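(* Let $\Xi$ be a translation invariant generalized stealthy random measure on $\mathbb{R}^d$ or $\mathbb{Z}^d$, i.e. one whose structure function $S$ vanishes on some nonempty open subset $U$ of the wave space ($U\subset\mathbb{R}^d$, resp. $U\subset\mathbb{T}^d$). Then for any bounded domain $D$, the restricted random measure $[\Xi]_{|D}$ is almost surely determined by the restricted random measure $[\Xi]_{|D^{\complement}}$; that is, there is a measurable function $F_D$ such that $[\Xi]_{|D}=F_D\big([\Xi]_{|D^{\complement}}\big)$ almost surely.
   Context: A random measure on $\mathbb{R}^d$ (resp. $\mathbb{Z}^d$) is a random variable $\Xi$ taking values in the space of locally finite complex Borel measures on $\mathbb{R}^d$ (resp. $\mathbb{Z}^d$). This includes point processes (via counting measures) and locally $L_1$ random fields $\{X_u\}$ (via $X_u\,\mathrm{d}u$). It is assumed that the total variation satisfies $\mathbb{E}[|\Xi|(K)^2]<\infty$ for every bounded $K$. $\Xi$ is translation invariant if its law is invariant under all translations by elements of $\mathbb{R}^d$ (resp. $\mathbb{Z}^d$). $D^{\complement}$ denotes the complement of $D$, and on $\mathbb{Z}^d$ a bounded domain means a finite subset. The covariance functional $\beta$ of $\Xi$ is defined by $$\mathrm{Cov}\Big[\int\varphi\,\mathrm{d}\Xi,\int\psi\,\mathrm{d}\Xi\Big]=\iint\varphi(s)\,\overline{\psi(t)}\,\beta(s-t)\,\mathrm{d}s\,\mathrm{d}t$$ for test functions $\varphi,\psi$, where $\mathrm{Cov}[X,Y]=\mathbb{E}[(X-\mathbb{E}X)\overline{(Y-\mathbb{E}Y)}]$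 (sums replace integrals on $\mathbb{Z}^d$; in general $\beta$ may be a measure or distribution). The structure function $S$ is the Fourier transform $\hat\beta$, with convention $\hat f(k)=\int f(x)e^{-i\langle k,x\rangle}\mathrm{d}x$; it lives on the wave space, which is $\mathbb{R}^d$ when the physical space is $\mathbb{R}^d$ and the torus $\mathbb{T}^d=\mathbb{R}^d/(2\pi\mathbb{Z})^d$ when the physical space is $\mathbb{Z}^d$. In general $S$ may be a nonnegative measure, in which case ''vanishes on $U$'' means $S(U)=0$. The set $U$ need not contain the origin. *)

(* Defs.v *)
From HB Require Import structures.
From mathcomp Require Import all_boot all_order all_algebra.
From mathcomp Require Import generic_quotient.
From mathcomp Require Import all_classical all_reals all_analysis.
From mathcomp Require Import complex.

Set Implicit Arguments.
Unset Strict Implicit.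
Unset Printing Implicit Defensive.
Import Order.TTheory GRing.Theory Num.Theory.
Import numFieldNormedType.Exports.
Local Open Scope classical_set_scope.
Local Open Scope ring_scope.
Local Open Scope complex_scope.

(** * Complex-valued sequences, functions and integrals *)

Definition ccvg {R : realType} (u : nat -> R[i]) (l : R[i]) : Prop :=
  (fun n => complex.Re (u n)) @ \oo --> complex.Re l /\
  (fun n => complex.Im (u n)) @ \oo --> complex.Im l.

Definition expi {R : realType} (t : R) : R[i] := cos t +i* sin t.

Definition cintegral {R : realType} {disp} {T : measurableType disp}
    (mu : set T -> \bar R) (D : set T) (f : T -> R[i]) : R[i] :=
  fine (\int[mu]_(x in D) (complex.Re (f x))%:E)%E
  +i* fine (\int[mu]_(x in D) (complex.Im (f x))%:E)%E.

Definition cintegrable {R : realType} {disp} {T : measurableType disp}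
    (mu : set T -> \bar R) (f : T -> R[i]) : Prop :=
  mu.-integrable setT (fun x => (complex.Re (f x))%:E) /\
  mu.-integrable setT (fun x => (complex.Im (f x))%:E).

Section covariance.
Context {R : realType} {disp} {Omega : measurableType disp}.
Variable P : probability Omega R.

Definition cexpectation (X : Omega -> R[i]) : R[i] :=
  fine 'E_P[fun w => complex.Re (X w)] +i* fine 'E_P[fun w => complex.Im (X w)].

Definition ccovariance (X Y : Omega -> R[i]) : R[i] :=
  cexpectation
    (fun w => (X w - cexpectation X) * (Y w - cexpectation Y)^*).

End covariance.

(** * Locally finite complex measures *)

Section lfcmeasure.
Context (R : realType) {disp} {T : measurableType disp}.
Variable bnd : set (set T).

(* A locally finite complex measure need not have a value on unbounded sets:
   it is a sigma-additive function on the delta-ring of bounded measurable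
   sets.  It is extended by 0 to all other sets, so that Leibniz equality is
   equality of measures. *)
Record lfcmeasure := LFCMeasure {
  lfc_val :> set T -> R[i] ;
  lfc_out : forall A, ~ (measurable A /\ bnd A) -> lfc_val A = 0 ;
  lfc_sigma_additive : forall F : nat -> set T,
    (forall n, measurable (F n)) -> trivIset setT F ->
    bnd (\bigcup_n F n) ->
    ccvg (fun n => \sum_(k < n) lfc_val (F k)) (lfc_val (\bigcup_n F n)) }.

Lemma lfc_eq (mu nu : lfcmeasure) : (mu : set T -> R[i]) = nu -> mu = nu.
Proof.
case: mu nu => [f fo fs] [g go gs] /= fg; subst g.
by congr LFCMeasure; exact: Prop_irrelevance.
Qed.

Lemma ccvg0 : ccvg (fun n => \sum_(k < n) (0 : R[i])) 0.
Proof.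
by rewrite /ccvg; split; apply: cvg_near_cst; near=> n; rewrite big1.
Unshelve. all: by end_near. Qed.

Definition lfc_zero : lfcmeasure :=
  @LFCMeasure (fun=> 0) (fun _ _ => erefl) (fun _ _ _ _ => ccvg0).

HB.instance Definition _ := gen_eqMixin lfcmeasure.
HB.instance Definition _ := gen_choiceMixin lfcmeasure.
HB.instance Definition _ := isPointed.Build lfcmeasure lfc_zero.

(* The sigma-algebra on the space of measures is the one generated by the
   evaluations mu |-> mu A, A bounded measurable. *)
Definition lfc_cylinder : set (set lfcmeasure) :=
  [set B | exists A (V : set R), [/\ measurable A, bnd A, measurable V &
     B = [set mu : lfcmeasure | V (complex.Re (mu A))] \/
     B = [set mu : lfcmeasure | V (complex.Im (mu A))]]].

Definition total_variation (mu : lfcmeasure) (K : set T) : \bar R :=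
  ereal_sup [set x | exists n (F : nat -> set T),
    [/\ (forall k, measurable (F k)), trivIset setT F,
        (forall k, F k `<=` K) &
        x = (\sum_(k < n) (Normc.normc (mu (F k)))%:E)%E]].

(* Jordan decomposition: a real locally finite measure nu is the difference of
   the positive variations of nu and of - nu. *)
Definition pos_variation (nu : set T -> R) (A : set T) : \bar R :=
  ereal_sup [set (nu B)%:E | B in
    [set B | [/\ measurable B, bnd B & B `<=` A]]].

Definition signed_integral (nu : set T -> R) (f : T -> R) : R :=
  fine (\int[pos_variation nu]_x (f x)%:E)%E -
  fine (\int[pos_variation (fun A => (- nu A)%R)]_x (f x)%:E)%E.

Definition lfc_integral (mu : lfcmeasure) (f : T -> R[i]) : R[i] :=
  let re A := complex.Re (mu A) in let im A := complex.Im (mu A) in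
  let a x := complex.Re (f x) in let b x := complex.Im (f x) in
  (signed_integral re a - signed_integral im b)
  +i* (signed_integral re b + signed_integral im a).

Section set_transformation.
Hypothesis bnd_sub : forall A B, A `<=` B -> bnd B -> bnd A.
Variable h : set T -> set T.
Hypothesis h_measurable : forall A, measurable A -> measurable (h A).
Hypothesis h_bnd : forall A, bnd A -> bnd (h A).
Hypothesis h_bigcup : forall F : nat -> set T,
  h (\bigcup_n F n) = \bigcup_n h (F n).
Hypothesis h_trivIset : forall F : nat -> set T,
  trivIset setT F -> trivIset setT (fun n => h (F n)).

Definition lfc_comp_val (mu : lfcmeasure) (A : set T) : R[i] :=
  if pselect (measurable A /\ bnd A) then mu (h A) else 0.

Lemma lfc_comp_out mu A : ~ (measurable A /\ bnd A) -> lfc_comp_val mu A = 0.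
Proof. by rewrite /lfc_comp_val; case: pselect. Qed.

Lemma lfc_comp_sigma_additive mu (F : nat -> set T) :
  (forall n, measurable (F n)) -> trivIset setT F -> bnd (\bigcup_n F n) ->
  ccvg (fun n => \sum_(k < n) lfc_comp_val mu (F k))
       (lfc_comp_val mu (\bigcup_n F n)).
Proof.
move=> mF tF bF.
have vF A : measurable A -> bnd A -> lfc_comp_val mu A = mu (h A).
  by move=> mA bA; rewrite /lfc_comp_val; case: pselect => // -[].
have bFn n : bnd (F n) by apply: bnd_sub bF; exact: bigcup_sup.
rewrite vF//; last exact: bigcupT_measurable.
rewrite h_bigcup (_ : (fun n => _) = fun n => \sum_(k < n) mu (h (F k))).
  apply: lfc_sigma_additive => [n||]; [exact: h_measurable|exact: h_trivIset|].
  by rewrite -h_bigcup; exact: h_bnd.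
by apply/funext => n; apply: eq_bigr => k _; rewrite vF.
Qed.

Definition lfc_comp (mu : lfcmeasure) : lfcmeasure :=
  LFCMeasure (@lfc_comp_out mu) (@lfc_comp_sigma_additive mu).

End set_transformation.

End lfcmeasure.

Notation lfc_space R bnd := (g_sigma_algebraType (@lfc_cylinder R _ _ bnd)).

Definition second_order {R : realType} {disp disp'}
    {Omega : measurableType disp} {T : measurableType disp'}
    {bnd : set (set T)} (P : probability Omega R)
    (Xi : Omega -> lfcmeasure R bnd) : Prop :=
  forall K, measurable K -> bnd K ->
    (\int[P]_w (total_variation (Xi w) K ^+ 2) < +oo)%E.

(** * Physical space R^d *)

Notation euclid R d := (g_sigma_algebraType (@open 'rV[R]_d)).

Definition boundedR {R : realType} {d} (A : set (euclid R d)) : Prop :=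
  bounded_set (A : set 'rV[R]_d).

Notation cmeasR R d := (lfc_space R (@boundedR R d)).

Definition dotp {R : realType} {d} (k x : 'rV[R]_d) : R :=
  \sum_(i < d) k 0 i * x 0 i.

Fixpoint lebesgue_rV (R : realType) (d : nat) : set (euclid R d) -> \bar R :=
  match d return set (euclid R d) -> \bar R with
  | 0 => @dirac _ (euclid R 0) (0 : 'rV[R]_0) R
  | d'.+1 => pushforward (@lebesgue_measure R \x @lebesgue_rV R d')%E
               (fun p : measurableTypeR R * euclid R d' =>
                 (row_mx (p.1)%:M (p.2 : 'rV[R]_d') : 'rV[R]_d'.+1)
                   : euclid R d'.+1)
  end.
Arguments lebesgue_rV {R} d.

Section euclid_operations.
Context {R : realType} {d : nat}.
Implicit Types (A B D : set (euclid R d)).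

Lemma boundedR_sub A B : A `<=` B -> boundedR B -> boundedR A.
Proof.
move=> AB; rewrite /boundedR /bounded_set /bounded_near /=.
by apply: filterS => M BM x Ax; apply: BM; exact: AB.
Qed.

Section restrict.
Variables (D : set (euclid R d)) (mD : measurable D).

Let setID_measurable A : measurable A -> measurable (A `&` D).
Proof. by move=> mA; exact: measurableI. Qed.

Let setID_bounded A : boundedR A -> boundedR (A `&` D).
Proof. by apply: boundedR_sub; exact: subIsetl. Qed.

Let setID_bigcup (F : nat -> set (euclid R d)) :
  (\bigcup_n F n) `&` D = \bigcup_n (F n `&` D).
Proof. exact: setI_bigcupl. Qed.

Let setID_trivIset (F : nat -> set (euclid R d)) :
  trivIset setT F -> trivIset setT (fun n => F n `&` D).
Proof. exact: trivIset_setIr. Qed.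

(* (restrictR mD mu) A = mu (A `&` D) for A bounded Borel *)
Definition restrictR : cmeasR R d -> cmeasR R d :=
  lfc_comp boundedR_sub setID_measurable setID_bounded setID_bigcup
    setID_trivIset.

End restrict.

Section translate.
Variable x : 'rV[R]_d.

Definition shiftR (A : set (euclid R d)) : set (euclid R d) :=
  [set y | A ((y : 'rV[R]_d) + x)].

Lemma shiftR_measurable A : measurable A -> measurable (shiftR A).
Proof.
move=> mA.
have mf : measurable_fun [set: euclid R d]
    ((fun y : 'rV[R]_d => y + x) : euclid R d -> euclid R d).
  apply: (@measurability _ _ (euclid R d) (euclid R d) setT _ (@open 'rV[R]_d))
    => // _ [B oB <-].
  rewrite setTI; apply: sub_gen_smallest; apply: open_comp => // y _.
  apply: (@continuousD R 'rV[R]_d _ id (cst x)); first by move=> ?; exact: cvg_id.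
  exact: cst_continuous.
by rewrite -[shiftR A]setTI; exact: mf.
Qed.

Lemma shiftR_bounded A : boundedR A -> boundedR (shiftR A).
Proof.
move=> [M [Mr AM]]; exists (M + `|x|); split; first exact: num_real.
move=> r Mxr y Ay; have yxr : `|y + x| <= r - `|x| by apply: AM Ay; rewrite ltrBrDr.
suff: `|y + x - x| <= r by rewrite addrK.
by rewrite (le_trans (ler_normB _ _))// -lerBrDr.
Qed.

Let shiftR_bigcup (F : nat -> set (euclid R d)) :
  shiftR (\bigcup_n F n) = \bigcup_n shiftR (F n).
Proof. by []. Qed.

Let shiftR_trivIset (F : nat -> set (euclid R d)) :
  trivIset setT F -> trivIset setT (fun n => shiftR (F n)).
Proof. by move=> tF i j _ _ [y [Fi Fj]]; apply: tF => //; exists (y + x). Qed.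

(* push-forward under y |-> y + x *)
Definition translateR : cmeasR R d -> cmeasR R d :=
  lfc_comp boundedR_sub shiftR_measurable shiftR_bounded shiftR_bigcup
    shiftR_trivIset.

End translate.

End euclid_operations.

Section structure_function_euclid.
Context {R : realType} {d : nat}.
Implicit Types (f phi psi : 'rV[R]_d -> R[i]).

(* the partial derivative d_(i_1) ... d_(i_m) g for s = [:: i_1; ..; i_m] *)
Definition pderiv (s : seq 'I_d) (g : 'rV[R]_d -> R) : 'rV[R]_d -> R :=
  foldr (fun i h => fun x => 'D_(delta_mx 0 i : 'rV[R]_d) h x) g s.

Definition smooth f : Prop := forall s (x : 'rV[R]_d),
  differentiable (pderiv s (fun y => complex.Re (f y))) x /\
  differentiable (pderiv s (fun y => complex.Im (f y))) x.

Definition test_function f : Prop :=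
  smooth f /\ bounded_set [set x | f x != 0].

(* the seminorms of order N of f are all at most C *)
Definition seminorm_le (N : nat) (C : R) f : Prop :=
  forall s : seq 'I_d, (size s <= N)%N -> forall x : 'rV[R]_d,
    (1 + `|x|) ^+ N * `|pderiv s (fun y => complex.Re (f y)) x| <= C /\
    (1 + `|x|) ^+ N * `|pderiv s (fun y => complex.Im (f y)) x| <= C.

Definition schwartz f : Prop :=
  smooth f /\ forall N, exists C, seminorm_le N C f.

(* only the values of beta on Schwartz functions are relevant *)
Definition tempered_distribution (beta : ('rV[R]_d -> R[i]) -> R[i]) : Prop :=
  (forall (a : R[i]) f g, schwartz f -> schwartz g ->
     beta (fun x => a * f x + g x) = a * beta f + beta g) /\
  (exists N (K : R), forall f C, schwartz f -> seminorm_le N C f ->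
     Normc.normc (beta f) <= K * C).

Definition fourier f (k : 'rV[R]_d) : R[i] :=
  cintegral (lebesgue_rV d) setT (fun x => f x * expi (- dotp k x)).

(* Substituting s = x + t,
     int int phi(s) (psi(t))^* beta(s - t) ds dt
       = int (int phi(x + t) (psi(t))^* dt) beta(x) dx
       = < beta, correlation phi psi >. *)
Definition correlation phi psi (x : 'rV[R]_d) : R[i] :=
  cintegral (lebesgue_rV d) setT
    (fun t : 'rV[R]_d => phi (x + t) * (psi t)^*).

Definition covariance_functionalR {disp} {Omega : measurableType disp}
    (P : probability Omega R) (Xi : Omega -> cmeasR R d)
    (beta : ('rV[R]_d -> R[i]) -> R[i]) : Prop :=
  tempered_distribution beta /\
  forall phi psi, test_function phi -> test_function psi ->
    ccovariance P (fun w => lfc_integral (Xi w) phi)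
                  (fun w => lfc_integral (Xi w) psi) =
    beta (correlation phi psi).

(* S is the Fourier transform of the tempered distribution beta:
   < S, f > = < beta, fourier f >; the integrability condition says that S is
   a tempered measure *)
Definition structure_functionR (beta : ('rV[R]_d -> R[i]) -> R[i])
    (S : {measure set (euclid R d) -> \bar R}) : Prop :=
  forall f, schwartz f ->
    cintegrable S f /\ cintegral S setT f = beta (fourier f).

Definition translation_invariantR {disp} {Omega : measurableType disp}
    (P : probability Omega R) (Xi : Omega -> cmeasR R d) : Prop :=
  forall (x : 'rV[R]_d) (B : set (cmeasR R d)), measurable B ->
    pushforward P (fun w => translateR x (Xi w)) B = pushforward P Xi B.

Definition generalized_stealthyR {disp} {Omega : measurableType disp}
    (P : probability Omega R) (Xi : Omega -> cmeasR R d) : Prop :=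
  exists beta (S : {measure set (euclid R d) -> \bar R}) (U : set 'rV[R]_d),
    [/\ covariance_functionalR P Xi beta, structure_functionR beta S,
        open U, U !=set0 & S U = 0%E].

End structure_function_euclid.

(** * Physical space Z^d and wave space T^d = R^d / (2 pi Z)^d *)

HB.instance Definition _ := isPointed.Build int 0.

Notation lattice d := (g_sigma_algebraType [set: set 'rV[int]_d]).

Notation cmeasZ R d := (lfc_space R (@finite_set (lattice d))).

Section lattice_operations.
Context {R : realType} {d : nat}.
Implicit Types (A B D : set (lattice d)).

Lemma measurable_lattice A : measurable A.
Proof. exact: sub_gen_smallest. Qed.

Section restrict.
Variable D : set (lattice d).

Let setID_measurable A : measurable A -> measurable (A `&` D).
Proof. by move=> _; exact: measurable_lattice. Qed.

Let setID_finite A : finite_set A -> finite_set (A `&` D).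
Proof. exact: finite_setIl. Qed.

Let setID_bigcup (F : nat -> set (lattice d)) :
  (\bigcup_n F n) `&` D = \bigcup_n (F n `&` D).
Proof. exact: setI_bigcupl. Qed.

Let setID_trivIset (F : nat -> set (lattice d)) :
  trivIset setT F -> trivIset setT (fun n => F n `&` D).
Proof. exact: trivIset_setIr. Qed.

Definition restrictZ : cmeasZ R d -> cmeasZ R d :=
  lfc_comp (@sub_finite_set _) setID_measurable setID_finite setID_bigcup
    setID_trivIset.

End restrict.

Section translate.
Variable x : 'rV[int]_d.

Definition shiftZ A : set (lattice d) := [set y | A ((y : 'rV[int]_d) + x)].

Let shiftZ_measurable A : measurable A -> measurable (shiftZ A).
Proof. by move=> _; exact: measurable_lattice. Qed.

Lemma shiftZ_finite A : finite_set A -> finite_set (shiftZ A).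
Proof.
move=> fA; apply: (@sub_finite_set _ _ [set z - x | z in (A : set 'rV[int]_d)]).
  by move=> y Ay; exists (y + x) => //; rewrite addrK.
exact: finite_image.
Qed.

Let shiftZ_bigcup (F : nat -> set (lattice d)) :
  shiftZ (\bigcup_n F n) = \bigcup_n shiftZ (F n).
Proof. by []. Qed.

Let shiftZ_trivIset (F : nat -> set (lattice d)) :
  trivIset setT F -> trivIset setT (fun n => shiftZ (F n)).
Proof. by move=> tF i j _ _ [y [Fi Fj]]; apply: tF => //; exists (y + x). Qed.

Definition translateZ : cmeasZ R d -> cmeasZ R d :=
  lfc_comp (@sub_finite_set _) shiftZ_measurable shiftZ_finite shiftZ_bigcup
    shiftZ_trivIset.

End translate.

End lattice_operations.

Section torus.
Context (R : realType) (d : nat).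

Definition vec_of_int (n : 'rV[int]_d) : 'rV[R]_d := map_mx intr n.

Definition torus_rel (x y : 'rV[R]_d) : bool :=
  `[< exists n : 'rV[int]_d, x - y = (2 * pi) *: vec_of_int n >].

Lemma torus_relxx : reflexive torus_rel.
Proof.
by move=> x; apply/asboolP; exists 0; rewrite /vec_of_int map_mx0 scaler0 subrr.
Qed.

Lemma torus_rel_sym : symmetric torus_rel.
Proof.
have H x y : torus_rel x y -> torus_rel y x.
  move=> /asboolP[n xy]; apply/asboolP; exists (- n).
  by rewrite /vec_of_int map_mxN scalerN -xy opprB.
by move=> x y; apply/idP/idP; exact: H.
Qed.

Lemma torus_rel_trans : transitive torus_rel.
Proof.
move=> y x z /asboolP[m xy] /asboolP[n yz]; apply/asboolP; exists (m + n).
by rewrite /vec_of_int map_mxD scalerDr -xy -yz addrA subrK.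
Qed.

Canonical torus_equiv := EquivRel torus_rel torus_relxx torus_rel_sym
  torus_rel_trans.

Definition torus := quotient_topology {eq_quot torus_equiv}%qT.

End torus.

Notation borel_torus R d := (g_sigma_algebraType (@open (torus R d))).

Section structure_function_lattice.
Context {R : realType} {d : nat}.

Definition finitely_supported (phi : 'rV[int]_d -> R[i]) : Prop :=
  finite_set [set n | phi n != 0].

Definition covariance_functionalZ {disp} {Omega : measurableType disp}
    (P : probability Omega R) (Xi : Omega -> cmeasZ R d)
    (beta : 'rV[int]_d -> R[i]) : Prop :=
  forall phi psi, finitely_supported phi -> finitely_supported psi ->
    ccovariance P (fun w => lfc_integral (Xi w) phi)
                  (fun w => lfc_integral (Xi w) psi) =
    \sum_(s \in [set: 'rV[int]_d]) \sum_(t \in [set: 'rV[int]_d])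
      phi s * (psi t)^* * beta (s - t).

Definition periodic (f : 'rV[R]_d -> R[i]) : Prop :=
  forall (n : 'rV[int]_d) x, f (x + (2 * pi) *: vec_of_int R n) = f x.

Definition fundamental_cell : set (euclid R d) :=
  [set k : 'rV[R]_d | forall i, 0 <= k 0 i < 2 * pi].

Definition fourier_coefficient (f : 'rV[R]_d -> R[i]) (n : 'rV[int]_d) : R[i] :=
  cintegral (lebesgue_rV d) fundamental_cell
    (fun k => f k * expi (- dotp k (vec_of_int R n))).

Definition box (N : nat) : set 'rV[int]_d :=
  [set n | forall i, `|n 0 i| <= N%:Z].

(* S is the Fourier transform of beta in the sense of distributions on T^d:
   < S, f > = < beta, fourier_coefficient f > for every smooth function f on
   T^d, i.e. every smooth periodic function f on R^d *)
Definition structure_functionZ (beta : 'rV[int]_d -> R[i])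
    (S : {finite_measure set (borel_torus R d) -> \bar R}) : Prop :=
  forall f, smooth f -> periodic f ->
    ccvg (fun N => \sum_(n \in box N) beta n * fourier_coefficient f n)
         (cintegral S setT (fun k : torus R d => f (repr k))).

Definition translation_invariantZ {disp} {Omega : measurableType disp}
    (P : probability Omega R) (Xi : Omega -> cmeasZ R d) : Prop :=
  forall (x : 'rV[int]_d) (B : set (cmeasZ R d)), measurable B ->
    pushforward P (fun w => translateZ x (Xi w)) B = pushforward P Xi B.

Definition generalized_stealthyZ {disp} {Omega : measurableType disp}
    (P : probability Omega R) (Xi : Omega -> cmeasZ R d) : Prop :=
  exists beta (S : {finite_measure set (borel_torus R d) -> \bar R})
    (U : set (torus R d)),
    [/\ covariance_functionalZ P Xi beta, structure_functionZ beta S,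
        open U, U !=set0 & S U = 0%E].

End structure_function_lattice.

(* Main.v *)
(** Suppose that S vanishes near -a. There are weights phi_n of bounded support
    with |phi_n| <= 1 and phi_n(x) -> exp(i<a,x>) such that the variance of
    Z_n = \int phi_n dXi, which is the S-integral of the squared modulus of the
    Fourier transform of phi_n, tends to 0. On Z^d one takes
    phi_n(s) = exp(i<a,s>) \prod_j C(2n, n + s_j) / C(2n, n), whose transform
    is a power of 1 + exp(it) that decays geometrically away from -a relative
    to its value there. On R^d one takes phi_n(x) = exp(i<a,x>) \prod_j b(x_j / n)
    for a smooth bump b; its transform concentrates at -a with rapidly decreasing
    tails, and S(B_r) = O(r^(2d)) because linear statistics of small support
    have bounded variance.

    Along a subsequence Z_n - E Z_n -> 0 almost surely, hence
    \int_D exp(i<a,x>) dXi = lim (E Z_n - \int_{D^c} phi_n dXi) is a function of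
    the restriction of Xi to D^c. As a ranges over an open set, differentiation
    in a yields the integrals over D of x^alpha exp(i<a,x>), then, by polynomial
    approximation and a monotone class argument, those of g(x) exp(i<a,x>) for
    bounded measurable g, in particular Xi(A `&` D) for every Borel set A.

    It remains to choose one measurable map for all A at once. The space is
    embedded in Cantor space, and the values of Xi on the countably many cells
    determine its Jordan decomposition; each part is the image of the Lebesgue
    measure on an interval under a quantile map, and this construction makes
    sense for every nonnegative additive function of cells, whether or not it
    comes from a measure on the original space. *)

Require Import Defs.
From HB Require Import structures.
From mathcomp Require Import all_boot all_order all_algebra.
From mathcomp Require Import all_classical all_reals all_analysis.
From mathcomp Require Import measurable_realfun finmap complex ring lra zify.
Set Implicit Arguments.
Unset Strict Implicit.
Unset Printing Implicit Defensive.
Import Order.TTheory GRing.Theory Num.Theory.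
Import numFieldNormedType.Exports.
Import HBNNSimple.
Local Open Scope classical_set_scope.
Local Open Scope ring_scope.

(** * Integration against locally finite complex measures *)

Section real_local_measures.
Context {R : realType} {d} {T : measurableType d}.
Variable bnd : set (set T).

(** On Z^d the measure S is finite, so a uniform bound on the squared transform off the vanishing
    set suffices; the normalization costs only a polynomial factor, C(2n, n) being at least 4^n /
    (2n + 1). On R^d, where S may be infinite, one variance identity serves twice: packets shrinking
    inside a fixed cube control the growth of S, and widening packets then exploit the decay of the
    transform. Since S is tested on Schwartz functions only, through [beta] of their transforms, the
    autocorrelation of a packet has to be exhibited as a Fourier transform; hence an inversion
    formula for the single function [bump].

    One wave yields one number about the hidden part; it is the openness of the set of directions
    that yields all polynomial moments. The resulting functions of the outside are fixed only up to
    null sets, and on an exceptional configuration their values need not fit together into a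
    measure. The final map must nonetheless be measurable and measure-valued everywhere, which
    forces a reconstruction that accepts inconsistent data and replaces it by zero. *)

Definition bornology : Prop := [/\ bnd set0,
  forall A B, A `<=` B -> bnd B -> bnd A &
  forall A B, bnd A -> bnd B -> bnd (A `|` B)].

Definition locally_sigma_additive (nu : set T -> R) : Prop :=
  forall F : nat -> set T, (forall n, measurable (F n)) -> trivIset setT F ->
    bnd (\bigcup_n F n) ->
    (fun n => \sum_(k < n) nu (F k)) @ \oo --> nu (\bigcup_n F n).

Lemma locally_sigma_additiveN nu : locally_sigma_additive nu ->
  locally_sigma_additive (fun A => - nu A).
Proof.
move=> h F mF tF bF; under eq_fun do rewrite sumrN.
by apply: cvgN; exact: h.
Qed.

Hypothesis bornol : bornology.

Let bnd0 : bnd set0. Proof. by case: bornol. Qed.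
Let bnd_sub A B : A `<=` B -> bnd B -> bnd A. Proof. by case: bornol => _ + _; exact. Qed.
Let bndU A B : bnd A -> bnd B -> bnd (A `|` B). Proof. by case: bornol => _ _; exact. Qed.

Variables (nu : set T -> R) (nus : locally_sigma_additive nu).

(** The partial sums over a constant family of empty sets are the multiples of [nu set0]; as they
    converge, their constant increment [nu set0] tends to 0. *)
Lemma lsa0 : nu set0 = 0.
Proof.
have := @nus (fun=> set0) (fun=> measurable0).
rewrite bigcup0// => /(_ _ bnd0) h; have {h} h := h _.
have {h} h : (fun n => \sum_(k < n) nu set0) @ \oo --> nu set0.
  by apply: h => i j _ _ [x []].
have h1 : (fun n => \sum_(k < n.+1) nu set0) @ \oo --> nu set0.
  by rewrite (cvg_shiftS (fun n => \sum_(k < n) nu set0)).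
have E : (fun n => \sum_(k < n.+1) nu set0) - (fun n => \sum_(k < n) nu set0) =
    cst (nu set0).
  apply/funext => n /=.
  rewrite [LHS](_ : _ = \sum_(k < n.+1) nu set0 - \sum_(k < n) nu set0)//.
  by rewrite big_ord_recr/= [X in X - _]addrC addrK.
have h2 : cst (nu set0) @ \oo --> (0 : R).
  by rewrite -(subrr (nu set0)) -{1}E; exact: cvgB.
by apply: (cvg_unique _ _ h2); [exact: norm_hausdorff|exact: cvg_cst].
Qed.

Lemma lsaU A B : measurable A -> measurable B -> bnd A -> bnd B ->
  A `&` B = set0 -> nu (A `|` B) = nu A + nu B.
Proof.
move=> mA mB bA bB AB.
have := @nus (bigcup2 A B).
rewrite bigcup2E => h; have {h} h : (fun n => \sum_(k < n) nu (bigcup2 A B k)) @ \oo --> nu (A `|` B).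
  apply: h; [|by rewrite -trivIset_bigcup2|exact: bndU].
  by move=> [|[|n]]/=.
suff h2 : (fun n => \sum_(k < n) nu (bigcup2 A B k)) @ \oo --> nu A + nu B.
  by apply: (cvg_unique _ h h2); exact: norm_hausdorff.
apply: cvg_near_cst; exists 2%N => // -[|[|n]]//= _.
by rewrite 2!big_ord_recl/= big1 ?addr0// => i _; exact: lsa0.
Qed.

Local Open Scope ereal_scope.

Let pv := pos_variation bnd nu.

Lemma pos_variation_ub A B : measurable B -> bnd B -> B `<=` A -> (nu B)%:E <= pv A.
Proof. by move=> mB bB BA; apply: ereal_sup_ubound; exists B. Qed.

Lemma pos_variation_le A M :
  (forall B, measurable B -> bnd B -> B `<=` A -> (nu B)%:E <= M) -> pv A <= M.
Proof. by move=> h; apply: ge_ereal_sup => _ [B [mB bB BA] <-]; exact: h. Qed.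

Lemma pos_variation_ge0 A : 0 <= pv A.
Proof. by rewrite -[0]/(0%R%:E) -lsa0; exact: pos_variation_ub. Qed.

Lemma pos_variationS A B : A `<=` B -> pv A <= pv B.
Proof.
move=> AB; apply: pos_variation_le => C mC bC CA; apply: pos_variation_ub => //.
exact: subset_trans AB.
Qed.

Lemma pos_variation0 : pv set0 = 0.
Proof.
apply/eqP; rewrite eq_le pos_variation_ge0 andbT.
by apply: pos_variation_le => B _ _; rewrite subset0 => ->; rewrite lsa0.
Qed.

(** Competitors for A and for B are disjoint, so their union competes for the union. The variation
    of the union is taken finite after a case split, because the two suprema are reached one after
    the other by subtraction. *)
Lemma pos_variation_superadd A B : A `&` B = set0 ->
  pv A + pv B <= pv (A `|` B).
Proof.
move=> AB; have := pos_variation_ge0 (A `|` B).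
case Eu : (pv (A `|` B)) => [u| |]// _; last by rewrite leey.
have h C D : measurable C -> bnd C -> C `<=` A -> measurable D -> bnd D -> D `<=` B ->
    ((nu C)%:E + (nu D)%:E <= u%:E).
  move=> mC bC CA mD bD DB; rewrite -Eu -EFinD -lsaU//.
    apply: pos_variation_ub; [exact: measurableU|exact: bndU|exact: setUSS].
  by apply/seteqP; split => // x [Cx Dx]; rewrite -AB; split; [exact: CA|exact: DB].
have h2 D : measurable D -> bnd D -> D `<=` B -> pv A + (nu D)%:E <= u%:E.
  move=> mD bD DB; rewrite -leeBrDr//; apply: pos_variation_le => C mC bC CA.
  by rewrite leeBrDr//; exact: h.
have pA : pv A \is a fin_num.
  rewrite ge0_fin_numE ?pos_variation_ge0// (@le_lt_trans _ _ u%:E) ?ltry//.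
  by rewrite -Eu; apply: pos_variationS; exact: subsetUl.
rewrite addeC -leeBrDr//; apply: pos_variation_le => D mD bD DB.
by rewrite leeBrDr// addeC; exact: h2.
Qed.

(** In one direction a competitor for the union is cut along the pieces; in the other,
    superadditivity on finite unions passes to the limit by monotonicity. Infinite values are
    allowed throughout. *)
Lemma pos_variation_sigma_additive : semi_sigma_additive pv.
Proof.
move=> F mF tF mUF.
have -> : pv (\bigcup_n F n) = \sum_(0 <= n <oo) pv (F n); last first.
  by apply: is_cvg_nneseries => n _ _; exact: pos_variation_ge0.
apply/eqP; rewrite eq_le; apply/andP; split.
- apply: pos_variation_le => B mB bB BF.
  have BE : B = \bigcup_n (B `&` F n) by rewrite -setI_bigcupr; apply/esym/setIidl.
  have cvgB : (fun n => \sum_(k < n) nu (B `&` F k))%R @ \oo --> nu B.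
    rewrite {2}BE; apply: nus; last by rewrite -BE.
      by move=> n; exact: measurableI.
    exact: trivIset_setIl.
  have /cvg_lim <- // : (fun n => (\sum_(k < n) nu (B `&` F k))%:E) @ \oo --> (nu B)%:E.
    by apply/cvg_EFin => //; apply: nearW.
  apply: lee_lim.
  + by apply/cvg_ex; exists (nu B)%:E; apply: cvg_EFin => //; exact: nearW.
  + by apply: is_cvg_nneseries => n _ _; exact: pos_variation_ge0.
  + apply: nearW => n; rewrite big_mkord -sumEFin; apply: lee_sum => i _.
    apply: pos_variation_ub; [exact: measurableI| |exact: subIsetr].
    by apply: bnd_sub bB; exact: subIsetl.
- apply: lime_le.
    by apply: is_cvg_nneseries => n _ _; exact: pos_variation_ge0.
  apply: nearW => n; rewrite big_mkord.
  apply: (@le_trans _ _ (pv (\big[setU/set0]_(k < n) F k))); last first.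
    by apply: pos_variationS; exact: bigsetU_bigcup.
  elim: n => [|n ih]; first by rewrite !big_ord0 pos_variation_ge0.
  rewrite 2!big_ord_recr/= (le_trans (leeD2r _ ih))//.
  apply: pos_variation_superadd; apply/seteqP; split => // x [].
  rewrite -bigcup_mkord => -[k/= kn Fk] Fn.
  by have := tF k n I I (ex_intro _ x (conj Fk Fn)) => E; move: kn; rewrite E ltnn.
Qed.

Lemma pos_variation_measure :
  exists m : {measure set T -> \bar R}, (m : set T -> \bar R) = pv.
Proof.
pose ms := isMeasure.Build d T R pv pos_variation0 pos_variation_ge0 pos_variation_sigma_additive.
pose c : {measure set T -> \bar R} := HB.pack pv ms.
by exists c.
Qed.

(** The trace of [nu] on K is a finite charge. With P the positive set of a Hahn decomposition, the
    value of a competitor does not decrease when its part in the negative set is dropped and the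
    rest is enlarged to the part of K in P; the supremum is thus at most one finite value of
    [nu]. *)
Lemma pos_variation_lty K : measurable K -> bnd K -> pv K < +oo.
Proof.
move=> mK bK.
pose c A := (nu (A `&` K))%:E.
have c0 : c set0 = 0 by rewrite /c set0I lsa0.
have cf A : measurable A -> c A \is a fin_num by [].
have cs : semi_sigma_additive c.
  move=> F mF tF mUF; rewrite /c setI_bigcupl.
  have : (fun n => \sum_(k < n) nu (F k `&` K))%R @ \oo --> nu (\bigcup_i (F i `&` K)).
    apply: nus.
    - by move=> n; exact: measurableI.
    - exact: trivIset_setIr.
    - by apply: bnd_sub bK => x [n _ []].
  move=> h; under eq_fun do rewrite big_mkord sumEFin.
  by apply: cvg_EFin => //; exact: nearW.
pose cm := isCharge.Build d T R c c0 cf cs.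
pose ch : {charge set T -> \bar R} := HB.pack c cm.
have [P [N [posP negN PNT PN0]]] := Hahn_decomposition ch.
apply: (@le_lt_trans _ _ (nu (P `&` K))%:E); last by rewrite ltry.
apply: pos_variation_le => B mB bB BK.
have mP := posP.1; have mN := negN.1.
have eB : nu B = (nu (B `&` P) + nu (B `&` N))%R.
  rewrite -lsaU.
  + by rewrite -setIUr PNT setIT.
  + exact: measurableI.
  + exact: measurableI.
  + by apply: bnd_sub bB; exact: subIsetl.
  + by apply: bnd_sub bB; exact: subIsetl.
  + by rewrite setIACA PN0 setI0.
have h1 : (nu (B `&` N) <= 0)%R.
  have := negN.2 (B `&` N) (measurableI _ _ mB mN) (@subIsetr _ _ _).
  by rewrite /= /c lee_fin setIAC (setIidl BK).
have h2 : (nu (P `&` K) = nu (B `&` P) + nu ((P `\` B) `&` K))%R.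
  rewrite -lsaU.
  + congr nu; apply/seteqP; split=> x.
      move=> [Px Kx]; have [Bx|Bx] := pselect (B x); first by left.
      by right.
    by move=> [[Bx Px]|[[Px _]]]//; split => //; exact: BK.
  + exact: measurableI.
  + by apply: measurableI => //; exact: measurableD.
  + by apply: bnd_sub bB; exact: subIsetl.
  + by apply: bnd_sub bK; exact: subIsetr.
  + by apply/seteqP; split=> x// [[? ?] [[]]].
have h3 : (0 <= nu ((P `\` B) `&` K))%R.
  have := posP.2 (P `\` B) (measurableD mP mB) (@subDsetl _ _ _).
  by rewrite /= /c lee_fin.
by rewrite lee_fin eB h2 lerD// (le_trans h1).
Qed.

End real_local_measures.

(** Jordan decomposition: passing from a competitor B to its complement in A exchanges the two
    variations, because [nu B] is [nu A] minus the value on the complement. Both inequalities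
    follow, the finiteness of the variations on A allowing the subtraction. *)
Lemma pos_variation_sub {R : realType} {d} {T : measurableType d} (bnd : set (set T))
    (nu : set T -> R) A : bornology bnd -> locally_sigma_additive bnd nu ->
  measurable A -> bnd A ->
  fine (pos_variation bnd nu A) - fine (pos_variation bnd (fun B => - nu B) A) = nu A.
Proof.
move=> bb sn mA bA; have snN := locally_sigma_additiveN sn.
have [b0 bs bU] := bb.
have f1 : pos_variation bnd nu A \is a fin_num.
  by rewrite ge0_fin_numE ?(pos_variation_ge0 bb sn)// (pos_variation_lty bb sn).
have f2 : pos_variation bnd (fun B => - nu B) A \is a fin_num.
  by rewrite ge0_fin_numE ?(pos_variation_ge0 bb snN)// (pos_variation_lty bb snN).
have split B : measurable B -> B `<=` A -> nu A = nu B + nu (A `\` B).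
  move=> mB BA; rewrite -(lsaU bb sn)//.
  - by rewrite setDUK.
  - exact: measurableD.
  - exact: bs bA.
  - by apply: bs bA; exact: subDsetl.
  - by rewrite setDIK.
apply/eqP; rewrite eq_le lerBlDr -lee_fin EFinD !fineK//; apply/andP; split.
  apply: pos_variation_le => B mB bB BA.
  have -> : nu B = nu A + - nu (A `\` B) by rewrite (split B)// addrK.
  rewrite EFinD leeD2l//; apply: (@pos_variation_ub _ _ _ bnd (fun B => - nu B)).
  - exact: measurableD.
  - by apply: bs bA; exact: subDsetl.
  - exact: subDsetl.
rewrite lerBrDr -lee_fin EFinD !fineK// addeC -leeBrDr//.
apply: pos_variation_le => B mB bB BA; rewrite leeBrDr// addeC -EFinD.
have -> : nu A + - nu B = nu (A `\` B) by rewrite (split B)// addrC addKr.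
apply: pos_variation_ub.
- exact: measurableD.
- by apply: bs bA; exact: subDsetl.
- exact: subDsetl.
Qed.

Section bounded_functions.
Context {R : realType} {d} {T : measurableType d}.
Implicit Types (K : set T) (f : T -> R).

Definition bounded_supported K f : Prop :=
  [/\ measurable_fun setT f, exists C : R, forall x, `|f x| <= C &
      forall x, ~ K x -> f x = 0].

Lemma bounded_supported_indic K A : measurable A -> A `<=` K ->
  bounded_supported K \1_A.
Proof.
move=> mA AK; split; first exact: measurable_indic.
  by exists 1 => x; rewrite indicE; case: (_ \in _); rewrite ?normr1// normr0.
by move=> x Kx; rewrite indicE memNset// => /AK.
Qed.

Lemma bounded_supported_lin K a f g : bounded_supported K f ->
  bounded_supported K g -> bounded_supported K (fun x => a * f x + g x).
Proof.
move=> [mf [C fC] f0] [mg [C' gC] g0]; split.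
- by apply: measurable_funD => //; exact: measurable_funM.
- exists (`|a| * C + C') => x; rewrite (le_trans (ler_normD _ _))// lerD//.
  by rewrite normrM ler_wpM2l.
- by move=> x Kx; rewrite f0// g0// mulr0 addr0.
Qed.

Lemma bounded_supportedS K K' f : K `<=` K' -> bounded_supported K f ->
  bounded_supported K' f.
Proof. by move=> KK [mf bf f0]; split => // x Kx; apply: f0 => /KK. Qed.

Lemma bounded_supportedM K K' f g : bounded_supported K f ->
  bounded_supported K' g -> bounded_supported (K `&` K') (fun x => f x * g x).
Proof.
move=> [mf [C fC] f0] [mg [C' gC] g0]; split.
- exact: measurable_funM.
- by exists (C * C') => x; rewrite normrM ler_pM.
- move=> x; have [Kx|Kx] := pselect (K x); last by rewrite f0// mul0r.
  have [K'x h|K'x _] := pselect (K' x); last by rewrite g0// mulr0.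
  by case: h.
Qed.

(** Functional form of the monotone class theorem, for bounded functions vanishing off a fixed set:
    simple functions are linear combinations of indicators, nonnegative functions are bounded limits
    of simple ones, and the general case is a difference of positive and negative parts. *)
Lemma bounded_supported_ind K (Q : (T -> R) -> Prop) :
  (forall A, measurable A -> A `<=` K -> Q \1_A) ->
  (forall a f g, bounded_supported K f -> bounded_supported K g ->
     Q f -> Q g -> Q (fun x => a * f x + g x)) ->
  (forall (F : nat -> T -> R) f (C : R), (forall n, bounded_supported K (F n)) ->
     (forall n x, `|F n x| <= C) -> bounded_supported K f ->
     (forall x, F ^~ x @ \oo --> f x) ->
     (forall n, Q (F n)) -> Q f) ->
  forall f, bounded_supported K f -> Q f.
Proof.
move=> Qi Ql Qc.
have Q0 : Q (fun=> 0).
  rewrite (_ : (fun=> 0) = \1_set0); first exact: Qi.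
  by apply/funext => x; rewrite indic0.
have b0 : bounded_supported K (fun=> 0).
  by split => //; [exists 0 => x; rewrite normr0].
have Qpos f : bounded_supported K f -> (forall x, 0 <= f x) -> Q f.
  move=> bf f0; have [mf [C fC] fK] := bf.
  have mfE : measurable_fun setT (EFin \o f) by exact/measurable_EFinP.
  pose g := nnsfun_approx measurableT mfE.
  have fE0 x : setT x -> (0 <= (EFin \o f) x)%E by move=> _; rewrite lee_fin.
  have cg x : (fun n => g n x) @ \oo --> f x.
    have := cvg_nnsfun_approx measurableT mfE fE0 (I : setT x).
    by move/fine_cvgP => [_].
  have gf n x : g n x <= f x.
    have nd : nondecreasing_seq (fun n => g n x).
      by move=> m k mk; have /lefP := nd_nnsfun_approx measurableT mfE mk; exact.
    have := nondecreasing_cvgn_le nd (cvgP _ (cg x)) n.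
    by rewrite (cvg_lim _ (cg x)).
  (* The level 0 is discarded, its preimage being too large: only the other level sets are contained
     in K, since the approximations lie between 0 and f. *)
  pose A n y := if y == 0 then set0 else g n @^-1` [set y].
  have mA n y : measurable (A n y) by rewrite /A; case: ifP.
  have AK n y : A n y `<=` K.
    rewrite /A; case: ifPn => [_ //|y0 x /= gxy]; apply: contrapT => Kx.
    move/negP : y0; apply; rewrite -gxy eq_le -{1}(fK _ Kx) gf/=.
    exact: fun_ge0.
  have gsum n : (g n : T -> R) = fun x =>
      \sum_(y <- (fset_set (range (g n)) : seq R)) y * \1_(A n y) x.
    apply/funext => x; rewrite fimfunE fsbig_finite//=.
    apply: eq_bigr => y _; rewrite /A; case: ifPn => // /eqP ->.
    by rewrite !mul0r.
  have Qsum n (s : seq R) :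
      bounded_supported K (fun x => \sum_(y <- s) y * \1_(A n y) x) /\
      Q (fun x => \sum_(y <- s) y * \1_(A n y) x).
    elim: s => [|y s [ih1 ih2]]; first by under eq_fun do rewrite big_nil.
    under eq_fun do rewrite big_cons; split.
      by apply: bounded_supported_lin => //; exact: bounded_supported_indic.
    by apply: Ql => //; [exact: bounded_supported_indic|exact: Qi].
  apply: (Qc (fun n => g n : T -> R) _ C) => //.
  - by move=> n; rewrite gsum; exact: (Qsum n _).1.
  - move=> n x; rewrite ger0_norm ?fun_ge0// (le_trans (gf n x))//.
    by rewrite (le_trans _ (fC x))// ler_norm.
  - by move=> n; rewrite gsum; exact: (Qsum n _).2.
move=> f [mf [C fC] fK].
have bp : bounded_supported K f^\+.
  split; first exact: measurable_funrpos.
    exists C => x; rewrite ger0_norm ?funrpos_ge0// /funrpos ge_max.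
    by rewrite (le_trans _ (fC x)) ?ler_norm// (le_trans _ (fC x)).
  by move=> x Kx; rewrite /funrpos fK// maxxx.
have bn : bounded_supported K f^\-.
  split; first exact: measurable_funrneg.
    exists C => x; rewrite ger0_norm ?funrneg_ge0// /funrneg ge_max.
    rewrite (le_trans _ (fC x)) ?(le_trans _ (fC x))//.
    by rewrite -normrN ler_norm.
  by move=> x Kx; rewrite /funrneg fK// oppr0 maxxx.
rewrite (_ : f = fun x => -1 * f^\- x + f^\+ x).
  apply: Ql => //; first by apply: Qpos => // x; exact: funrneg_ge0.
  by apply: Qpos => // x; exact: funrpos_ge0.
apply/funext => x; rewrite mulN1r addrC.
by have /(congr1 (fun h => h x)) := funrposBneg f.
Qed.

End bounded_functions.

Section signed_integral_theory.
Context {R : realType} {d} {T : measurableType d}.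
Variable bnd : set (set T).
Hypothesis bb : bornology bnd.
Let sint := @signed_integral R _ _ bnd.

Lemma integrable_indic_lty (m : {measure set T -> \bar R}) K :
  measurable K -> (m K < +oo)%E -> m.-integrable setT (EFin \o \1_K).
Proof.
move=> mK Kfin; apply/integrableP; split.
  exact/measurable_EFinP/measurable_indic.
under eq_integral do rewrite /= ger0_norm ?indic_ge0//.
by rewrite integral_indic// setIT.
Qed.

Lemma bounded_supported_integrable (m : {measure set T -> \bar R}) K f :
  measurable K -> (m K < +oo)%E -> bounded_supported K f ->
  m.-integrable setT (EFin \o f).
Proof.
move=> mK Kfin [mf [C fC] fK].
apply: (@le_integrable _ _ _ _ _ _ _ (EFin \o (fun x => C * \1_K x))) => //.
- exact/measurable_EFinP.
- move=> x _ /=; rewrite lee_fin.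
  have [Kx|Kx] := pselect (K x); last by rewrite fK// normr0.
  by rewrite indicE mem_set// mulr1 (le_trans (fC x))// ler_norm.
- rewrite (_ : _ \o _ = fun x => C%:E * (\1_K x)%:E)%E; last first.
    by apply/funext => x /=; rewrite EFinM.
  by apply: integrableZl => //; exact: integrable_indic_lty.
Qed.

Lemma bounded_supported_cvg (m : {measure set T -> \bar R}) K
    (F : nat -> T -> R) f (C : R) :
  measurable K -> (m K < +oo)%E -> (forall n, bounded_supported K (F n)) ->
  (forall n x, `|F n x| <= C) -> bounded_supported K f ->
  (forall x, F ^~ x @ \oo --> f x) ->
  (fun n => fine (\int[m]_x (F n x)%:E)) @ \oo --> fine (\int[m]_x (f x)%:E).
Proof.
move=> mK Kfin bF FC bf cF.
have intf := bounded_supported_integrable mK Kfin bf.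
have h : (fun n => \int[m]_x (F n x)%:E)%E @ \oo --> (\int[m]_x (f x)%:E)%E.
  have [//|||||_ _ ] := @dominated_convergence _ _ _ m setT measurableT
    (fun n x => (F n x)%:E) (EFin \o f) (EFin \o (fun x => C * \1_K x)).
  - by move=> n; apply/measurable_EFinP; have [] := bF n.
  - by apply/measurable_EFinP; have [] := bf.
  - by apply: aeW => x _; apply: cvg_EFin => //; [exact: nearW|exact: cF].
  - rewrite (_ : _ \o _ = fun x => C%:E * (\1_K x)%:E)%E; last first.
      by apply/funext => x /=; rewrite EFinM.
    by apply: integrableZl => //; exact: integrable_indic_lty.
  - apply: aeW => x n _ /=; rewrite lee_fin.
    have [Kx|Kx] := pselect (K x).
      by rewrite indicE mem_set// mulr1 (le_trans (FC n x)).
    have [_ _ ->//] := bF n; rewrite normr0 indicE memNset// mulr0//.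
  - exact.
by apply: fine_cvg; rewrite fineK//; apply: integrable_fin_num.
Qed.

Variables (nu : set T -> R) (nus : locally_sigma_additive bnd nu).
Variables (K : set T) (mK : measurable K) (bK : bnd K).

Lemma signed_integral_indic A : measurable A -> A `<=` K -> sint nu \1_A = nu A.
Proof.
move=> mA AK.
have [m mE] := pos_variation_measure bb nus.
have [m' mE'] := pos_variation_measure bb (locally_sigma_additiveN nus).
have [_ bs _] := bb.
rewrite /sint /signed_integral -mE -mE' !integral_indic// !setIT mE mE'.
by apply: pos_variation_sub => //; exact: bs bK.
Qed.

Lemma signed_integral_lin a f g : bounded_supported K f -> bounded_supported K g ->
  sint nu (fun x => a * f x + g x) = a * sint nu f + sint nu g.
Proof.
move=> bf bg.
have nusN := locally_sigma_additiveN nus.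
have [m mE] := pos_variation_measure bb nus.
have [m' mE'] := pos_variation_measure bb nusN.
have := pos_variation_lty bb nus mK bK; rewrite -mE => Km.
have := pos_variation_lty bb nusN mK bK; rewrite -mE' => Km'.
rewrite /sint /signed_integral -mE -mE'.
have E (n : {measure set T -> \bar R}) : (n K < +oo)%E ->
    fine (\int[n]_x (a * f x + g x)%:E) =
    a * fine (\int[n]_x (f x)%:E) + fine (\int[n]_x (g x)%:E).
  move=> Kn; have iF := bounded_supported_integrable mK Kn bf.
  have iG := bounded_supported_integrable mK Kn bg.
  under eq_integral do rewrite EFinD EFinM.
  rewrite integralD//=; last exact: integrableZl.
  rewrite integralZl// fineD ?fineM//; first exact: integrable_fin_num.
    by rewrite fin_numM//; exact: integrable_fin_num.
  exact: integrable_fin_num.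
by rewrite !E//; ring.
Qed.

Lemma signed_integral_cvg (F : nat -> T -> R) f (C : R) :
  (forall n, bounded_supported K (F n)) -> (forall n x, `|F n x| <= C) ->
  bounded_supported K f -> (forall x, F ^~ x @ \oo --> f x) ->
  (fun n => sint nu (F n)) @ \oo --> sint nu f.
Proof.
move=> bF FC bf cF.
have nusN := locally_sigma_additiveN nus.
have [m mE] := pos_variation_measure bb nus.
have [m' mE'] := pos_variation_measure bb nusN.
have := pos_variation_lty bb nus mK bK; rewrite -mE => Km.
have := pos_variation_lty bb nusN mK bK; rewrite -mE' => Km'.
rewrite /sint /signed_integral -mE -mE'.
by apply: cvgB; exact: bounded_supported_cvg bF FC bf cF.
Qed.

Lemma signed_integral_le f (C : R) : bounded_supported K f ->
  (forall x, `|f x| <= C) ->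
  `|sint nu f| <= C * (fine (pos_variation bnd nu K)
                     + fine (pos_variation bnd (fun A => - nu A) K)).
Proof.
move=> bf fC.
have nusN := locally_sigma_additiveN nus.
have [m mE] := pos_variation_measure bb nus.
have [m' mE'] := pos_variation_measure bb nusN.
have := pos_variation_lty bb nus mK bK; rewrite -mE => Km.
have := pos_variation_lty bb nusN mK bK; rewrite -mE' => Km'.
rewrite /sint /signed_integral -mE -mE'.
have E (n : {measure set T -> \bar R}) : (n K < +oo)%E ->
    `|fine (\int[n]_x (f x)%:E)| <= C * fine (n K).
  move=> Kn; have iF := bounded_supported_integrable mK Kn bf.
  rewrite -lee_fin EFinM fineK ?ge0_fin_numE// -[leRHS]/(C%:E * n K)%E.
  rewrite -fine_abse; last exact: integrable_fin_num.
  rewrite fineK; last by rewrite abse_fin_num; exact: integrable_fin_num.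
  rewrite (le_trans (le_abse_integral _ _ _))//; first exact: (measurable_int n).
  rewrite -[X in n X]setIT -integral_indic// -integralZl//; last exact: integrable_indic_lty.
  have [mf _ fK] := bf.
  apply: ge0_le_integral => //.
  - by apply/measurable_EFinP; exact: measurableT_comp.
  - by apply/measurable_EFinP; apply: measurable_funM => //; exact: measurable_indic.
  - move=> x _ /=; rewrite lee_fin; have [Kx|Kx] := pselect (K x).
      by rewrite indicE mem_set// mulr1.
    by rewrite fK// normr0 indicE memNset// mulr0.
by rewrite (le_trans (ler_normB _ _))// mulrDr lerD// E.
Qed.

End signed_integral_theory.

Section lfc_integral_theory.
Context {R : realType} {d} {T : measurableType d}.
Variable bnd : set (set T).
Hypothesis bb : bornology bnd.
Implicit Types (mu : lfcmeasure R bnd) (K : set T) (f g : T -> R[i]).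

Lemma lfc_re_sigma_additive mu :
  locally_sigma_additive bnd (fun A => complex.Re (mu A)).
Proof.
move=> F mF tF bF; have [+ _] := lfc_sigma_additive mu mF tF bF.
by under eq_fun do rewrite raddf_sum.
Qed.

Lemma lfc_im_sigma_additive mu :
  locally_sigma_additive bnd (fun A => complex.Im (mu A)).
Proof.
move=> F mF tF bF; have [_ +] := lfc_sigma_additive mu mF tF bF.
by under eq_fun do rewrite raddf_sum.
Qed.

Definition cbounded_supported K f : Prop :=
  bounded_supported K (fun x => complex.Re (f x)) /\
  bounded_supported K (fun x => complex.Im (f x)).

Lemma cbounded_supported_lin K (c : R[i]) f g : cbounded_supported K f ->
  cbounded_supported K g -> cbounded_supported K (fun x => c * f x + g x).
Proof.
move: c => [a b] [rf jf] [rg jg]; split.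
  rewrite (_ : (fun x => _) = fun x => a * complex.Re (f x) +
    (- b * complex.Im (f x) + complex.Re (g x))).
    by do 2 apply: bounded_supported_lin => //.
  by apply/funext => x; case: (f x) => ? ?; case: (g x) => ? ? /=; ring.
rewrite (_ : (fun x => _) = fun x => a * complex.Im (f x) +
  (b * complex.Re (f x) + complex.Im (g x))).
  by do 2 apply: bounded_supported_lin => //.
by apply/funext => x; case: (f x) => ? ?; case: (g x) => ? ? /=; ring.
Qed.

Lemma lfc_integral_lin mu K (c : R[i]) f g : measurable K -> bnd K ->
  cbounded_supported K f -> cbounded_supported K g ->
  lfc_integral mu (fun x => c * f x + g x) =
  c * lfc_integral mu f + lfc_integral mu g.
Proof.
move=> mK bK; move: c => [a b] [rf jf] [rg jg].
have re := @lfc_re_sigma_additive mu; have im := @lfc_im_sigma_additive mu.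
rewrite /lfc_integral.
rewrite (_ : (fun x => complex.Re ((a +i* b)%C * f x + g x)) =
    fun x => a * complex.Re (f x) +
    (- b * complex.Im (f x) + complex.Re (g x))); last first.
  by apply/funext => x; case: (f x) => ? ?; case: (g x) => ? ? /=; ring.
rewrite (_ : (fun x => complex.Im ((a +i* b)%C * f x + g x)) =
    fun x => a * complex.Im (f x) +
    (b * complex.Re (f x) + complex.Im (g x))); last first.
  by apply/funext => x; case: (f x) => ? ?; case: (g x) => ? ? /=; ring.
have b1 := bounded_supported_lin (- b) jf rg.
have b2 := bounded_supported_lin b rf jg.
rewrite !(signed_integral_lin bb re mK bK, signed_integral_lin bb im mK bK)//.
by apply/eqP; rewrite eq_complex /=; apply/andP; split; apply/eqP; ring.
Qed.

Lemma lfc_integral_cvg mu K (F : nat -> T -> R[i]) f (C : R) :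
  measurable K -> bnd K -> (forall n, cbounded_supported K (F n)) ->
  (forall n x, `|complex.Re (F n x)| <= C /\ `|complex.Im (F n x)| <= C) ->
  cbounded_supported K f -> (forall x, ccvg (F ^~ x) (f x)) ->
  ccvg (fun n => lfc_integral mu (F n)) (lfc_integral mu f).
Proof.
move=> mK bK bF FC [rf jf] cF.
have re := @lfc_re_sigma_additive mu; have im := @lfc_im_sigma_additive mu.
have cvr nu : locally_sigma_additive bnd nu ->
    (fun n => signed_integral bnd nu (fun x => complex.Re (F n x))) @ \oo -->
    signed_integral bnd nu (fun x => complex.Re (f x)).
  move=> nus; apply: (signed_integral_cvg bb nus mK bK (C := C)) => //.
  - by move=> n; have [] := bF n.
  - by move=> n x; have [] := FC n x.
  - by move=> x; have [] := cF x.
have cvi nu : locally_sigma_additive bnd nu ->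
    (fun n => signed_integral bnd nu (fun x => complex.Im (F n x))) @ \oo -->
    signed_integral bnd nu (fun x => complex.Im (f x)).
  move=> nus; apply: (signed_integral_cvg bb nus mK bK (C := C)) => //.
  - by move=> n; have [] := bF n.
  - by move=> n x; have [] := FC n x.
  - by move=> x; have [] := cF x.
by split => /=; [apply: cvgB|apply: cvgD]; auto.
Qed.

Lemma signed_integral0 nu : locally_sigma_additive bnd nu ->
  signed_integral bnd nu (fun=> 0 : R) = 0 :> R.
Proof.
move=> nus; have [m mE] := pos_variation_measure bb nus.
have [m' mE'] := pos_variation_measure bb (locally_sigma_additiveN nus).
by rewrite /signed_integral -mE -mE' !integral0_eq ?subrr.
Qed.

Lemma lfc_integral_indic mu K A : measurable K -> bnd K -> measurable A ->
  A `<=` K -> lfc_integral mu (fun x => (\1_A x)%:C%C) = mu A.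
Proof.
move=> mK bK mA AK.
have re := @lfc_re_sigma_additive mu; have im := @lfc_im_sigma_additive mu.
rewrite /lfc_integral /= !signed_integral0// subr0 add0r.
rewrite (signed_integral_indic bb re bK)// (signed_integral_indic bb im bK)//.
by case: (mu A).
Qed.

Lemma pos_variation_total mu K (nu : set T -> R) :
  (forall A, nu A <= Normc.normc (mu A)) ->
  (pos_variation bnd nu K <= Defs.total_variation mu K)%E.
Proof.
move=> h; apply: pos_variation_le => B mB bB BK.
apply: (@le_trans _ _ (Normc.normc (mu B))%:E); first by rewrite lee_fin.
apply: ereal_sup_ubound; exists 1%N, (fun n => if n == 0%N then B else set0).
split.
- by move=> k; case: ifP.
- move=> i j _ _ [x []]; case: ifP => //= /eqP -> _; case: ifP => //= /eqP ->//.
- by move=> k; case: ifP => // _ x [].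
- by rewrite big_ord1.
Qed.

Lemma normc_re (z : R[i]) : `|complex.Re z| <= Normc.normc z.
Proof.
case: z => a b /=; rewrite -sqrtr_sqr ler_sqrt ?addr_ge0 ?sqr_ge0//.
by rewrite lerDl sqr_ge0.
Qed.

Lemma normc_im (z : R[i]) : `|complex.Im z| <= Normc.normc z.
Proof.
case: z => a b /=; rewrite -sqrtr_sqr ler_sqrt ?addr_ge0 ?sqr_ge0//.
by rewrite lerDr sqr_ge0.
Qed.

(** Each part of the integral is made of two signed integrals, and each of those of two variations
    bounded by the total variation; hence the factor 4. The bound lives in the extended reals
    because the total variation of K is not shown to be finite. *)
Lemma lfc_integral_le mu K f (C : R) : measurable K -> bnd K ->
  cbounded_supported K f ->
  (forall x, `|complex.Re (f x)| <= C /\ `|complex.Im (f x)| <= C) ->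
  ((`|complex.Re (lfc_integral mu f)|)%:E <= (4 * C)%:E * Defs.total_variation mu K)%E /\
  ((`|complex.Im (lfc_integral mu f)|)%:E <= (4 * C)%:E * Defs.total_variation mu K)%E.
Proof.
move=> mK bK [rf jf] fC.
have C0 : 0 <= C by have [+ _] := fC point; apply: le_trans.
have re := @lfc_re_sigma_additive mu; have im := @lfc_im_sigma_additive mu.
set V := Defs.total_variation mu K.
have V0 : (0 <= V)%E.
  apply: le_trans (pos_variation_ge0 bb re K) _; apply: pos_variation_total => A.
  by rewrite (le_trans _ (normc_re _))// ler_norm.
have H (nu : set T -> R) (g : T -> R) : locally_sigma_additive bnd nu ->
    (forall A, `|nu A| <= Normc.normc (mu A)) -> bounded_supported K g ->
    (forall x, `|g x| <= C) ->
    ((`|signed_integral bnd nu g|)%:E <= (2 * C)%:E * V)%E.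
  move=> nus nm bg gC; have nusN := locally_sigma_additiveN nus.
  have h1 : (pos_variation bnd nu K <= V)%E.
    by apply: pos_variation_total => A; rewrite (le_trans _ (nm _))// ler_norm.
  have h2 : (pos_variation bnd (fun A => (- nu A)%R) K <= V)%E.
    apply: pos_variation_total => A.
    by rewrite (le_trans _ (nm _))// -normrN ler_norm.
  (* An infinite total variation makes the bound trivial unless C is 0; then the right-hand side is
     0 and the integral vanishes as well. *)
  have [Voo|Voo] := eqVneq V +oo%E.
    have [C00|C00] := eqVneq C 0.
      rewrite C00 mulr0 mul0e lee_fin.
      rewrite (le_trans (signed_integral_le bb nus mK bK bg gC))// C00 mul0r//.
    by rewrite Voo gt0_muley ?leey// lte_fin mulr_gt0// lt_neqAle eq_sym C00.
  have Vfin : V \is a fin_num by rewrite ge0_fin_numE// lt_neqAle Voo leey.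
  rewrite -(fineK Vfin) -EFinM lee_fin.
  rewrite (le_trans (signed_integral_le bb nus mK bK bg gC))//.
  rewrite (@le_trans _ _ (C * (fine V + fine V)))//; last by rewrite le_eqVlt; apply/orP; left; apply/eqP; ring.
  by rewrite ler_wpM2l// lerD// fine_le// ge0_fin_numE ?(pos_variation_ge0 bb)//
    (pos_variation_lty bb).
have E4 : ((4 * C)%:E * V = (2 * C)%:E * V + (2 * C)%:E * V)%E.
  by rewrite -ge0_muleDl ?lee_fin ?mulr_ge0// -EFinD; congr (_%:E * _)%E; ring.
have nr A : `|complex.Re (mu A)| <= Normc.normc (mu A) by exact: normc_re.
have ni A : `|complex.Im (mu A)| <= Normc.normc (mu A) by exact: normc_im.
have fr x : `|complex.Re (f x)| <= C by have [] := fC x.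
have fi x : `|complex.Im (f x)| <= C by have [] := fC x.
rewrite E4; split.
  apply: (@le_trans _ _ ((`|signed_integral bnd (fun A => complex.Re (mu A))
     (fun x => complex.Re (f x))|)%:E + (`|signed_integral bnd
     (fun A => complex.Im (mu A)) (fun x => complex.Im (f x))|)%:E)%E).
    by rewrite -EFinD lee_fin ler_normB.
  by rewrite leeD// H.
apply: (@le_trans _ _ ((`|signed_integral bnd (fun A => complex.Re (mu A))
   (fun x => complex.Im (f x))|)%:E + (`|signed_integral bnd
   (fun A => complex.Im (mu A)) (fun x => complex.Re (f x))|)%:E)%E).
  by rewrite -EFinD lee_fin ler_normD.
by rewrite leeD// H.
Qed.

Lemma measurable_lfc_eval A (V : set R) : measurable A -> bnd A -> measurable V ->
  measurable [set mu : lfc_space R bnd | V (complex.Re (mu A))] /\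
  measurable [set mu : lfc_space R bnd | V (complex.Im (mu A))].
Proof.
by move=> mA bA mV; split; apply: sub_gen_smallest; exists A, V; split => //;
  [left|right].
Qed.

(** Evaluations at bounded measurable sets are measurable by definition of the cylinder
    sigma-algebra; the monotone class argument carries this over to integrands. *)
Lemma measurable_lfc_integral K f : measurable K -> bnd K ->
  cbounded_supported K f ->
  measurable_fun [set: lfc_space R bnd] (fun mu => complex.Re (lfc_integral mu f)) /\
  measurable_fun [set: lfc_space R bnd] (fun mu => complex.Im (lfc_integral mu f)).
Proof.
have [_ bs _] := bb.
move=> mK bK [rf jf].
have mre (g : T -> R) : bounded_supported K g -> measurable_fun [set: lfc_space R bnd]
    (fun mu => signed_integral bnd (fun A => complex.Re (mu A)) g).
  move: g; apply: bounded_supported_ind.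
  - move=> A mA AK.
    under eq_fun do rewrite (signed_integral_indic bb (@lfc_re_sigma_additive _) bK)//.
    move=> _ V mV; rewrite setTI.
    by have [] := @measurable_lfc_eval A V mA (bs _ _ AK bK) mV.
  - move=> a u v bu bv mu mv.
    under eq_fun do rewrite (signed_integral_lin bb (@lfc_re_sigma_additive _) mK bK)//.
    by apply: measurable_funD => //; exact: measurable_funM.
  - move=> F h C bF FC bh cF mF.
    apply: (measurable_fun_cvg mF) => mu _.
    exact: (signed_integral_cvg bb (@lfc_re_sigma_additive _) mK bK bF FC bh cF).
have mim (g : T -> R) : bounded_supported K g -> measurable_fun [set: lfc_space R bnd]
    (fun mu => signed_integral bnd (fun A => complex.Im (mu A)) g).
  move: g; apply: bounded_supported_ind.
  - move=> A mA AK.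
    under eq_fun do rewrite (signed_integral_indic bb (@lfc_im_sigma_additive _) bK)//.
    move=> _ V mV; rewrite setTI.
    by have [] := @measurable_lfc_eval A V mA (bs _ _ AK bK) mV.
  - move=> a u v bu bv mu mv.
    under eq_fun do rewrite (signed_integral_lin bb (@lfc_im_sigma_additive _) mK bK)//.
    by apply: measurable_funD => //; exact: measurable_funM.
  - move=> F h C bF FC bh cF mF.
    apply: (measurable_fun_cvg mF) => mu _.
    exact: (signed_integral_cvg bb (@lfc_im_sigma_additive _) mK bK bF FC bh cF).
by split; [apply: measurable_funB|apply: measurable_funD]; auto.
Qed.

Lemma lfc_integral_restrict mu mu' K E f : measurable K -> bnd K ->
  measurable E ->
  (forall A, measurable A -> bnd A -> mu' A = mu (A `&` E)) ->
  cbounded_supported K f ->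
  lfc_integral mu' f = lfc_integral mu (fun x => f x * (\1_E x)%:C%C).
Proof.
move=> mK bK mE muE [rf jf]; have [_ bs _] := bb.
have bE (g : T -> R) : bounded_supported K g -> bounded_supported K (fun x => g x * \1_E x).
  move=> bg; have := bounded_supportedM bg (bounded_supported_indic mE (@subsetT _ E)).
  by rewrite setIT.
have H (nu nu' : set T -> R) (g : T -> R) : locally_sigma_additive bnd nu ->
    locally_sigma_additive bnd nu' ->
    (forall A, measurable A -> bnd A -> nu' A = nu (A `&` E)) ->
    bounded_supported K g ->
    signed_integral bnd nu' g = signed_integral bnd nu (fun x => g x * \1_E x).
  move=> nus nus' nuE; move: g; apply: bounded_supported_ind.
  - move=> A mA AK; rewrite (signed_integral_indic bb nus' bK)//.
    rewrite (_ : (fun x => _) = \1_(A `&` E)); last first.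
      by apply/funext => x; rewrite indicI.
    rewrite (signed_integral_indic bb nus bK)//; last 2 first.
      exact: measurableI.
      by move=> x [/AK].
    by apply: nuE => //; exact: bs bK.
  - move=> a u v bu bv uE vE; rewrite (signed_integral_lin bb nus' mK bK)//.
    rewrite uE vE -(signed_integral_lin bb nus mK bK); [|exact: bE..].
    by congr (signed_integral _ _ _); apply/funext => x; ring.
  - move=> F g C bF FC bg cF FE.
    have h1 := signed_integral_cvg bb nus' mK bK bF FC bg cF.
    have h2 : (fun n => signed_integral bnd nu' (F n)) @ \oo -->
        signed_integral bnd nu (fun x => g x * \1_E x).
      under eq_fun do rewrite FE.
      apply: (signed_integral_cvg bb nus mK bK (C := C)) => //.
      - by move=> n; exact: bE.
      - move=> n x; rewrite normrM (le_trans _ (FC n x))// ler_piMr//.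
        by rewrite indicE; case: (_ \in _); rewrite ?normr1// normr0.
      - exact: bE.
      - by move=> x; apply: cvgMl; exact: cF.
    by apply: (cvg_unique _ h1 h2); exact: norm_hausdorff.
have re := @lfc_re_sigma_additive mu; have im := @lfc_im_sigma_additive mu.
have re' := @lfc_re_sigma_additive mu'; have im' := @lfc_im_sigma_additive mu'.
rewrite /lfc_integral.
rewrite (_ : (fun x => complex.Re (f x * _)) =
    fun x => complex.Re (f x) * \1_E x); last first.
  by apply/funext => x; case: (f x) => ? ? /=; ring.
rewrite (_ : (fun x => complex.Im (f x * _)) =
    fun x => complex.Im (f x) * \1_E x); last first.
  by apply/funext => x; case: (f x) => ? ? /=; ring.
rewrite !(H _ _ _ re re')// ?(H _ _ _ im im')//.
all: by move=> A mA bA; rewrite muE.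
Qed.

End lfc_integral_theory.

(** * Reconstruction of a measure from its values on dyadic cells *)

Section binary_trees.
Context {R : realType}.
Implicit Types (f g : seq bool -> R) (p q : seq bool).

(** A binary word p stands for a cell, whose two halves are its extensions by one letter. Additivity
    is the only trace of a measure that is kept at this level. *)
Definition tree_additive f : Prop :=
  forall p, f p = f (rcons p false) + f (rcons p true).

(* The sum of the positive parts of [f] over the descendants of [p] of depth [n];
   its limit is the positive part in the Jordan decomposition. *)
Fixpoint tree_pos f n p : R :=
  if n is m.+1 then tree_pos f m (rcons p false) + tree_pos f m (rcons p true)
  else Num.max (f p) 0.

Lemma tree_pos_ge0 f n p : 0 <= tree_pos f n p.
Proof. by elim: n p => [|n ih] p /=; [rewrite le_max lexx orbT|rewrite addr_ge0]. Qed.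

(** The positive part is subadditive, so splitting cells further can only increase the sum. *)
Lemma tree_pos_nd f : tree_additive f -> forall n p, tree_pos f n p <= tree_pos f n.+1 p.
Proof.
move=> fa; elim=> [|n ih] p; last by rewrite [leRHS]/= [leLHS]/= lerD// ih.
by rewrite /= (fa p) ge_max addr_ge0 ?le_max ?lexx ?orbT// andbT lerD// le_max lexx.
Qed.

Definition tree_bounded f : Prop := exists C, forall n, tree_pos f n [::] <= C.

Lemma tree_pos_bounded f : tree_bounded f ->
  forall p, exists C, forall n, tree_pos f n p <= C.
Proof.
move=> bf; elim/last_ind => [//|p b [C ih]]; exists C => n.
apply: le_trans (ih n.+1) => /=.
by case: b; rewrite ?lerDr ?lerDl tree_pos_ge0.
Qed.

Definition tree_pos_lim f p : R := limn (fun n => tree_pos f n p).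

Lemma tree_pos_cvg f : tree_additive f -> tree_bounded f ->
  forall p, (fun n => tree_pos f n p) @ \oo --> tree_pos_lim f p.
Proof.
move=> fa fb p; apply: nondecreasing_is_cvgn.
  by apply/nondecreasing_seqP => n; exact: tree_pos_nd.
by have [C hC] := tree_pos_bounded fb p; exists C => _ [n _ <-].
Qed.

Lemma tree_pos_lim_additive f : tree_additive f -> tree_bounded f ->
  tree_additive (tree_pos_lim f).
Proof.
move=> fa fb p.
have h : (fun n => tree_pos f n (rcons p false) + tree_pos f n (rcons p true)) @ \oo -->
    tree_pos_lim f (rcons p false) + tree_pos_lim f (rcons p true).
  by apply: cvgD; exact: tree_pos_cvg.
have h2 : (fun n => tree_pos f n.+1 p) @ \oo --> tree_pos_lim f p.
  by rewrite (cvg_shiftS (fun n => tree_pos f n p)); exact: tree_pos_cvg.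
by apply: (cvg_unique _ h2 h); exact: norm_hausdorff.
Qed.

Lemma tree_pos_lim_ge f p : tree_additive f -> tree_bounded f ->
  Num.max (f p) 0 <= tree_pos_lim f p.
Proof.
move=> fa fb; have cf := tree_pos_cvg (p := p) fa fb.
apply: (@nondecreasing_cvgn_le _ (fun n => tree_pos f n p) _ (cvgP _ cf) 0%N).
by apply/nondecreasing_seqP => n; exact: tree_pos_nd.
Qed.

(* The half-open intervals [tree_left g p, tree_left g p + g p) are nested along
   the tree. *)
Definition tree_left g p : R :=
  \sum_(i < size p) (if nth false p i then g (rcons (take i p) false) else 0).

Lemma tree_left_rcons g p b : tree_left g (rcons p b) =
  tree_left g p + if b then g (rcons p false) else 0.
Proof.
rewrite /tree_left size_rcons big_ord_recr/= nth_rcons ltnn eqxx.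
rewrite -cats1 take_size_cat//; congr (_ + _); apply: eq_bigr => i _.
by rewrite nth_cat ltn_ord takel_cat// ltnW.
Qed.

Definition tree_itv g p : set R :=
  [set y | tree_left g p <= y < tree_left g p + g p].

Section nonneg_additive.
Variable g : seq bool -> R.
Hypotheses (g0 : forall p, 0 <= g p) (ga : tree_additive g).

Lemma tree_itv_split p y : tree_itv g p y ->
  tree_itv g (rcons p false) y \/ tree_itv g (rcons p true) y.
Proof.
rewrite /tree_itv /= !tree_left_rcons addr0 => /andP[h1 h2].
have [h|h] := ltP y (tree_left g p + g (rcons p false)); [left|right].
  by rewrite h1.
by rewrite -addrA -ga.
Qed.

Lemma tree_itv_rcons p b y : tree_itv g (rcons p b) y -> tree_itv g p y.
Proof.
rewrite /tree_itv /= tree_left_rcons => /andP[h1 h2].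
have := ga p; have := g0 (rcons p false); have := g0 (rcons p true).
by case: b h1 h2 => h1 h2 k1 k2 ->; apply/andP; split; lra.
Qed.

Lemma tree_itv_disj p y : tree_itv g (rcons p false) y -> tree_itv g (rcons p true) y -> False.
Proof.
rewrite /tree_itv /= !tree_left_rcons addr0 => /andP[h1 h2] /andP[h3 h4].
by have := lt_le_trans h2 h3; rewrite ltxx.
Qed.

Lemma tree_itv_inj p q y : size p = size q -> tree_itv g p y -> tree_itv g q y -> p = q.
Proof.
elim/last_ind: p q => [|p b ih] q; first by move/esym/size0nil.
elim/last_ind: q => [|q c _]; first by rewrite size_rcons.
rewrite !size_rcons => -[spq] hp hq.
have := ih _ spq (tree_itv_rcons hp) (tree_itv_rcons hq) => E; subst q.
by case: b c hp hq => -[]// h1 h2; [case: (tree_itv_disj h2 h1)|case: (tree_itv_disj h1 h2)].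
Qed.

(** The quantile map: for a nonnegative additive [g], a point of the root interval is sent to the
    infinite word whose prefixes index the intervals containing it, and any other point to the
    constant word [false]. Letter n is read off from some word of length n rather than by recursion
    on the previous letters, which makes measurability a countable union. *)
Definition tree_bits (y : R) (n : nat) : bool :=
  `[< exists p, size p = n /\ tree_itv g (rcons p true) y >].

Lemma tree_itv_bits y n : tree_itv g [::] y -> tree_itv g (mkseq (tree_bits y) n) y.
Proof.
move=> y0; elim: n => [//|n ih].
rewrite /mkseq -addn1 iotaD map_cat/= add0n cats1 -/(mkseq _ _).
rewrite {2}/tree_bits; case: asboolP => [[p [sp hp]]|np].
  suff <- : p = mkseq (tree_bits y) n by [].
  by apply: (tree_itv_inj _ (tree_itv_rcons hp) ih); rewrite size_mkseq.
have [//|h] := tree_itv_split ih.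
by exfalso; apply: np; exists (mkseq (tree_bits y) n); rewrite size_mkseq.
Qed.

(** The preimage of a cell of the Cantor space is thereby an interval of length [g p], so the image
    of the Lebesgue measure has the prescribed masses on cells. *)
Lemma tree_bits_itv p y : tree_itv g [::] y /\ mkseq (tree_bits y) (size p) = p <-> tree_itv g p y.
Proof.
split => [[y0 <-]|hp]; first exact: tree_itv_bits.
have y0 : tree_itv g [::] y by elim/last_ind: p hp => // p b ih /tree_itv_rcons.
split=> //; apply: (tree_itv_inj _ (tree_itv_bits _ y0) hp).
by rewrite size_mkseq.
Qed.

End nonneg_additive.

End binary_trees.

Definition code_cell (p : seq bool) : set (nat -> bool) :=
  [set s | mkseq s (size p) = p].

(** The empty set is added to obtain a family stable under intersection: two cells are nested or
    disjoint. *)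
Definition code_cells : set (set (nat -> bool)) :=
  [set B | B = set0 \/ exists p, B = code_cell p].

Notation code := (g_sigma_algebraType code_cells).

Lemma code_cells_setI : setI_closed code_cells.
Proof.
have key p q : (size p <= size q)%N -> code_cells (code_cell p `&` code_cell q).
  move=> spq; have [E|E] := eqVneq (take (size p) q) p.
    right; exists q; apply/seteqP; split=> [s []//|s sq]; split=> //.
    rewrite /code_cell /= in sq *.
    by rewrite -{2}E -sq -map_take take_iota (minn_idPl spq).
  left; apply/seteqP; split => // s [sp sq].
  rewrite /code_cell /= in sp sq; move/negP: E; apply.
  by rewrite -{1}sq -map_take take_iota (minn_idPl spq) -/(mkseq _ _) sp.
move=> A B [->|[p ->]]; first by left; rewrite set0I.
move=> [->|[q ->]]; first by left; rewrite setI0.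
by have [pq|/ltnW qp] := leqP (size p) (size q); [|rewrite setIC]; exact: key.
Qed.

Lemma measurable_code_cell p : measurable (code_cell p : set code).
Proof. by apply: sub_gen_smallest; right; exists p. Qed.

Lemma measurable_code_coord n : measurable ([set s : nat -> bool | s n] : set code).
Proof.
have -> : [set s : nat -> bool | s n] = \bigcup_(p in [set p | size p = n.+1 /\ nth false p n]) code_cell p.
  apply/seteqP; split => s /=.
    move=> sn; have H : code_cell (mkseq s n.+1) s by rewrite /code_cell /mkset size_mkseq.
    by exists (mkseq s n.+1); [split; [rewrite size_mkseq|rewrite nth_mkseq]|exact: H].
  by move=> [p [sp pn]]; rewrite /code_cell/= => E; move: pn; rewrite -E nth_mkseq// sp.
rewrite bigcup_mkcond; apply: countable_bigcupT_measurable => //.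
by move=> p; case: ifP => // _; exact: measurable_code_cell.
Qed.

Lemma measurable_fun_code d (X : measurableType d) (h : X -> code) :
  (forall n, measurable [set x | h x n]) -> measurable_fun setT h.
Proof.
move=> mh; apply: (@measurability _ _ X code setT h code_cells) => //.
move=> _ [B [->|[p ->]] <-]; first by rewrite preimage_set0 setI0.
rewrite setTI (_ : _ @^-1` _ = \bigcap_(i in [set i | (i < size p)%N])
    (if nth false p i then [set x | h x i] else ~` [set x | h x i])).
  apply: bigcap_measurableType => i _; case: ifP => _; first exact: mh.
  by apply: measurableC; exact: mh.
apply/seteqP; split => x /=.
  rewrite /code_cell /= => E i /= ip; rewrite -E nth_mkseq//.
  by case: ifP => //= ->.
move=> H; apply: (@eq_from_nth _ false); rewrite size_mkseq// => i ip.
by rewrite nth_mkseq//; have := H i ip; case: ifP => //= _ /negP/negbTE.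
Qed.

Section finite_signed_measures.
Context {R : realType}.

(** Values are signed here, so the Dynkin argument is run on real-valued set functions; equality of
    the total values takes care of complements. *)
Lemma lsa_unique d (T : measurableType d) (G : set (set T)) (m1 m2 : set T -> R) :
  @measurable _ T = <<s G >> -> setI_closed G ->
  locally_sigma_additive setT m1 -> locally_sigma_additive setT m2 ->
  m1 setT = m2 setT -> (forall A, G A -> m1 A = m2 A) ->
  forall A, measurable A -> m1 A = m2 A.
Proof.
move=> GE GI s1 s2 ET EG A mA.
have bT : bornology [set: set T] by [].
have CE (m : set T -> R) B : locally_sigma_additive setT m -> measurable B -> m (~` B) = m setT - m B.
  move=> sm mB; rewrite -(setvU B) (lsaU bT sm)//.
  - by rewrite addrK.
  - exact: measurableC.
  - by rewrite setICl.
pose Q A := m1 A = m2 A.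
suff H : forall S, <<s G >> S -> Q S by apply: H; rewrite -GE.
apply: (dynkin_induction GE GI) => //.
  by move=> S mS E; rewrite /Q !CE// E ET.
move=> F mF tF E; rewrite /Q.
have h1 := s1 F mF tF I; have h2 := s2 F mF tF I.
have h2' : (fun n => \sum_(k < n) m1 (F k)) @ \oo --> m2 (\bigcup_n F n).
  by under eq_fun do under eq_bigr do rewrite E.
by apply: (cvg_unique _ h1 h2'); exact: norm_hausdorff.
Qed.

Lemma lsa_preimage d d' (T : measurableType d) (T' : measurableType d')
    (h : T -> T') (m : set T -> R) : measurable_fun setT h ->
  locally_sigma_additive setT m -> locally_sigma_additive setT (fun A => m (h @^-1` A)).
Proof.
move=> mh sm F mF tF _; rewrite preimage_bigcup; apply: sm => //.
  by move=> n; rewrite -[X in measurable X]setTI; exact: mh.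
by move=> i j _ _ [x [Fi Fj]]; apply: tF => //; exists (h x).
Qed.

Lemma lsaB d (T : measurableType d) (m1 m2 : set T -> R) :
  locally_sigma_additive setT m1 -> locally_sigma_additive setT m2 ->
  locally_sigma_additive setT (fun A => m1 A - m2 A).
Proof.
move=> s1 s2 F mF tF bF; under eq_fun do rewrite sumrB.
by apply: cvgB; [exact: s1|exact: s2].
Qed.

Lemma lsa_fine_measure d (T : measurableType d) (m : {measure set T -> \bar R}) D :
  measurable D -> (m D < +oo)%E ->
  locally_sigma_additive setT (fun A => fine (m (D `&` A))).
Proof.
move=> mD Dfin F mF tF _.
have fin A : measurable A -> m (D `&` A) \is a fin_num.
  move=> mA; rewrite ge0_fin_numE// (le_lt_trans _ Dfin)//.
  have mDA : measurable (D `&` A) by exact: measurableI.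
  by apply: le_measure; [exact/mem_set|exact/mem_set|exact: subIsetl].
have := @measure_semi_sigma_additive _ _ _ m (fun n => D `&` F n).
rewrite -setI_bigcupr => h.
have {}h : (fun n => \sum_(0 <= k < n) m (D `&` F k))%E @ \oo --> m (D `&` \bigcup_n F n).
  apply: h.
  - by move=> n; exact: measurableI.
  - exact: trivIset_setIl.
  - by apply: measurableI => //; exact: bigcupT_measurable.
rewrite (_ : (fun n => _) = fine \o (fun n => \sum_(0 <= k < n) m (D `&` F k))%E).
  apply: fine_cvg; rewrite fineK//; apply: fin.
  exact: bigcupT_measurable.
apply/funext => n /=; rewrite big_mkord sum_fine// => k _.
exact: fin.
Qed.

End finite_signed_measures.

(** * Quantile maps into the Cantor space *)

Section quantile.
Context {R : realType}.

Definition quantile_mass (g : seq bool -> R) (B : set code) : R :=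
  fine (lebesgue_measure (tree_itv g [::] `&` (tree_bits g @^-1` B))).

Variable g : seq bool -> R.

Lemma measurable_tree_itv p : measurable (tree_itv g p).
Proof.
rewrite (_ : tree_itv g p = `[tree_left g p, tree_left g p + g p[%classic)//.
Qed.

Lemma tree_bits_bigcup n : [set y | tree_bits g y n] =
  \bigcup_(p in [set p | size p = n]) tree_itv g (rcons p true).
Proof.
apply/seteqP; split => y /=; first by move=> /asboolP[p [sp hp]]; exists p.
by move=> [p sp hp]; apply/asboolP; exists p.
Qed.

Lemma measurable_tree_bits : measurable_fun [set: measurableTypeR R] (tree_bits g : _ -> code).
Proof.
apply: measurable_fun_code => n; rewrite tree_bits_bigcup bigcup_mkcond.
apply: countable_bigcupT_measurable => // p; case: ifP => // _.
exact: measurable_tree_itv.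
Qed.

Hypotheses (g0 : forall p, 0 <= g p) (ga : tree_additive g).

Lemma lebesgue_tree_itv p : lebesgue_measure (tree_itv g p) = (g p)%:E.
Proof.
rewrite (_ : tree_itv g p = `[tree_left g p, tree_left g p + g p[%classic); last first.
  by apply/seteqP; split => y; rewrite /tree_itv /= in_itv.
rewrite lebesgue_measure_itv /= lte_fin ltrDl; case: ifPn => [_|].
  by rewrite -EFinB addrAC subrr add0r.
by rewrite -leNgt => gp; congr EFin; apply/eqP; rewrite eq_le g0 gp.
Qed.

(** Countable additivity is inherited from the Lebesgue measure by transport along [tree_bits], so
    finite additivity of [g] on cells is enough. *)
Lemma quantile_mass_sigma_additive : locally_sigma_additive setT (quantile_mass g).
Proof.
apply: (lsa_preimage (m := fun A => fine (lebesgue_measure (tree_itv g [::] `&` A))) measurable_tree_bits).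
apply: (@lsa_fine_measure _ _ _ (@lebesgue_measure R)); first exact: measurable_tree_itv.
by have := ltry (g [::]); rewrite -lebesgue_tree_itv.
Qed.

Lemma quantile_mass_cell p : quantile_mass g (code_cell p) = g p.
Proof.
rewrite /quantile_mass (_ : _ `&` _ = tree_itv g p) ?lebesgue_tree_itv//.
apply/seteqP; split => y.
  by move=> [y0 yp]; apply/(tree_bits_itv g0 ga).
by move/(tree_bits_itv g0 ga).
Qed.

End quantile.

Section quantile_kernel.
Context {R : realType} {d} {M : measurableType d}.
Variable g : seq bool -> M -> R.
Hypothesis mg : forall p, measurable_fun setT (g p).
Hypothesis g0 : forall p nu, 0 <= g p nu.

Lemma measurable_tree_left p : measurable_fun setT (fun nu => tree_left (g ^~ nu) p).
Proof.
rewrite /tree_left; apply: measurable_sum => i.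
by case: (nth false p i).
Qed.

Lemma measurable_tree_itv2 p :
  measurable [set z : M * measurableTypeR R | tree_itv (g ^~ z.1) p z.2].
Proof.
rewrite (_ : [set z | _] = [set z | tree_left (g ^~ z.1) p <= z.2] `&`
   [set z | z.2 < tree_left (g ^~ z.1) p + g p z.1]); last first.
  by apply/seteqP; split => z; rewrite /tree_itv /= => /andP.
have m1 : measurable_fun setT (fun z : M * measurableTypeR R => tree_left (g ^~ z.1) p).
  exact: (measurableT_comp (measurable_tree_left p) measurable_fst).
have m2 : measurable_fun setT (fun z : M * measurableTypeR R => z.2 : R) by exact: measurable_snd.
have m3 : measurable_fun setT (fun z : M * measurableTypeR R => tree_left (g ^~ z.1) p + g p z.1).
  by apply: measurable_funD => //; exact: (measurableT_comp (mg p) measurable_fst).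
apply: measurableI.
  rewrite -[X in measurable X]setTI.
  exact: (measurable_fun_ler m1 m2 measurableT (Y := [set true])).
rewrite -[X in measurable X]setTI.
exact: (measurable_fun_ltr m2 m3 measurableT (Y := [set true])).
Qed.

(** The parameter and the point of the line are treated jointly: the points sent into B form a
    measurable subset of the product, and the Lebesgue measure of its sections depends measurably on
    the parameter. *)
Lemma measurable_quantile_mass (B : set code) : measurable B ->
  measurable_fun setT (fun nu => quantile_mass (g ^~ nu) B).
Proof.
move=> mB.
pose S := [set z : M * measurableTypeR R | tree_itv (g ^~ z.1) [::] z.2 /\ B (tree_bits (g ^~ z.1) z.2)].
have mS : measurable S.
  rewrite /S (_ : [set z | _] = [set z | tree_itv (g ^~ z.1) [::] z.2] `&`
    ((fun z : M * measurableTypeR R => tree_bits (g ^~ z.1) z.2) @^-1` B))//.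
  apply: measurableI; first exact: measurable_tree_itv2.
  rewrite -[X in measurable X]setTI.
  suff : measurable_fun setT ((fun z => tree_bits (g ^~ z.1) z.2) : M * measurableTypeR R -> code).
    exact.
  apply: measurable_fun_code => n.
  rewrite (_ : [set z | _] = \bigcup_(p in [set p | size p = n])
      [set z : M * measurableTypeR R | tree_itv (g ^~ z.1) (rcons p true) z.2]).
    rewrite bigcup_mkcond; apply: countable_bigcupT_measurable => // p; case: ifP => // _.
    exact: measurable_tree_itv2.
  apply/seteqP; split => y /=; first by move=> /asboolP[p [sp hp]]; exists p.
  by move=> [p sp hp]; apply/asboolP; exists p.
have := measurable_fun_xsection (@lebesgue_measure R) mS.
move=> /(measurableT_comp (fine_measurable measurableT)).
rewrite (_ : _ \o _ = fun nu => quantile_mass (g ^~ nu) B)//.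
apply/funext => nu; rewrite /quantile_mass /=; congr (fine (lebesgue_measure _)).
by apply/seteqP; split => [y /xsectionP//|y ?]; apply/xsectionP.
Qed.

End quantile_kernel.

(** This supplies [tree_bounded] for the cell values of a genuine measure, whose positive variation
    is finite. It rests on the superadditivity of the variation over the two halves of a cell. *)
Lemma tree_pos_le_variation {R : realType} d (T : measurableType d) (zeta : set T -> R)
    (cell : seq bool -> set T) : locally_sigma_additive setT zeta ->
  (forall p, measurable (cell p)) ->
  (forall p, cell p = cell (rcons p false) `|` cell (rcons p true)) ->
  (forall p, cell (rcons p false) `&` cell (rcons p true) = set0) ->
  forall n p, ((tree_pos (fun q => zeta (cell q)) n p)%:E <= pos_variation setT zeta (cell p))%E.
Proof.
move=> sz mc cU cI; have bT : bornology [set: set T] by [].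
elim=> [|n ih] p /=; last first.
  by rewrite EFinD (le_trans (leeD (ih _) (ih _)))// (cU p) pos_variation_superadd.
rewrite EFin_max ge_max pos_variation_ge0// andbT.
exact: pos_variation_ub.
Qed.

(** * Measurable reconstruction from countably many cells *)

Section reconstruction.
Context {R : realType} {dT dM} {T : measurableType dT} {M : measurableType dM}.
Variables (E : nat -> set T) (decode : code -> T).
Hypothesis mE : forall n, measurable (E n).
Hypothesis mdecode : measurable_fun setT decode.

(** With a measurable left inverse [decode], the sets E n separate points and T becomes a part of
    the Cantor space; this is the standard Borel property in the form used here. *)
Definition encode (x : T) : code := fun n => `[< E n x >].

Hypothesis decodeK : cancel encode decode.

Definition cell p : set T := encode @^-1` code_cell p.

Lemma measurable_encode : measurable_fun setT encode.
Proof.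
apply: measurable_fun_code => n; rewrite (_ : [set x | _] = E n)//.
by apply/seteqP; split => x /asboolP.
Qed.

Lemma measurable_cell p : measurable (cell p).
Proof.
rewrite -[X in measurable X]setTI; apply: measurable_encode => //.
exact: measurable_code_cell.
Qed.

Lemma code_cell_rcons p b s :
  code_cell (rcons p b) s <-> code_cell p s /\ s (size p) = b.
Proof.
rewrite /code_cell /= size_rcons /mkseq -addn1 iotaD map_cat/= add0n cats1.
split => [/eqP|[-> ->]//]; rewrite eqseq_rcons => /andP[/eqP-> /eqP->]//.
Qed.

Lemma cell_nil : cell [::] = setT.
Proof. by apply/seteqP; split. Qed.

Lemma cellU p : cell p = cell (rcons p false) `|` cell (rcons p true).
Proof.
apply/seteqP; split => x; rewrite /cell /=.
  move=> h; have [e|e] := boolP (encode x (size p)); [right|left];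
    by apply/code_cell_rcons; split => //; exact/negbTE.
by move=> [] /code_cell_rcons[].
Qed.

Lemma cellI p : cell (rcons p false) `&` cell (rcons p true) = set0.
Proof.
apply/seteqP; split => x // []; rewrite /cell /=.
by move=> /code_cell_rcons[_ e1] /code_cell_rcons[_]; rewrite e1.
Qed.

(** Where the data come from a measure, the answer is forced by uniqueness on cells; at the other
    parameters it only has to be sigma-additive and measurable in the parameter. *)
Lemma signed_reconstruction (f : seq bool -> M -> R) :
  (forall p, measurable_fun setT (f p)) ->
  exists Psi : M -> set T -> R,
  [/\ forall nu, locally_sigma_additive setT (Psi nu),
      forall A, measurable A -> measurable_fun setT (Psi ^~ A) &
      forall nu zeta, locally_sigma_additive setT zeta ->
        (forall p, f p nu = zeta (cell p)) ->
        forall A, measurable A -> Psi nu A = zeta A].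
Proof.
move=> mf.
(* The consistent parameters: additive data of bounded positive variation. Countably many measurable
   conditions define this set, and it contains every parameter whose data come from a measure. *)
pose G : set M := [set nu | tree_additive (f ^~ nu) /\ tree_bounded (f ^~ nu)].
have mpos0 (h : seq bool -> M -> R) : (forall p, measurable_fun setT (h p)) -> forall n p, measurable_fun setT (fun nu => tree_pos (h ^~ nu) n p).
  move=> mh; elim=> [|n ih] p /=; last by apply: measurable_funD; exact: ih.
  by apply: measurable_maxr.
have mG : measurable G.
  rewrite (_ : G = (~` \bigcup_p (fun nu => f p nu - (f (rcons p false) nu + f (rcons p true) nu)) @^-1` (~` [set 0]))
     `&` \bigcup_(C : nat) \bigcap_(n : nat) [set nu | tree_pos (f ^~ nu) n [::] <= C%:R]).
    apply: measurableI.
      apply: measurableC; apply: countable_bigcupT_measurable => // p.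
      rewrite -[X in measurable X]setTI.
      have : measurable_fun setT (fun nu => f p nu - (f (rcons p false) nu + f (rcons p true) nu)).
        by apply: measurable_funB => //; exact: measurable_funD.
      by apply => //; exact: measurableC.
    apply: bigcupT_measurable => C; apply: bigcapT_measurable => n.
    rewrite -[X in measurable X]setTI.
    exact: (measurable_fun_ler (mpos0 _ mf n [::]) (@measurable_cst _ _ _ _ setT (C%:R : R)) measurableT (Y := [set true])).
  apply/seteqP; split => nu; rewrite /G /=.
    move=> [fa [C fC]]; split.
      by move=> [p _ /=]; apply; rewrite (fa p) subrr.
    have [k Ck] : exists k : nat, C <= k%:R.
      by exists (Num.bound `|C|); rewrite (le_trans (ler_norm _))// ltW// archi_boundP.
    by exists k => // n _ /=; rewrite (le_trans (fC n)).
  move=> [h [k _ hk]]; split; last by exists k%:R => n; exact: hk.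
  move=> p; apply/eqP; rewrite -subr_eq0; apply/eqP; apply: contrapT => hp.
  by apply: h; exists p.
(* Inconsistent data are replaced by 0, which is additive and bounded, so that the Jordan
   decomposition below makes sense at every parameter. *)
pose f' p nu := \1_G nu * f p nu.
have mf' p : measurable_fun setT (f' p).
  by apply: measurable_funM => //; exact: measurable_indic.
have pos0 n p : tree_pos (fun=> 0 : R) n p = 0.
  by elim: n p => [|n ih] p /=; rewrite ?maxxx// !ih addr0.
have f'G nu : G nu -> f' ^~ nu = f ^~ nu.
  by move=> Gn; apply/funext => p; rewrite /f' indicE mem_set// mul1r.
have f'N nu : ~ G nu -> f' ^~ nu = fun=> 0.
  by move=> Gn; apply/funext => p; rewrite /f' indicE memNset// mul0r.
have f'a nu : tree_additive (f' ^~ nu).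
  have [Gn|Gn] := pselect (G nu); first by rewrite f'G//; have [] := Gn.
  by rewrite f'N// => p; rewrite addr0.
have f'b nu : tree_bounded (f' ^~ nu).
  have [Gn|Gn] := pselect (G nu); first by rewrite f'G//; have [] := Gn.
  by rewrite f'N//; exists 0 => n; rewrite pos0.
(* The data split as [g - h], both nonnegative and additive, hence both realized by quantile
   maps. *)
pose g p nu := tree_pos_lim (f' ^~ nu) p.
pose h p nu := g p nu - f' p nu.
have mg p : measurable_fun setT (g p).
  apply: (measurable_fun_cvg (mpos0 f' mf' ^~ p)) => nu _.
  exact: (tree_pos_cvg (f'a nu) (f'b nu)).
have mh p : measurable_fun setT (h p) by exact: measurable_funB.
have gmax p nu := tree_pos_lim_ge p (f'a nu) (f'b nu).
have g0 p nu : 0 <= g p nu by apply: le_trans (gmax p nu); rewrite le_max lexx orbT.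
have h0 p nu : 0 <= h p nu.
  by rewrite subr_ge0; apply: le_trans (gmax p nu); rewrite le_max lexx.
have ga nu : tree_additive (g ^~ nu) := tree_pos_lim_additive (f'a nu) (f'b nu).
have ha nu : tree_additive (h ^~ nu).
  by move=> p; rewrite /h (ga nu p) (f'a nu p); ring.
have mpre A : measurable A -> measurable (decode @^-1` A).
  by move=> mA; rewrite -[X in measurable X]setTI; exact: mdecode.
pose Q nu B := quantile_mass (g ^~ nu) B - quantile_mass (h ^~ nu) B.
have Qs nu : locally_sigma_additive setT (Q nu).
  apply: lsaB; apply: quantile_mass_sigma_additive.
  - by move=> p; exact: g0.
  - by move=> p; exact: h0.
(* The image under [decode] brings all the mass of the Cantor space to T, including mass lying off
   the range of [encode]. *)
exists (fun nu A => Q nu (decode @^-1` A)); split.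
- by move=> nu; apply: lsa_preimage.
- by move=> A mA; apply: measurable_funB; apply: measurable_quantile_mass => //; exact: mpre.
- move=> nu zeta sz fz A mA.
  have Gn : G nu.
    have fE : f ^~ nu = fun p => zeta (cell p) by apply/funext => p; exact: fz.
    have bT : bornology [set: set T] by [].
    split; rewrite fE.
      move=> p; rewrite {1}cellU (lsaU bT sz)//; [exact: measurable_cell..|exact: cellI].
    exists (fine (pos_variation setT zeta setT)) => n.
    rewrite -lee_fin fineK; last first.
      by rewrite ge0_fin_numE ?pos_variation_lty ?pos_variation_ge0.
    rewrite -[X in pos_variation _ _ X]cell_nil.
    by apply: tree_pos_le_variation => // p; [exact: measurable_cell|exact: cellU|exact: cellI].
  have Qcell p : Q nu (code_cell p) = zeta (cell p).
    rewrite /Q !quantile_mass_cell//.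
    by rewrite /h opprB addrC subrK -fz; have /(congr1 (@^~ p)) := f'G _ Gn.
  (* Since [decode] is a left inverse of [encode], the comparison can take place on the Cantor
     space, where cells generate the sigma-algebra. *)
  have {2}-> : A = encode @^-1` (decode @^-1` A).
    by apply/seteqP; split => x /=; rewrite decodeK.
  apply: (@lsa_unique R _ code code_cells _ (fun B => zeta (encode @^-1` B))) => //.
  - exact: code_cells_setI.
  - exact: lsa_preimage measurable_encode _.
  - rewrite preimage_setT -cell_nil -Qcell; congr (Q _ _).
    by apply/seteqP; split.
  - move=> B [->|[p ->]]; last exact: Qcell.
    rewrite preimage_set0 !(@lsa0 R _ _ setT)//.
  - exact: mpre.
Qed.

Variable bnd : set (set T).
Hypothesis bb : bornology bnd.

(** The real and imaginary parts of the restriction to the bounded set D are finite signed measures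
    on the whole sigma-algebra, to which the signed reconstruction applies; the result is then cut
    down to bounded sets. *)
Lemma lfc_reconstruction (D : set T) (f : seq bool -> M -> R[i]) :
  measurable D -> bnd D ->
  (forall p, measurable_fun setT (fun nu => complex.Re (f p nu))) ->
  (forall p, measurable_fun setT (fun nu => complex.Im (f p nu))) ->
  exists2 Phi : M -> lfc_space R bnd, measurable_fun setT Phi &
    forall nu (mu : lfcmeasure R bnd), (forall p, f p nu = mu (cell p `&` D)) ->
      forall A, measurable A -> bnd A -> Phi nu A = mu (A `&` D).
Proof.
move=> mD bD mr mi; have [b0 bs bU] := bb.
have [Pr [sPr mPr uPr]] := signed_reconstruction mr.
have [Pi [sPi mPi uPi]] := signed_reconstruction mi.
pose v nu A : R[i] := if pselect (measurable A /\ bnd A) then (Pr nu A +i* Pi nu A)%C else 0.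
have vE nu A : measurable A -> bnd A -> v nu A = (Pr nu A +i* Pi nu A)%C.
  by move=> mA bA; rewrite /v; case: pselect => // -[].
have vout nu A : ~ (measurable A /\ bnd A) -> v nu A = 0 by rewrite /v; case: pselect.
have vs nu (F : nat -> set T) : (forall n, measurable (F n)) -> trivIset setT F ->
    bnd (\bigcup_n F n) -> ccvg (fun n => \sum_(k < n) v nu (F k)) (v nu (\bigcup_n F n)).
  move=> mF tF bF; rewrite vE//; last exact: bigcupT_measurable.
  have bFn k : bnd (F k) by apply: bs bF; exact: bigcup_sup.
  split.
    rewrite (_ : (fun n => _) = fun n => \sum_(k < n) Pr nu (F k)); first exact: sPr.
    by apply/funext => n; rewrite raddf_sum; apply: eq_bigr => k _; rewrite vE.
  rewrite (_ : (fun n => _) = fun n => \sum_(k < n) Pi nu (F k)); first exact: sPi.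
  by apply/funext => n; rewrite raddf_sum; apply: eq_bigr => k _; rewrite vE.
pose Phi nu : lfc_space R bnd := LFCMeasure (@vout nu) (@vs nu).
exists Phi.
  apply: (@measurability _ _ M (lfc_space R bnd) setT Phi (@lfc_cylinder R _ _ bnd)) => //.
  move=> _ [B [A [V [mA bA mV [->|->]]]] <-]; rewrite setTI.
    rewrite (_ : _ @^-1` _ = (Pr ^~ A) @^-1` V); last first.
      by apply/seteqP; split => nu /=; rewrite vE.
    by rewrite -[X in measurable X]setTI; exact: mPr.
  rewrite (_ : _ @^-1` _ = (Pi ^~ A) @^-1` V); last first.
    by apply/seteqP; split => nu /=; rewrite vE.
  by rewrite -[X in measurable X]setTI; exact: mPi.
move=> nu mu fmu A mA bA; rewrite /Phi/= vE//.
have bAD B : bnd (B `&` D) by apply: bs bD; exact: subIsetr.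
have sre : locally_sigma_additive setT (fun A => complex.Re (mu (A `&` D))).
  move=> F mF tF _; rewrite setI_bigcupl; apply: lfc_re_sigma_additive.
  - by move=> n; exact: measurableI.
  - exact: trivIset_setIr.
  - by rewrite -setI_bigcupl.
have sim : locally_sigma_additive setT (fun A => complex.Im (mu (A `&` D))).
  move=> F mF tF _; rewrite setI_bigcupl; apply: lfc_im_sigma_additive.
  - by move=> n; exact: measurableI.
  - exact: trivIset_setIr.
  - by rewrite -setI_bigcupl.
rewrite (uPr _ _ sre) ?(uPi _ _ sim)//; last 2 first.
  by move=> p; rewrite fmu.
  by move=> p; rewrite fmu.
by case: (mu _).
Qed.

End reconstruction.

(** * Determination by the complement *)

Section complex_sequences.
Context {R : realType}.
Implicit Types (u v : nat -> R[i]) (l m : R[i]).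

Lemma ccvgD u v l m : ccvg u l -> ccvg v m -> ccvg (fun n => u n + v n) (l + m).
Proof.
move=> [u1 u2] [v1 v2]; split.
  rewrite (_ : (fun n => _) = fun n => complex.Re (u n) + complex.Re (v n)).
    by rewrite raddfD; exact: cvgD.
  by apply/funext => n; rewrite raddfD.
rewrite (_ : (fun n => _) = fun n => complex.Im (u n) + complex.Im (v n)).
  by rewrite raddfD; exact: cvgD.
by apply/funext => n; rewrite raddfD.
Qed.

Lemma ccvg_cst l : ccvg (fun=> l) l.
Proof. by split; exact: cvg_cst. Qed.

Lemma ccvgM u v l m : ccvg u l -> ccvg v m -> ccvg (fun n => u n * v n) (l * m).
Proof.
move: l m => [a b] [a' b'] [/= u1 u2] [/= v1 v2]; split => /=.
  rewrite (_ : (fun n => _) = fun n => complex.Re (u n) * complex.Re (v n) - complex.Im (u n) * complex.Im (v n)).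
    by apply: cvgB; exact: cvgM.
  by apply/funext => n; case: (u n) => ? ?; case: (v n).
rewrite (_ : (fun n => _) = fun n => complex.Re (u n) * complex.Im (v n) + complex.Im (u n) * complex.Re (v n)).
  by apply: cvgD; exact: cvgM.
by apply/funext => n; case: (u n) => ? ?; case: (v n).
Qed.

Lemma ccvgN u l : ccvg u l -> ccvg (fun n => - u n) (- l).
Proof.
move=> /(ccvgM (ccvg_cst (-1))); rewrite mulN1r.
by under eq_fun do rewrite mulN1r.
Qed.

Lemma ccvgB u v l m : ccvg u l -> ccvg v m -> ccvg (fun n => u n - v n) (l - m).
Proof. by move=> h /ccvgN; exact: ccvgD. Qed.

(** Only n <= k n is asked of the indices, since tending to infinity is enough for the limit. *)
Lemma ccvg_sub (k : nat -> nat) u l : (forall n, (n <= k n)%N) -> ccvg u l ->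
  ccvg (fun n => u (k n)) l.
Proof.
move=> hk [u1 u2].
have kinf : k @ \oo --> \oo.
  by move=> A [N _ NA]; exists N => // n /= Nn; apply: NA; exact: leq_trans (hk n).
by split; [exact: (cvg_comp _ _ kinf u1)|exact: (cvg_comp _ _ kinf u2)].
Qed.

Lemma expiD (s t : R) : expi (s + t) = expi s * expi t.
Proof. by rewrite /expi cosD sinD; congr (_ +i* _)%C; rewrite addrC mulrC [X in _ + X]mulrC addrC. Qed.

Lemma expiN (t : R) : expi (- t) = (expi t)^*.
Proof. by rewrite /expi cosN sinN. Qed.

Lemma expi0 : expi (0 : R) = 1.
Proof. by rewrite /expi cos0 sin0. Qed.

Lemma expiNK (t : R) : expi (- t) * expi t = 1.
Proof. by rewrite -expiD addNr expi0. Qed.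

End complex_sequences.

Section real_limits.
Context {R : realType}.
Implicit Types (u x y q : R).

Lemma norm_sin_le x : `|sin x| <= `|x|.
Proof.
wlog x0 : x / 0 <= x.
  move=> H; have [/H//|/ltW x0] := leP 0 x.
  by rewrite -normrN -sinN -[leRHS]normrN H// oppr_ge0.
have [->|xN0] := eqVneq x 0; first by rewrite sin0.
have x0' : 0 < x by rewrite lt_neqAle eq_sym xN0.
have [c _] := @MVT_segment R sin cos 0 x x0 (fun c _ => is_derive_sin c)
  (continuous_subspaceT (@continuous_sin R)).
by rewrite sin0 !subr0 => ->; rewrite normrM ler_piMl// ler_norml cos_geN1 cos_le1.
Qed.

Lemma norm_cosB1_le x : `|cos x - 1| <= `|x|.
Proof.
wlog x0 : x / 0 <= x.
  move=> H; have [/H//|/ltW x0] := leP 0 x.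
  by rewrite -cosN -[leRHS]normrN H// oppr_ge0.
have [c _] := @MVT_segment R cos (fun y => - sin y) 0 x x0 (fun c _ => is_derive_cos c)
  (continuous_subspaceT (@continuous_cos R)).
by rewrite cos0 !subr0 => ->; rewrite normrM ler_piMl// normrN ler_norml sin_geN1 sin_le1.
Qed.

Lemma cvg_diff_quot (f : R -> R) (l : R) (t : nat -> R) : is_derive (0 : R) (1 : R) f l ->
  (forall n, t n != 0) -> t @ \oo --> 0 -> (fun n => (f (t n) - f 0) / t n) @ \oo --> l.
Proof.
move=> df tN0 ct; have [dr dl] := df.
have h : (fun h => h^-1 *: (f (h *: 1 + 0) - f 0)) @ 0^' --> l.
  by rewrite -dl; exact: dr.
have ct' : t @ \oo --> 0^'.
  move=> A [e /= e0 eA]; have /cvgrPdist_lt/(_ _ e0)[N _ hN] := ct.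
  exists N => // n Nn; apply: eA; [exact: hN|exact: tN0].
have := cvg_comp _ _ ct' h; rewrite /comp.
rewrite (_ : (fun n => _) = fun n => (f (t n) - f 0) / t n)//.
by apply/funext => n /=; rewrite addr0 /GRing.scale/= mulr1 mulrC.
Qed.

Lemma cvg_sin_quot x (t : nat -> R) : (forall n, t n != 0) -> t @ \oo --> 0 ->
  (fun n => sin (x * t n) / t n) @ \oo --> x.
Proof.
move=> tN0 ct; have df : is_derive (0 : R) 1 (fun s : R => sin (x * s)) x.
  by apply: is_derive_eq; rewrite mulr0 cos0 /GRing.scale/=; ring.
have := cvg_diff_quot df tN0 ct.
by under eq_fun do rewrite mulr0 sin0 subr0.
Qed.

Lemma cvg_cos_quot x (t : nat -> R) : (forall n, t n != 0) -> t @ \oo --> 0 ->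
  (fun n => (cos (x * t n) - 1) / t n) @ \oo --> 0.
Proof.
move=> tN0 ct; have df : is_derive (0 : R) 1 (fun s : R => cos (x * s)) 0.
  by apply: is_derive_eq; rewrite mulr0 sin0 /GRing.scale/=; ring.
have := cvg_diff_quot df tN0 ct.
by under eq_fun do rewrite mulr0 cos0.
Qed.

Lemma bernoulli_ge x n : -1 <= x -> 1 + n%:R * x <= (1 + x) ^+ n.
Proof.
move=> x1; elim: n => [|n ih]; first by rewrite mul0r addr0 expr0.
have x1' : 0 <= 1 + x by lra.
rewrite exprS; apply: (@le_trans _ _ ((1 + x) * (1 + n%:R * x))); last by rewrite ler_wpM2l.
rewrite -[n.+1]addn1 natrD; have := mulr_ge0 (ler0n R n) (sqr_ge0 x); rewrite expr2.
nra.
Qed.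

Lemma cvg_natmul_expr q : 0 <= q < 1 -> (fun n => n%:R * q ^+ n) @ \oo --> 0.
Proof.
move=> /andP[q0 q1]; have [->|qN0] := eqVneq q 0.
  apply: cvg_near_cst; exists 1%N => // n /= n0.
  by rewrite expr0n gtn_eqF// mulr0.
(* With s the square root of q, n q^n is the product of n s^n, bounded by Bernoulli, and of s^n,
   which tends to 0. *)
pose s := Num.sqrt q.
have qp : 0 < q by rewrite lt_neqAle eq_sym qN0.
have s0 : 0 < s by rewrite sqrtr_gt0.
have s1 : s < 1 by rewrite -sqrtr1 ltr_sqrt.
have sE : q = s * s by rewrite -expr2 sqr_sqrtr.
pose h := s^-1 - 1.
have h0 : 0 < h by rewrite subr_gt0 invf_gt1.
have ns n : n%:R * s ^+ n <= h^-1.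
  have h1 : -1 <= h by rewrite (le_trans _ (ltW h0))// lerN10.
  have E : 1 + h = s^-1 by rewrite /h addrC subrK.
  have := bernoulli_ge n h1; rewrite E exprVn => H.
  have sn : 0 < s ^+ n by rewrite exprn_gt0.
  have H2 : n%:R * h <= s ^- n by lra.
  have := ler_wpM2r (ltW sn) H2; rewrite mulVf ?gt_eqF// => H3.
  by rewrite -[leRHS]mul1r ler_pdivlMr// mulrAC.
apply: (@squeeze_cvgr _ _ _ _ (cst 0) (fun n => h^-1 * s ^+ n)).
- apply: nearW => n; rewrite mulr_ge0 ?exprn_ge0//= sE exprMn mulrA.
  by rewrite ler_wpM2r// exprn_ge0// ltW.
- exact: cvg_cst.
- rewrite -(mulr0 h^-1); apply: cvgMr; apply: cvg_expr.
  by rewrite ger0_norm// ltW.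
Qed.

(* By Bernoulli, with (n 2^n) u^n = n (2u)^n, which tends to 0 or to infinity. *)
Lemma cvg_cutoff u : 0 <= u < 1 ->
  (fun n => (1 + - 1 * u ^+ n) ^+ (n * 2 ^ n)) @ \oo --> ((u < 1 / 2)%R%:R : R).
Proof.
move=> /andP[u0 u1].
have y01 n : 0 <= u ^+ n <= 1 by rewrite exprn_ge0//= exprn_ile1// ltW.
have ME n : (n * 2 ^ n)%:R * u ^+ n = n%:R * (2 * u) ^+ n.
  by rewrite natrM natrX exprMn mulrA.
have P01 n : 0 <= (1 + -1 * u ^+ n) ^+ (n * 2 ^ n) <= 1.
  by have /andP[h1 h2] := y01 n; rewrite exprn_ge0 ?exprn_ile1//=; lra.
have [h|h] := ltP u (1 / 2) => /=.
  apply: (@squeeze_cvgr _ _ _ _ (fun n => 1 - n%:R * (2 * u) ^+ n) (cst 1)).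
  - apply: nearW => n; have /andP[_ ->] := P01 n; rewrite andbT -ME -mulrN -mulN1r.
    by apply: bernoulli_ge; have /andP[] := y01 n; lra.
  - rewrite -[X in _ --> X]subr0; apply: cvgB; first exact: cvg_cst.
    by apply: cvg_natmul_expr; lra.
  - exact: cvg_cst.
apply: (@squeeze_cvgr _ _ _ _ (cst 0) (fun n => n.+1%:R^-1)).
- apply: nearW => n; have /andP[-> _] := P01 n; rewrite andTb.
  have /andP[h1 h2] := y01 n; set y := u ^+ n in h1 h2 *; set M := (n * 2 ^ n)%N.
  have p1 : 0 < (1 + y) ^+ M by rewrite exprn_gt0//; lra.
  have nM : n.+1%:R <= (1 + y) ^+ M.
    apply: (@le_trans _ _ (1 + M%:R * y)); last by apply: bernoulli_ge; lra.
    rewrite ME -addn1 natrD addrC lerD2l ler_peMr// exprn_ege1//; lra.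
  apply: (@le_trans _ _ ((1 + y) ^+ M)^-1); last by rewrite lef_pV2 ?posrE.
  rewrite -[leRHS]mul1r ler_pdivlMr// -exprMn exprn_ile1//; nra.
- exact: cvg_cst.
- exact: cvg_harmonic.
Qed.

End real_limits.

Section integrals_of_nonneg_functions.
Context {R : realType} d (T : measurableType d) (mu : {measure set T -> \bar R}).
Local Open Scope ereal_scope.

(* [g] need not be measurable: its integral is then a lower integral. *)
Lemma ge0_le_lower_integral (f g : T -> \bar R) : (forall x, 0 <= f x) ->
  (forall x, f x <= g x) -> \int[mu]_x f x <= \int[mu]_x g x.
Proof.
move=> f0 fg; have g0 x : 0 <= g x by exact: le_trans (fg x).
rewrite !ge0_integralTE//; apply: ereal_sup_le => _ [h hf <-].
by exists h => // x; exact: le_trans (fg x).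
Qed.

(** The indices are chosen with integrals at most 2^-(n+1), so the series of the chosen functions
    has a finite integral; it converges almost everywhere and its terms tend to 0. *)
Lemma cvg0_ae_subseq (Y : nat -> T -> R) :
  (forall n, measurable_fun setT (Y n)) -> (forall n x, 0 <= Y n x)%R ->
  (fun n => \int[mu]_x (Y n x)%:E) @ \oo --> 0 ->
  exists2 k : nat -> nat, (forall n, n <= k n)%N &
    {ae mu, forall x, (fun n => Y (k n) x) @ \oo --> 0%R}.
Proof.
move=> mY Y0 cY.
have /choice[k kP] n : exists m, (n <= m)%N /\ \int[mu]_x (Y m x)%:E <= ((1 / (2 ^ n.+1)%:R)%:E).
  have e0 : (0 < 1 / (2 ^ n.+1)%:R :> R)%R by rewrite divr_gt0// ltr0n expn_gt0.
  have /fine_cvgP[[N1 _ hN1] /cvgrPdist_le /(_ _ e0)[N2 _ hN2]] := cY.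
  exists (maxn n (maxn N1 N2)); split; first exact: leq_maxl.
  have h1 := hN1 (maxn n (maxn N1 N2)); have h2 := hN2 (maxn n (maxn N1 N2)).
  have /= {}h1 := h1 (leq_trans (leq_maxl _ _) (leq_maxr _ _)).
  have /= {}h2 := h2 (leq_trans (leq_maxr _ _) (leq_maxr _ _)).
  by rewrite -(fineK h1) lee_fin; move: h2; rewrite sub0r normrN; apply: le_trans; exact: ler_norm.
exists k; first by move=> n; have [] := kP n.
have mYE n : measurable_fun setT (fun x => (Y n x)%:E) by exact/measurable_EFinP.
have Y0E n x : 0 <= (Y n x)%:E by rewrite lee_fin.
have mS : measurable_fun setT (fun x => \sum_(n <oo) (Y (k n) x)%:E).
  by apply: ge0_emeasurable_sum => // n x _ _.
have S0 x : 0 <= \sum_(n <oo) (Y (k n) x)%:E by exact: nneseries_ge0.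
have intS : mu.-integrable setT (fun x => \sum_(n <oo) (Y (k n) x)%:E).
  apply/integrableP; split => //.
  under eq_integral do rewrite gee0_abs//.
  rewrite integral_nneseries//.
  apply: (@le_lt_trans _ _ (\sum_(n <oo) (1 / (2 ^ n.+1)%:R : R)%:E)).
    by apply: lee_nneseries => [n _ _|n _]; [exact: integral_ge0|have [] := kP n].
  by apply: (le_lt_trans (epsilon_trick0 xpredT ler01)); rewrite ltry.
have := integrable_ae measurableT intS.
apply: filterS => x /(_ I) fS.
have : cvgn (series (fun n => Y (k n) x)).
  apply: nondecreasing_is_cvgn; first by apply: nondecreasing_series => n _ _.
  exists (fine (\sum_(n <oo) (Y (k n) x)%:E)) => _ [n _ <-] /=.
  rewrite -lee_fin fineK// /series/= -sumEFin.
  by apply: (nneseries_lim_ge n) => i _ _.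
exact: cvg_series_cvg_0.
Qed.
End integrals_of_nonneg_functions.

(** * Random variables that are functions of another one *)

Section almost_sure_functions.
Context {R : realType} {dO dM} {Omega : measurableType dO} {M : measurableType dM}.
Variables (P : probability Omega R) (Y : Omega -> M).

Definition determined (X : Omega -> R) : Prop :=
  exists2 f : M -> R, measurable_fun setT f & {ae P, forall w, X w = f (Y w)}.

Lemma determined_comp f : measurable_fun setT f -> determined (fun w => f (Y w)).
Proof. by move=> mf; exists f => //; exact: aeW. Qed.

Lemma determined_lin a X Z : determined X -> determined Z ->
  determined (fun w => a * X w + Z w).
Proof.
move=> [f mf fX] [g mg gZ]; exists (fun m => a * f m + g m).
  by apply: measurable_funD => //; exact: measurable_funM.
by apply: filterS2 fX gZ => w -> ->.
Qed.

Lemma determined_cvg (X : nat -> Omega -> R) Z : (forall n, determined (X n)) ->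
  {ae P, forall w, X ^~ w @ \oo --> Z w} -> determined Z.
Proof.
move=> dX cX.
have /choice[f fP] n : exists f : M -> R, measurable_fun setT f /\ {ae P, forall w, X n w = f (Y w)}.
  by have [f mf fX] := dX n; exists f.
(* The upper limit is measurable and defined everywhere, also where the functions f n diverge;
   [fine] discards its infinite values. *)
exists (fun m => fine (limn_esup (fun n => (f n m)%:E))).
  apply: (measurableT_comp (fine_measurable measurableT)).
  apply: measurable_fun_limn_esup => n; apply/measurable_EFinP.
  by have [] := fP n.
have aeX : {ae P, forall w, forall n, X n w = f n (Y w)}.
  by apply: ae_foralln => n; have [] := fP n.
apply: filterS2 aeX cX => w Xw cw.
have h : (fun n => (f n (Y w))%:E) @ \oo --> (Z w)%:E.
  apply: cvg_EFin; first exact: nearW.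
  by rewrite (_ : _ \o _ = X ^~ w)//; apply/funext => n /=; rewrite Xw.
by rewrite is_cvg_limn_esupE; [rewrite (cvg_lim _ h)|apply/cvg_ex; exists (Z w)%:E].
Qed.

End almost_sure_functions.

Section cbounded_functions.
Context {R : realType} {d} {T : measurableType d}.
Implicit Types (f g : T -> R[i]).

Lemma cbounded_supportedM K K' f g : cbounded_supported K f -> cbounded_supported K' g ->
  cbounded_supported (K `&` K') (fun x => f x * g x).
Proof.
move=> [rf jf] [rg jg]; split.
  rewrite (_ : (fun x => _) = fun x => -1 * (complex.Im (f x) * complex.Im (g x)) +
     complex.Re (f x) * complex.Re (g x)).
    by apply: bounded_supported_lin; exact: bounded_supportedM.
  by apply/funext => x; case: (f x) => ? ?; case: (g x) => ? ? /=; ring.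
rewrite (_ : (fun x => _) = fun x => 1 * (complex.Re (f x) * complex.Im (g x)) +
   complex.Im (f x) * complex.Re (g x)).
  by apply: bounded_supported_lin; exact: bounded_supportedM.
by apply/funext => x; case: (f x) => ? ?; case: (g x) => ? ? /=; ring.
Qed.

Lemma cbounded_supported_real K (g : T -> R) : bounded_supported K g ->
  cbounded_supported K (fun x => (g x)%:C%C).
Proof.
move=> bf; split => //=.
by split => //; exists 0 => x; rewrite normr0.
Qed.

Lemma cbounded_supported_scale K (c : R[i]) f : cbounded_supported K f ->
  cbounded_supported K (fun x => c * f x).
Proof.
move=> bf; rewrite (_ : (fun x => _) = fun x => (c - 1) * f x + f x).
  exact: cbounded_supported_lin.
by apply/funext => x; rewrite mulrBl mul1r subrK.
Qed.

Lemma cbounded_supported_expi (g : T -> R) : measurable_fun setT g ->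
  cbounded_supported setT (fun x => expi (g x)).
Proof.
move=> mg; split; split.
- by apply: (measurableT_comp _ mg); apply: continuous_measurable_fun; exact: continuous_cos.
- by exists 1 => x; rewrite /expi/= ler_norml cos_geN1 cos_le1.
- by move=> x [].
- by apply: (measurableT_comp _ mg); apply: continuous_measurable_fun; exact: continuous_sin.
- by exists 1 => x; rewrite /expi/= ler_norml sin_geN1 sin_le1.
- by move=> x [].
Qed.

Lemma cvg_norm_le (u : nat -> R) (l C : R) :
  (forall n, `|u n| <= C) -> u @ \oo --> l -> `|l| <= C.
Proof.
move=> uC cu; rewrite -(cvg_lim (@norm_hausdorff _ _) cu).
have uC' n : - C <= u n <= C by rewrite -ler_norml.
rewrite ler_norml; apply/andP; split.
  by apply: limr_ge; [apply/cvg_ex; exists l|apply: nearW => n; have /andP[] := uC' n].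
by apply: limr_le; [apply/cvg_ex; exists l|apply: nearW => n; have /andP[] := uC' n].
Qed.

End cbounded_functions.

Lemma fine_variance_le {R : realType} d (Omega : measurableType d) (P : probability Omega R)
    (X : Omega -> R) : measurable_fun setT X -> P.-integrable setT (fun w => (X w ^+ 2)%:E) ->
  P.-integrable setT (fun w => ((X w - fine (\int[P]_w (X w)%:E)) ^+ 2)%:E) /\
  fine (\int[P]_w ((X w - fine (\int[P]_w (X w)%:E)) ^+ 2)%:E) <= fine (\int[P]_w (X w ^+ 2)%:E).
Proof.
move=> mX iX2; have i1 c : P.-integrable setT (fun=> c%:E) by exact: finite_measure_integrable_cst.
have iX : P.-integrable setT (fun w => (X w)%:E).
  apply: (le_integrable measurableT _ _ (integrableD measurableT (i1 1) iX2)) => //.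
    exact/measurable_EFinP.
  (* |X| <= 1 + X^2 follows from expanding the square of |X| - 1; so X is integrable because its
     square is. *)
  move=> w _ /=; rewrite lee_fin [leRHS]ger0_norm ?addr_ge0 ?sqr_ge0//.
  have := sqr_ge0 (`|X w| - 1); rewrite -(real_normK (num_real (X w))) sqrrB1.
  have := normr_ge0 (X w); set x := `|X w|; nra.
set m := fine _.
have mE : (\int[P]_w (X w)%:E = m%:E)%E by rewrite fineK//; exact: integrable_fin_num.
have E : (fun w => ((X w - m) ^+ 2)%:E) = (fun w => (X w ^+ 2)%:E + ((- 2 * m)%:E * (X w)%:E + (m ^+ 2)%:E))%E.
  by apply/funext => w; rewrite -EFinM -!EFinD; congr EFin; ring.
have iL : P.-integrable setT (fun w => ((- 2 * m)%:E * (X w)%:E + (m ^+ 2)%:E)%E).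
  by apply: integrableD => //; exact: integrableZl.
rewrite E; split; first exact: integrableD.
rewrite integralD// integralD//; last exact: integrableZl.
have Ec : (\int[P]_w (m ^+ 2)%:E = (m ^+ 2)%:E)%E.
  by have := expectation_cst P (m ^+ 2); rewrite unlock.
rewrite integralZl// mE Ec -EFinM -EFinD.
rewrite fineD//; last exact: integrable_fin_num.
rewrite gerDl /=; have := sqr_ge0 m; nra.
Qed.

Lemma Re_sqr_dist {R : realType} (z m : R[i]) :
  complex.Re ((z - m) * (z - m)^*) =
  (complex.Re z - complex.Re m) ^+ 2 + (complex.Im z - complex.Im m) ^+ 2.
Proof. by case: z m => a b [p q] /=; ring. Qed.

(** * Variance bounds for linear statistics *)

Section second_moments.
Context {R : realType} {dT dO} {T : measurableType dT} {Omega : measurableType dO}.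
Variables (bnd : set (set T)) (bb : bornology bnd).
Variables (P : probability Omega R) (Xi : Omega -> lfc_space R bnd).
Hypothesis mXi : measurable_fun setT Xi.
Hypothesis P2 : second_order P Xi.
Variables (K : set T) (mK : measurable K) (bK : bnd K).

Let TV2 := (\int[P]_w (Defs.total_variation (Xi w) K ^+ 2))%E.

(** The total variation is not known to be measurable in w, so [TV2] is a lower integral; it is
    compared with the square of |X| / C, a measurable function lying below. *)
Lemma square_integrable_le (X : Omega -> R) (C : R) : 0 < C -> measurable_fun setT X ->
  (forall w, ((`|X w|)%:E <= C%:E * Defs.total_variation (Xi w) K)%E) ->
  P.-integrable setT (fun w => (X w ^+ 2)%:E) /\
  fine (\int[P]_w (X w ^+ 2)%:E) <= C ^+ 2 * fine TV2.
Proof.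
move=> C0 mX XC; have CN0 : C != 0 by rewrite gt_eqF.
pose f w := ((`|X w| / C) ^+ 2)%:E.
have f0 w : (0 <= f w)%E by rewrite lee_fin sqr_ge0.
have mf : measurable_fun setT f.
  by apply/measurable_EFinP; apply: measurable_funX; apply: measurable_funM => //; exact: measurableT_comp.
have fTV w : (f w <= Defs.total_variation (Xi w) K ^+ 2)%E.
  have h : ((`|X w| / C)%:E <= Defs.total_variation (Xi w) K)%E.
    rewrite mulrC EFinM -[leRHS]mul1e -(mulVf CN0) EFinM -muleA.
    by rewrite lee_wpmul2l// lee_fin invr_ge0 ltW.
  have h0 : (0 <= (`|X w| / C)%:E)%E by rewrite lee_fin divr_ge0// ltW.
  by rewrite /f EFin_expe /expe /=; apply: lee_pmul.
have le1 : (\int[P]_w f w <= TV2)%E by exact: ge0_le_lower_integral.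
have TVfin : (TV2 < +oo)%E by exact: P2.
have fE : (fun w => (X w ^+ 2)%:E) = (fun w => (C ^+ 2)%:E * f w)%E.
  apply/funext => w; rewrite -EFinM; congr EFin.
  by rewrite expr_div_n real_normK ?num_real// mulrC divfK// expf_neq0.
have intf : P.-integrable setT f.
  apply/integrableP; split=> //; under eq_integral do rewrite gee0_abs//.
  exact: le_lt_trans le1 TVfin.
rewrite fE; split; first exact: integrableZl.
have f0' : (0 <= \int[P]_w f w)%E by exact: integral_ge0.
rewrite integralZl// fineM//; last exact: integrable_fin_num.
rewrite ler_wpM2l ?sqr_ge0// fine_le//.
  exact: integrable_fin_num.
by rewrite ge0_fin_numE// (le_trans f0' le1).
Qed.

Variables (phi : T -> R[i]) (C : R).
Hypothesis bphi : cbounded_supported K phi.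
Hypothesis C0 : 0 < C.
Hypothesis phiC : forall x, `|complex.Re (phi x)| <= C /\ `|complex.Im (phi x)| <= C.

Let Z w := lfc_integral (Xi w) phi.
Let m := cexpectation P Z.
Let Y w := (complex.Re (Z w) - complex.Re m) ^+ 2 + (complex.Im (Z w) - complex.Im m) ^+ 2.

Lemma measurable_linear_statistic :
  measurable_fun setT (fun w => complex.Re (Z w)) /\ measurable_fun setT (fun w => complex.Im (Z w)).
Proof.
have [m1 m2] := measurable_lfc_integral bb mK bK bphi.
by split; [exact: (measurableT_comp m1 mXi)|exact: (measurableT_comp m2 mXi)].
Qed.

(** The variance of the real part, like that of the imaginary part, is at most its second moment,
    itself bounded by (4 C)^2 times the second moment of the total variation. Two such terms make 32
    C^2. *)
Lemma linear_statistic_variance : P.-integrable setT (EFin \o Y) /\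
  [/\ complex.Re (ccovariance P Z Z) = fine (\int[P]_w (Y w)%:E),
      0 <= complex.Re (ccovariance P Z Z) &
      complex.Re (ccovariance P Z Z) <= 32 * C ^+ 2 * fine TV2].
Proof.
have [mZr mZi] := measurable_linear_statistic.
have C4 : 0 < 4 * C by rewrite mulr_gt0.
have [ir ler] := square_integrable_le C4 mZr (fun w => (lfc_integral_le bb (Xi w) mK bK bphi phiC).1).
have [ii lei] := square_integrable_le C4 mZi (fun w => (lfc_integral_le bb (Xi w) mK bK bphi phiC).2).
have [vir vler] := fine_variance_le mZr ir.
have [vii vlei] := fine_variance_le mZi ii.
have mE : m = (fine (\int[P]_w (complex.Re (Z w))%:E) +i* fine (\int[P]_w (complex.Im (Z w))%:E))%C.
  by rewrite /m /cexpectation unlock.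
have covE : complex.Re (ccovariance P Z Z) = fine (\int[P]_w (Y w)%:E).
  have ReE (a b : R) : complex.Re (a +i* b)%C = a by [].
  rewrite /ccovariance {1}/cexpectation ReE unlock; congr fine.
  by apply: eq_integral => w _; congr EFin; rewrite Re_sqr_dist.
have YE : EFin \o Y = (fun w => ((complex.Re (Z w) - complex.Re m) ^+ 2)%:E + ((complex.Im (Z w) - complex.Im m) ^+ 2)%:E)%E.
  by apply/funext => w /=; rewrite -EFinD.
have mr : complex.Re m = fine (\int[P]_w (complex.Re (Z w))%:E) by rewrite mE.
have mi : complex.Im m = fine (\int[P]_w (complex.Im (Z w))%:E) by rewrite mE.
rewrite -mr in vir vler; rewrite -mi in vii vlei.
have iY : P.-integrable setT (EFin \o Y).
  by rewrite YE; apply: integrableD.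
split=> //; split => //.
  rewrite covE fine_ge0// integral_ge0// => w _.
  by rewrite lee_fin addr_ge0 ?sqr_ge0.
rewrite covE (_ : (fun w => (Y w)%:E) = EFin \o Y)// YE integralD//.
rewrite fineD; [|exact: integrable_fin_num..].
rewrite (le_trans (lerD vler vlei))// (le_trans (lerD ler lei))//.
by rewrite le_eqVlt; apply/orP; left; apply/eqP; ring.
Qed.

End second_moments.

Section determination.
Context {R : realType} {dT dO} {T : measurableType dT} {Omega : measurableType dO}.
Variables (bnd : set (set T)) (bb : bornology bnd).
Variables (P : probability Omega R) (Xi : Omega -> lfc_space R bnd).
Hypothesis mXi : measurable_fun setT Xi.
Variables (D : set T) (mD : measurable D) (bD : bnd D).
Variable restr : lfc_space R bnd -> lfc_space R bnd.
Hypothesis restrE : forall mu A, measurable A -> bnd A -> restr mu A = mu (A `&` ~` D).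

Let det := determined P (fun w => restr (Xi w)).

Definition cdetermined (h : T -> R[i]) : Prop :=
  det (fun w => complex.Re (lfc_integral (Xi w) h)) /\
  det (fun w => complex.Im (lfc_integral (Xi w) h)).

Lemma cdetermined_lin c f g : cbounded_supported D f -> cbounded_supported D g ->
  cdetermined f -> cdetermined g -> cdetermined (fun x => c * f x + g x).
Proof.
move: c => [a b] bf bg [rf jf] [rg jg]; split.
  rewrite (_ : (fun w => _) = fun w => a * complex.Re (lfc_integral (Xi w) f) +
    (- b * complex.Im (lfc_integral (Xi w) f) + complex.Re (lfc_integral (Xi w) g))).
    by apply: determined_lin => //; exact: determined_lin.
  apply/funext => w; rewrite (lfc_integral_lin bb _ _ mD bD bf bg).
  by case: (lfc_integral _ f) => ? ?; case: (lfc_integral _ g) => ? ? /=; ring.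
rewrite (_ : (fun w => _) = fun w => a * complex.Im (lfc_integral (Xi w) f) +
  (b * complex.Re (lfc_integral (Xi w) f) + complex.Im (lfc_integral (Xi w) g))).
  by apply: determined_lin => //; exact: determined_lin.
apply/funext => w; rewrite (lfc_integral_lin bb _ _ mD bD bf bg).
by case: (lfc_integral _ f) => ? ?; case: (lfc_integral _ g) => ? ? /=; ring.
Qed.

Lemma cdetermined_scale c f : cbounded_supported D f ->
  cdetermined f -> cdetermined (fun x => c * f x).
Proof.
move=> bf hf; rewrite (_ : (fun x => _) = fun x => (c - 1) * f x + f x).
  exact: cdetermined_lin.
by apply/funext => x; rewrite mulrBl mul1r subrK.
Qed.

Lemma cdetermined_cvg (F : nat -> T -> R[i]) f (C : R) :
  (forall n, cbounded_supported D (F n)) ->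
  (forall n x, `|complex.Re (F n x)| <= C /\ `|complex.Im (F n x)| <= C) ->
  cbounded_supported D f -> (forall x, ccvg (F ^~ x) (f x)) ->
  (forall n, cdetermined (F n)) -> cdetermined f.
Proof.
move=> bF FC bf cF dF; have h w := lfc_integral_cvg bb (Xi w) mD bD bF FC bf cF.
split.
  apply: (determined_cvg (X := fun n w => complex.Re (lfc_integral (Xi w) (F n)))).
    by move=> n; have [] := dF n.
  by apply: aeW => w; have [] := h w.
apply: (determined_cvg (X := fun n w => complex.Im (lfc_integral (Xi w) (F n)))).
  by move=> n; have [] := dF n.
by apply: aeW => w; have [] := h w.
Qed.

(** * From waves with frequencies in an open set to all bounded functions *)

Section stealthy_directions.
Variables (d : nat) (iota : T -> 'rV[R]_d) (V : set 'rV[R]_d).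
Hypothesis miota : forall j, measurable_fun setT (fun x => iota x 0 j).
Hypothesis iota_bounded : exists L : R, forall x j, D x -> `|iota x 0 j| <= L.
Hypothesis V0 : V !=set0.
Hypothesis Vopen : forall a, V a -> forall j : 'I_d,
  exists2 e : R, 0 < e & forall t, `|t| < e -> V (a + t *: delta_mx 0 j).
Hypothesis iota_gen : @measurable _ T `<=`
  <<s [set A | exists j (r : R), A = [set x | iota x 0 j < r]] >>.

Let wave a x : R[i] := expi (dotp a (iota x)).

Hypothesis Vdet : forall a, V a -> cdetermined (fun x => (\1_D x)%:C%C * wave a x).

Let wave_bounded a : cbounded_supported setT (wave a).
Proof.
have mdot : measurable_fun setT (fun x => dotp a (iota x)).
  by rewrite /dotp; apply: measurable_sum => j; exact: measurable_funM.
exact: cbounded_supported_expi mdot.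
Qed.

(** The condition is imposed for all a in V at once: differentiating in a at one frequency uses the
    neighbouring ones. *)
Definition good (g : T -> R) : Prop := bounded_supported D g /\
  forall a, V a -> cdetermined (fun x => (g x)%:C%C * wave a x).

Let gw_bounded g a : bounded_supported D g ->
  cbounded_supported D (fun x => (g x)%:C%C * wave a x).
Proof.
move=> bg; rewrite -[X in cbounded_supported X]setIT.
exact: cbounded_supportedM (cbounded_supported_real bg) (wave_bounded a).
Qed.

Lemma good_lin c f g : good f -> good g -> good (fun x => c * f x + g x).
Proof.
move=> [bf hf] [bg hg]; split; first exact: bounded_supported_lin.
move=> a Va; have := cdetermined_lin c%:C%C (gw_bounded a bf) (gw_bounded a bg) (hf _ Va) (hg _ Va).
rewrite (_ : (fun x => _) = (fun x => (c * f x + g x)%:C%C * wave a x))//.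
by apply/funext => x; rewrite rmorphD rmorphM/=; ring.
Qed.

Lemma wave_le1 a x : `|complex.Re (wave a x)| <= 1 /\ `|complex.Im (wave a x)| <= 1.
Proof. by rewrite /wave/expi/= !ler_norml cos_geN1 cos_le1 sin_geN1 sin_le1. Qed.

Lemma good_cvg (F : nat -> T -> R) f (C : R) : (forall n, good (F n)) ->
  (forall n x, `|F n x| <= C) -> (forall x, F ^~ x @ \oo --> f x) -> good f.
Proof.
move=> gF FC cF.
have bf : bounded_supported D f.
  split.
  - by apply: (measurable_fun_cvg (h := F)) => // n; have [[]] := gF n.
  - by exists C => x; apply: cvg_norm_le (cF x) => n; exact: FC.
  - move=> x Dx; have := cF x.
    have -> : F ^~ x = cst 0 by apply/funext => n; have [[_ _ ->]] := gF n.
    by move=> h; apply: (cvg_unique _ h); [exact: norm_hausdorff|exact: cvg_cst].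
split => // a Va.
apply: (cdetermined_cvg (F := fun n x => (F n x)%:C%C * wave a x) (C := C)).
- by move=> n; apply: gw_bounded; have [] := gF n.
- move=> n x; have [h1 h2] := wave_le1 a x.
  have h k : `|k| <= 1 -> `|F n x * k| <= C.
    by move=> k1; rewrite normrM (le_trans _ (FC n x))// ler_piMr.
  move: h1 h2; case: (wave a x) => u v /= h1 h2.
  by rewrite !mul0r subr0 addr0; split; exact: h.
- exact: gw_bounded.
- by move=> x; apply: ccvgM (ccvg_cst _); split => /=; [exact: cF|exact: cvg_cst].
- by move=> n; have [_] := gF n; exact.
Qed.

Lemma good_indic : good \1_D.
Proof. by split; [exact: bounded_supported_indic|exact: Vdet]. Qed.

(* In the direction of the j-th axis, the derivative of a |-> wave a x is
   'i (iota x 0 j) (wave a x), a bounded limit of difference quotients. *)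
Lemma good_coord j g : good g -> good (fun x => iota x 0 j * g x).
Proof.
move=> [bg hg]; have [L0 HL0] := iota_bounded.
pose L := `|L0|.
have HL x : D x -> `|iota x 0 j| <= L.
  by move=> Dx; rewrite (le_trans (HL0 _ _ Dx))// ler_norm.
have [mg [C gC] gD] := bg.
have bxg : bounded_supported D (fun x => iota x 0 j * g x).
  split; first exact: measurable_funM.
    exists (L * C) => x; have [Dx|Dx] := pselect (D x).
      by rewrite normrM ler_pM// HL.
    by rewrite gD// mulr0 normr0 mulr_ge0 ?normr_ge0// (le_trans (normr_ge0 _) (gC x)).
  by move=> x Dx; rewrite gD// mulr0.
split=> // a Va; have [e e0 he] := Vopen Va j.
(* Dividing by n + 2 instead of n + 1 keeps every increment strictly below e, so the shifted
   frequencies stay in V. *)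
pose t n : R := e / (n.+2)%:R.
have t0 n : 0 < t n by rewrite divr_gt0.
have tN0 n : t n != 0 by rewrite gt_eqF.
have ct : t @ \oo --> 0.
  rewrite -(mulr0 e); apply: cvgMr.
  by rewrite (cvg_shiftS (fun n => n.+1%:R^-1 : R)); exact: cvg_harmonic.
have Vt n : V (a + t n *: delta_mx 0 j).
  apply: he; rewrite gtr0_norm// /t ltr_pdivrMr// ltr_pMr//.
  by rewrite (_ : 1 = 1%:R)// ltr_nat.
have waveD n x : wave (a + t n *: delta_mx 0 j) x = wave a x * expi (iota x 0 j * t n).
  rewrite /wave -expiD; congr expi; rewrite /dotp.
  under eq_bigr do rewrite !mxE mulrDl.
  rewrite big_split/=; congr (_ + _); rewrite (bigD1 j)//= eqxx mulr1 big1 ?addr0.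
    by rewrite mulrC.
  by move=> i ij; rewrite (negbTE ij) mulr0 mul0r.
pose k n : R[i] := (0 +i* (- (t n)^-1))%C.
pose F n x : R[i] := k n * ((g x)%:C%C * wave (a + t n *: delta_mx 0 j) x) +
   (- k n) * ((g x)%:C%C * wave a x).
pose q n x : R[i] := (sin (iota x 0 j * t n) / t n +i* (- ((cos (iota x 0 j * t n) - 1) / t n)))%C.
have FE n x : F n x = q n x * ((g x)%:C%C * wave a x).
  rewrite /F waveD /q /k /expi; case: (wave a x) => u v.
  by apply/eqP; rewrite eq_complex/=; apply/andP; split; apply/eqP; field.
have cq x : ccvg (q ^~ x) (iota x 0 j)%:C%C.
  split => /=; first exact: cvg_sin_quot.
  have : (fun n => - ((cos (iota x 0 j * t n) - 1) / t n)) @ \oo --> - (0 : R).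
    by apply: cvgN; exact: cvg_cos_quot.
  by rewrite oppr0.
have bF n : cbounded_supported D (F n).
  by apply: cbounded_supported_lin; [exact: gw_bounded|apply: cbounded_supported_scale; exact: gw_bounded].
apply: (cdetermined_cvg (F := F) (C := 2 * (L * C))) => //.
- move=> n x; rewrite FE; have [Dx|Dx] := pselect (D x); last first.
    have C0 : 0 <= C := le_trans (normr_ge0 _) (gC x).
    have LC0 : 0 <= 2 * (L * C) by rewrite !mulr_ge0 ?normr_ge0.
    by rewrite gD// rmorph0 mul0r mulr0 /= normr0.
  have [w1 w2] := wave_le1 a x.
  have gw1 : `|g x * complex.Re (wave a x)| <= C.
    by rewrite normrM -[leRHS]mulr1 ler_pM.
  have gw2 : `|g x * complex.Im (wave a x)| <= C.
    by rewrite normrM -[leRHS]mulr1 ler_pM.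
  have q1 : `|complex.Re (q n x)| <= L.
    rewrite /q/= normrM normfV (gtr0_norm (t0 n)) ler_pdivrMr// (le_trans (norm_sin_le _))//.
    by rewrite normrM (gtr0_norm (t0 n)) (ler_pM2r (t0 n)) HL.
  have q2 : `|complex.Im (q n x)| <= L.
    rewrite /q/= normrN normrM normfV (gtr0_norm (t0 n)) ler_pdivrMr// (le_trans (norm_cosB1_le _))//.
    by rewrite normrM (gtr0_norm (t0 n)) (ler_pM2r (t0 n)) HL.
  have -> : (g x)%:C%C * wave a x = (g x * complex.Re (wave a x) +i* (g x * complex.Im (wave a x)))%C.
    by case: (wave a x) => u v; apply/eqP; rewrite eq_complex/=; apply/andP; split; apply/eqP; ring.
  case: (q n x) q1 q2 => q1 q2 /= h1 h2.
  rewrite mulrDl mul1r; split.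
    by rewrite (le_trans (ler_normB _ _))// lerD// normrM ler_pM.
  by rewrite (le_trans (ler_normD _ _))// lerD// normrM ler_pM.
- exact: gw_bounded.
- move=> x; under eq_fun do rewrite FE.
  rewrite (_ : (iota x 0 j * g x)%:C%C * _ = (iota x 0 j)%:C%C * ((g x)%:C%C * wave a x)).
    exact: ccvgM (cq x) (ccvg_cst _).
  by rewrite rmorphM mulrA.
- move=> n; apply: cdetermined_lin => //.
  + exact: gw_bounded.
  + by apply: cbounded_supported_scale; exact: gw_bounded.
  + exact: hg.
  + by apply: cdetermined_scale; [exact: gw_bounded|exact: hg].
Qed.

(** Multipliers form an algebra closed under limits that are bounded on D; containing the
    coordinates, it ends up containing all bounded measurable functions. *)
Definition multiplier (v : T -> R) : Prop :=
  forall g, good g -> good (fun x => v x * g x).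

Lemma multiplier_cst c : multiplier (fun=> c).
Proof.
move=> g gg; have g0 : good (fun=> 0).
  have := good_lin (-1) gg gg.
  by rewrite (_ : (fun x => _) = fun=> 0)//; apply/funext => x; rewrite mulN1r addNr.
have := good_lin c gg g0.
by rewrite (_ : (fun x => _) = fun x => c * g x)//; apply/funext => x; rewrite addr0.
Qed.

Lemma multiplierD u v : multiplier u -> multiplier v -> multiplier (fun x => u x + v x).
Proof.
move=> mu mv g gg; have := good_lin 1 (mu _ gg) (mv _ gg).
by rewrite (_ : (fun x => _) = fun x => (u x + v x) * g x)//; apply/funext => x; ring.
Qed.

Lemma multiplierM u v : multiplier u -> multiplier v -> multiplier (fun x => u x * v x).
Proof.
move=> mu mv g gg; have := mu _ (mv _ gg).
by rewrite (_ : (fun x => _) = fun x => u x * v x * g x)//; apply/funext => x; ring.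
Qed.

Lemma multiplierX u n : multiplier u -> multiplier (fun x => u x ^+ n).
Proof.
move=> mu; elim: n => [|n ih]; first exact: (multiplier_cst 1).
rewrite (_ : (fun x => _) = fun x => u x * u x ^+ n); first exact: multiplierM.
by apply/funext => x; rewrite exprS.
Qed.

Lemma multiplier_cvg (F : nat -> T -> R) v (C : R) : (forall n, multiplier (F n)) ->
  (forall n x, D x -> `|F n x| <= C) -> (forall x, D x -> F ^~ x @ \oo --> v x) ->
  multiplier v.
Proof.
move=> mF FC cF g gg; have [[_ [C' gC] gD] _] := gg.
apply: (good_cvg (F := fun n x => F n x * g x) (C := `|C| * C')).
- by move=> n; exact: mF.
- move=> n x; have [Dx|Dx] := pselect (D x).
    by rewrite normrM ler_pM// (le_trans (FC _ _ Dx))// ler_norm.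
  by rewrite gD// mulr0 normr0 mulr_ge0// (le_trans _ (gC x)).
- move=> x; have [Dx|Dx] := pselect (D x); first by apply: cvgMl; exact: cF.
  rewrite gD// mulr0 (_ : (fun n => _) = cst 0); first exact: cvg_cst.
  by apply/funext => n /=; rewrite mulr0.
Qed.

Lemma multiplier_halfspace j (r : R) : multiplier \1_[set x | iota x 0 j < r].
Proof.
have [L HL] := iota_bounded.
(* This l is large enough for the affine function u to send D into [1/4, 3/4], the half-space
   becoming u < 1/2. The polynomials (1 - u^n)^(n 2^n) in the coordinate then tend to its indicator
   on D. *)
pose l := 4 * (`|L| + `|r| + 1).
have l0 : 0 < l by rewrite mulr_gt0// ltr_wpDl// addr_ge0.
pose u x := l^-1 * iota x 0 j + (1 / 2 - r / l).
have hu x : D x -> 1 / 4 <= u x <= 3 / 4.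
  move=> Dx; have := HL x j Dx; rewrite ler_norml => /andP[h1 h2].
  have h3 := ler_norm L; have h4 := ler_norm r; have h5 : - `|r| <= r by rewrite lerNl -normrN ler_norm.
  have E : u x = 1 / 2 + (iota x 0 j - r) / l by rewrite /u; field; rewrite gt_eqF.
  have : - (1 / 4) <= (iota x 0 j - r) / l <= 1 / 4.
    by rewrite ler_pdivlMr// ler_pdivrMr// /l; apply/andP; split; lra.
  by rewrite E => /andP[k1 k2]; apply/andP; split; lra.
have mu : multiplier u.
  apply: multiplierD; last exact: multiplier_cst.
  by apply: multiplierM; [exact: multiplier_cst|exact: good_coord].
apply: (multiplier_cvg (F := fun n x => (1 + - 1 * u x ^+ n) ^+ (n * 2 ^ n)) (C := 1)).
- move=> n; apply: multiplierX; apply: multiplierD; first exact: multiplier_cst.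
  by apply: multiplierM; [exact: multiplier_cst|exact: multiplierX].
- move=> n x Dx; have /andP[u1 u2] := hu x Dx.
  rewrite ger0_norm; last by rewrite exprn_ge0// mulN1r subr_ge0 exprn_ile1//; lra.
  have : 0 <= u x ^+ n <= 1 by rewrite exprn_ge0 ?exprn_ile1//; lra.
  by move=> /andP[h1 h2]; rewrite exprn_ile1//; lra.
- move=> x Dx; have /andP[u1 u2] := hu x Dx.
  rewrite indicE (_ : (x \in _) = (u x < 1 / 2)); first by apply: cvg_cutoff; lra.
  have E : u x = 1 / 2 + (iota x 0 j - r) / l by rewrite /u; field; rewrite gt_eqF.
  have E2 : (u x < 1 / 2) = (iota x 0 j < r).
    by rewrite E gtrDl pmulr_llt0 ?invr_gt0// subr_lt0.
  by rewrite E2; apply/idP/idP => [/set_mem//|h]; apply/mem_set.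
Qed.

(** The sets whose indicator is a multiplier form a sigma-algebra: 1 - u gives complements, u + v -
    u v finite unions, and bounded limits countable ones. *)
Lemma multiplier_indic A : measurable A -> multiplier \1_A.
Proof.
move/iota_gen.
suff : <<s [set A | exists j (r : R), A = [set x | iota x 0 j < r]] >> `<=` [set A | multiplier \1_A].
  by apply.
apply: smallest_sub; last by move=> B [j [r ->]]; exact: multiplier_halfspace.
split => /=.
- rewrite (_ : (\1_set0 : T -> R) = fun=> 0); first exact: multiplier_cst.
  by apply/funext => x; rewrite indic0.
- move=> B mB; have := multiplierD (multiplier_cst 1) (multiplierM (multiplier_cst (-1)) mB).
  rewrite (_ : (fun x => _) = \1_(setT `\` B))//; apply/funext => x.
  rewrite setTD !indicE in_setC; case: (x \in B); rewrite /= ?mulr1 ?subrr// mulr0 addr0//.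
- move=> F mF.
  have fin n : multiplier \1_(\big[setU/set0]_(k < n) F k).
    elim: n => [|n ih].
      rewrite big_ord0 (_ : (\1_set0 : T -> R) = fun=> 0); first exact: multiplier_cst.
      by apply/funext => x; rewrite indic0.
    rewrite big_ord_recr/=.
    have := multiplierD (multiplierD ih (mF n)) (multiplierM (multiplier_cst (-1)) (multiplierM ih (mF n))).
    rewrite (_ : (fun x => _) = \1_(\big[setU/set0]_(k < n) F k `|` F n))//.
    apply/funext => x; rewrite !indicE in_setU.
    by case: (x \in _); case: (x \in F n) => /=; ring.
  apply: (multiplier_cvg fin (C := 1)).
    by move=> n x _; rewrite indicE; case: (_ \in _); rewrite ?normr1// normr0.
  move=> x _; have [[n _ Fn]|H] := pselect ((\bigcup_k F k) x).
    apply: cvg_near_cst; exists n.+1 => // m /= nm.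
    rewrite !indicE !mem_set//; first by exists n.
    by rewrite -bigcup_mkord; exists n.
  apply: cvg_near_cst; exists 0%N => // m _.
  rewrite !indicE !memNset// -bigcup_mkord => -[k _ Fk]; apply: H.
  by exists k.
Qed.

Lemma multiplier_bounded v : bounded_supported setT v -> multiplier v.
Proof.
move: v; apply: bounded_supported_ind.
- by move=> A mA _; exact: multiplier_indic.
- by move=> a f g _ _ mf mg; exact: (multiplierD (multiplierM (multiplier_cst a) mf) mg).
- by move=> F f C bF FC bf cF mF; exact: (multiplier_cvg mF (C := C)).
Qed.

(** For one fixed a in V, the real and imaginary parts of the wave are bounded multipliers. Their
    combination into the conjugate wave cancels the factor exp(i<a,x>) and leaves the bare
    indicator. *)
Lemma cdetermined_indic A : measurable A -> cdetermined (fun x => (\1_(A `&` D) x)%:C%C).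
Proof.
move=> mA; have [a Va] := V0.
have gA := multiplier_indic mA good_indic.
have [wr wi] := wave_bounded a.
have [bc hc] := multiplier_bounded wr gA; have [bs hs] := multiplier_bounded wi gA.
have := cdetermined_lin (- 'i) (gw_bounded a bs) (gw_bounded a bc) (hs _ Va) (hc _ Va).
rewrite (_ : (fun x => _) = fun x => (\1_(A `&` D) x)%:C%C)//.
apply/funext => x; rewrite indicI /= !rmorphM/=.
have : expi (- dotp a (iota x)) * wave a x = 1 by exact: expiNK.
rewrite /wave; set w := expi (dotp a (iota x)).
rewrite (_ : expi (- _) = (complex.Re w)%:C%C - 'i * (complex.Im w)%:C%C); last first.
  by rewrite expiN /w; case: (expi _) => p q; apply/eqP; rewrite eq_complex/= ; apply/andP; split; apply/eqP; ring.
move=> h; rewrite -[RHS]mulr1 -h; ring.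
Qed.

Theorem determined_restriction (E : nat -> set T) (decode : code -> T) :
  (forall n, measurable (E n)) -> measurable_fun setT decode ->
  cancel (encode E) decode ->
  exists2 F : lfc_space R bnd -> lfc_space R bnd, measurable_fun setT F &
    {ae P, forall w, forall A, measurable A -> bnd A ->
       F (restr (Xi w)) A = Xi w (A `&` D)}.
Proof.
move=> mE mdec decK.
have Xidet p : det (fun w => complex.Re (Xi w (cell E p `&` D))) /\
    det (fun w => complex.Im (Xi w (cell E p `&` D))).
  have mc := measurable_cell mE p.
  have [h1 h2] := cdetermined_indic mc.
  have mcD : measurable (cell E p `&` D) by exact: measurableI.
  have cD : cell E p `&` D `<=` D by exact: subIsetr.
  have IE w := lfc_integral_indic bb (Xi w) mD bD mcD cD.
  rewrite (_ : (fun w => complex.Re _) = fun w => complex.Re (lfc_integral (Xi w)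
    (fun x => (\1_(cell E p `&` D) x)%:C%C))); last by apply/funext => w; rewrite IE.
  rewrite (_ : (fun w => complex.Im _) = fun w => complex.Im (lfc_integral (Xi w)
    (fun x => (\1_(cell E p `&` D) x)%:C%C))) //; by apply/funext => w; rewrite IE.
have /choice[f fP] p : exists fg : (lfc_space R bnd -> R) * (lfc_space R bnd -> R),
    [/\ measurable_fun setT fg.1, measurable_fun setT fg.2,
     {ae P, forall w, complex.Re (Xi w (cell E p `&` D)) = fg.1 (restr (Xi w))} &
     {ae P, forall w, complex.Im (Xi w (cell E p `&` D)) = fg.2 (restr (Xi w))}].
  by have [[u mu hu] [v mv hv]] := Xidet p; exists (u, v).
pose g p nu : R[i] := ((f p).1 nu +i* (f p).2 nu)%C.
have mg1 p : measurable_fun setT (fun nu => complex.Re (g p nu)) by have [] := fP p.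
have mg2 p : measurable_fun setT (fun nu => complex.Im (g p nu)) by have [] := fP p.
have [F mF FP] := lfc_reconstruction mE mdec decK bb mD bD mg1 mg2.
exists F => //.
(* Words are enumerated by the naturals through [unpickle], so that the countably many null sets are
   merged into one. *)
have : {ae P, forall w, forall (n : nat) (p : seq bool), @choice.unpickle (seq bool) n = Some p ->
    g p (restr (Xi w)) = Xi w (cell E p `&` D)}.
  apply: ae_foralln => n; case: (@choice.unpickle (seq bool) n) => [p|]; last exact: aeW.
  have [_ _ h1 h2] := fP p.
  by apply: filterS2 h1 h2 => w e1 e2 q [<-]; rewrite /g -e1 -e2; case: (Xi w _).
apply: filterS => w hw A mA bA; apply: FP => // p.
by apply: (hw (choice.pickle p)); rewrite choice.pickleK.
Qed.

End stealthy_directions.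

Lemma wave_determined (a : T -> R[i]) (K : nat -> set T) (phi : nat -> T -> R[i]) :
  second_order P Xi ->
  (forall n, measurable (K n) /\ bnd (K n)) ->
  (forall n, cbounded_supported (K n) (phi n)) ->
  (forall n x, `|complex.Re (phi n x)| <= 1 /\ `|complex.Im (phi n x)| <= 1) ->
  cbounded_supported setT a ->
  (forall x, ccvg (phi ^~ x) (a x)) ->
  (fun n => complex.Re (ccovariance P (fun w => lfc_integral (Xi w) (phi n))
       (fun w => lfc_integral (Xi w) (phi n)))) @ \oo --> 0 ->
  cdetermined (fun x => (\1_D x)%:C%C * a x).
Proof.
move=> P2 mbK bphi phi1 ba cphi cvar.
have mK n : measurable (K n) by have [] := mbK n.
have bK n : bnd (K n) by have [] := mbK n.
pose Z n w := lfc_integral (Xi w) (phi n).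
pose m n := cexpectation P (Z n).
pose Y n w := (complex.Re (Z n w) - complex.Re (m n)) ^+ 2 + (complex.Im (Z n w) - complex.Im (m n)) ^+ 2.
have mY n : measurable_fun setT (Y n).
  have [mr mi] := measurable_linear_statistic bb mXi (mK n) (bK n) (bphi n).
  by apply: measurable_funD; apply: measurable_funX; apply: measurable_funB.
have Y0 n w : 0 <= Y n w by rewrite addr_ge0// sqr_ge0.
have V n := linear_statistic_variance bb mXi P2 (mK n) (bK n) (bphi n) ltr01 (phi1 n).
have cY : (fun n => \int[P]_w (Y n w)%:E)%E @ \oo --> 0%E.
  have E n : (\int[P]_w (Y n w)%:E = (complex.Re (ccovariance P (Z n) (Z n)))%:E)%E.
    by have [iY [-> _ _]] := V n; rewrite fineK//; exact: integrable_fin_num.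
  under eq_fun do rewrite E.
  by apply: cvg_EFin => //; exact: nearW.
have [k hk aeY] := cvg0_ae_subseq mY Y0 cY.
(* Applied to the restriction to the complement of D, [G n] is the mean of the statistic minus its
   outside part, a measurable function of the outside alone. *)
pose G n (mu : lfc_space R bnd) : R[i] := m (k n) - lfc_integral mu (phi (k n)).
have dG n : det (fun w => complex.Re (G n (restr (Xi w)))) /\ det (fun w => complex.Im (G n (restr (Xi w)))).
  have [m1 m2] := measurable_lfc_integral bb (mK (k n)) (bK (k n)) (bphi (k n)).
  split.
    apply: (@determined_comp _ _ _ _ _ P (fun w => restr (Xi w)) (fun mu => complex.Re (G n mu))).
    rewrite (_ : (fun mu => _) = fun mu => complex.Re (m (k n)) - complex.Re (lfc_integral mu (phi (k n)))).
      by apply: measurable_funB.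
    by apply/funext => mu; rewrite /G raddfB.
  apply: (@determined_comp _ _ _ _ _ P (fun w => restr (Xi w)) (fun mu => complex.Im (G n mu))).
  rewrite (_ : (fun mu => _) = fun mu => complex.Im (m (k n)) - complex.Im (lfc_integral mu (phi (k n)))).
    by apply: measurable_funB.
  by apply/funext => mu; rewrite /G raddfB.
have mDc : measurable (~` D) by exact: measurableC.
have bD1 : bounded_supported D (\1_D : T -> R) by exact: bounded_supported_indic.
have bDa : cbounded_supported D (fun x => (\1_D x)%:C%C * a x).
  rewrite -[X in cbounded_supported X]setIT.
  exact: cbounded_supportedM (cbounded_supported_real bD1) ba.
have bDphi n : cbounded_supported D (fun x => (\1_D x)%:C%C * phi n x).
  have := cbounded_supportedM (cbounded_supported_real bD1) (bphi n).
  by move=> [h1 h2]; split; [apply: bounded_supportedS h1|apply: bounded_supportedS h2].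
have splitZ n w : lfc_integral (Xi w) (fun x => (\1_D x)%:C%C * phi n x) =
    Z n w - lfc_integral (restr (Xi w)) (phi n).
  rewrite (lfc_integral_restrict bb (mK n) (bK n) mDc (restrE (Xi w)) (bphi n)).
  have bK1 : cbounded_supported (K n) (fun x => (\1_D x)%:C%C * phi n x).
    have := cbounded_supportedM (cbounded_supported_real bD1) (bphi n).
    by move=> [h1 h2]; split; [apply: bounded_supportedS h1|apply: bounded_supportedS h2].
  have bK2 : cbounded_supported (K n) (fun x => phi n x * (\1_(~` D) x)%:C%C).
    have bD2 : bounded_supported (~` D) (\1_(~` D) : T -> R) by exact: bounded_supported_indic.
    have := cbounded_supportedM (bphi n) (cbounded_supported_real bD2).
    by move=> [h1 h2]; split; [apply: bounded_supportedS h1|apply: bounded_supportedS h2].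
  have := lfc_integral_lin bb (Xi w) 1 (mK n) (bK n) bK1 bK2.
  have E : (fun x => 1 * ((\1_D x)%:C%C * phi n x) + phi n x * (\1_(~` D) x)%:C%C) = phi n.
    apply/funext => x; rewrite !indicE in_setC; case: (x \in D) => /=.
      by rewrite !mul1r mulr0 addr0.
    by rewrite mul0r mulr0 mulr1 add0r.
  by rewrite E mul1r /Z => ->; rewrite addrK.
have cD w : ccvg (fun n => lfc_integral (Xi w) (fun x => (\1_D x)%:C%C * phi n x))
    (lfc_integral (Xi w) (fun x => (\1_D x)%:C%C * a x)).
  apply: (lfc_integral_cvg bb _ mD bD (C := 1)) => //.
  - move=> n x; have [h1 h2] := phi1 n x; rewrite indicE; case: (_ \in _).
      by rewrite mul1r.
    by rewrite mul0r/= normr0.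
  - by move=> x; exact: ccvgM (ccvg_cst _) (cphi x).
have key : {ae P, forall w, ccvg (fun n => G n (restr (Xi w)))
    (lfc_integral (Xi w) (fun x => (\1_D x)%:C%C * a x))}.
  apply: filterS aeY => w cw.
  (* Both parts of Z - m are dominated by the square root of Y, which tends to 0 along the
     subsequence. *)
  have h0 : ccvg (fun n => Z (k n) w - m (k n)) 0.
    have sq (u : nat -> R) : (forall n, u n ^+ 2 <= Y (k n) w) -> u @ \oo --> 0.
      move=> hu; apply/norm_cvg0P; apply: (@squeeze_cvgr _ _ _ _ (cst 0) (fun n => Num.sqrt (Y (k n) w))).
      - by apply: nearW => n; rewrite normr_ge0/= -sqrtr_sqr ler_sqrt.
      - exact: cvg_cst.
      - by rewrite -sqrtr0; apply: (cvg_comp _ _ cw); exact: sqrt_continuous.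
    split; apply: sq => n; rewrite raddfB /Y; first by rewrite lerDl sqr_ge0.
    by rewrite lerDr sqr_ge0.
  (* The integral over D minus the centred statistic Z - m is exactly [G] at the restriction. *)
  have := ccvgB (ccvg_sub hk (cD w)) h0; rewrite subr0.
  rewrite (_ : (fun n => _) = fun n => G n (restr (Xi w)))//.
  by apply/funext => n; rewrite splitZ /G; ring.
split.
  apply: (determined_cvg (X := fun n w => complex.Re (G n (restr (Xi w))))).
    by move=> n; have [] := dG n.
  by apply: filterS key => w [].
apply: (determined_cvg (X := fun n w => complex.Im (G n (restr (Xi w))))).
  by move=> n; have [] := dG n.
by apply: filterS key => w [].
Qed.

End determination.

(** * Borel structure of the physical spaces *)

Section euclid_borel.
Context {R : realType} {d : nat}.

Lemma measurable_coord (j : 'I_d) :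
  measurable_fun [set: euclid R d] (fun x : 'rV[R]_d => x 0 j).
Proof.
apply: (@measurability _ _ (euclid R d) (measurableTypeR R) setT _ (RGenOpens.G (R:=R))).
  exact: RGenOpens.measurableE.
move=> _ [_ [a [b ->]] <-]; rewrite setTI; apply: sub_gen_smallest.
by apply: open_comp; [move=> x _; exact: coord_continuous|exact: interval_open].
Qed.

Definition halfspaces : set (set 'rV[R]_d) :=
  [set A | exists j (r : R), A = [set x : 'rV[R]_d | x 0 j < r]].

Let box_sub (q : 'rV[rat]_d) (n : nat) : set 'rV[R]_d :=
  [set x | forall j, `|x 0 j - ratr (q 0 j)| < n.+1%:R^-1].

Let box_halfspaces q n : <<s halfspaces >> (box_sub q n).
Proof.
pose T := g_sigma_algebraType halfspaces.
suff : measurable (box_sub q n : set T) by [].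
have mlt j r : measurable ([set x : 'rV[R]_d | x 0 j < r] : set T).
  by apply: sub_gen_smallest; exists j, r.
(* Opposite half-spaces are countable unions of complements of the given ones. *)
have mgt j r : measurable ([set x : 'rV[R]_d | r < x 0 j] : set T).
  rewrite (_ : [set x | _] = \bigcup_(k : nat) ~` [set x : 'rV[R]_d | x 0 j < r + k.+1%:R^-1]).
    by apply: bigcupT_measurable => k; apply: measurableC; exact: mlt.
  apply/seteqP; split => x /=.
    move=> rx; have [k hk] : exists k : nat, k.+1%:R^-1 < x 0 j - r.
      exists (Num.truncn (x 0 j - r)^-1).
      rewrite -[ltRHS]invrK ltf_pV2 ?posrE ?invr_gt0 ?subr_gt0//.
      by rewrite truncnS_gt.
    by exists k => //=; apply/negP; rewrite -leNgt -lerBrDl ltW.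
  move=> [k _ /= /negP]; rewrite -leNgt; apply: lt_le_trans.
  by rewrite ltrDl invr_gt0.
rewrite (_ : box_sub q n = \bigcap_(j : 'I_d) ([set x : 'rV[R]_d | x 0 j < ratr (q 0 j) + n.+1%:R^-1] `&`
   [set x : 'rV[R]_d | ratr (q 0 j) - n.+1%:R^-1 < x 0 j])).
  rewrite -[X in measurable X]setCK setC_bigcap; apply: measurableC.
  apply: countable_bigcupT_measurable => // j.
  by apply: measurableC; apply: measurableI.
apply/seteqP; split => x h.
  by move=> j _ /=; have := h j; rewrite ltr_distl => /andP[? ?]; split.
by move=> j; have [/= h1 h2] := h j I; rewrite ltr_distl; apply/andP.
Qed.

Lemma open_halfspaces (A : set 'rV[R]_d) : open A -> <<s halfspaces >> A.
Proof.
move=> oA; pose T := g_sigma_algebraType halfspaces.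
suff : measurable (A : set T) by [].
rewrite (_ : A = \bigcup_(qn : 'rV[rat]_d * nat)
   (if `[< box_sub qn.1 qn.2 `<=` A >] then box_sub qn.1 qn.2 else set0)).
  apply: countable_bigcupT_measurable => // qn; case: ifP => // _.
  exact: box_halfspaces.
apply/seteqP; split=> x.
  move=> Ax; have /nbhs_ballP[e /= e0 eA] : nbhs x A by exact: open_nbhs_nbhs.
  (* The factor 2 pays for the triangle inequality through the rational centre of the box. *)
  pose n := Num.truncn (2 / e).
  have n2 : 2 * n.+1%:R^-1 < e.
    by rewrite ltr_pdivrMr// mulrC -ltr_pdivrMr// truncnS_gt.
  have n0 : 0 < n.+1%:R^-1 :> R by rewrite invr_gt0.
  have /choice[q hq] (j : 'I_d) : exists q : rat, `|x 0 j - ratr q| < n.+1%:R^-1.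
    have : x 0 j - n.+1%:R^-1 < x 0 j + n.+1%:R^-1 by rewrite ltrBlDr -addrA ltrDl addr_gt0.
    by move=> /rat_in_itvoo[q]; rewrite in_itv/= => qx; exists q; rewrite distrC ltr_distl.
  exists (\row_j q j, n) => //=; case: ifPn => [_ j|/negP]; first by rewrite mxE.
  case; apply/asboolP => y hy; apply: eA; split=> // i j; rewrite ord1.
  rewrite /ball/= (le_lt_trans _ n2)//.
  have := hy j; rewrite mxE => h1; have h2 := hq j.
  rewrite (le_trans (ler_distD (ratr (q j)) _ _))// mulr2n mulrDl mul1r.
  by rewrite lerD// ltW// distrC.
by move=> [qn _]; case: ifPn => // /asboolP; exact.
Qed.

Lemma measurable_euclid_halfspaces : @measurable _ (euclid R d) = <<s halfspaces >>.
Proof.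
apply/seteqP; split.
  apply: smallest_sub; first exact: smallest_sigma_algebra.
  exact: open_halfspaces.
apply: smallest_sub; first exact: smallest_sigma_algebra.
move=> _ [j [r ->]]; have := measurable_coord j measurableT (measurable_itv `]-oo, r[).
by rewrite setTI; congr (measurable _); apply/seteqP; split => x /=; rewrite in_itv.
Qed.

Lemma measurable_fun_euclid disp (X : measurableType disp) (h : X -> euclid R d) :
  (forall j, measurable_fun setT (fun x => (h x : 'rV[R]_d) 0 j)) -> measurable_fun setT h.
Proof.
move=> mh; apply: (@measurability _ _ X (euclid R d) setT h halfspaces).
  exact: measurable_euclid_halfspaces.
move=> _ [_ [j [r ->]] <-]; rewrite setTI.
have := mh j measurableT _ (measurable_itv `]-oo, r[).
by rewrite setTI; congr (measurable _); apply/seteqP; split => x /=; rewrite in_itv.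
Qed.

Lemma bornologyR : bornology (@boundedR R d).
Proof.
split.
- by exists 0; split => // r _ x [].
- exact: boundedR_sub.
- move=> A B [M [Mr hM]] [N [Nr hN]]; exists (Num.max M N); split; first exact: num_real.
  by move=> r; rewrite gt_max => /andP[h1 h2] x [Ax|Bx]; [exact: hM Ax|exact: hN Bx].
Qed.

Lemma norm_coord_le (x : 'rV[R]_d) j : `|x 0 j| <= `|x|.
Proof.
rewrite {2}/Num.Def.normr/= mx_normrE.
by apply: (bigmax_sup (0, j)).
Qed.

Lemma boundedR_coord (D : set (euclid R d)) : boundedR D ->
  exists L : R, forall (x : euclid R d) j, D x -> `|(x : 'rV[R]_d) 0 j| <= L.
Proof.
move=> [M [_ hM]]; exists (M + 1) => x j Dx; apply: le_trans (norm_coord_le _ _) _.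
by apply: hM Dx; rewrite ltrDl.
Qed.

Definition rational_halfspace (n : nat) : set (euclid R d) :=
  if @choice.unpickle ('I_d * rat)%type n is Some (j, q) then
    [set x : 'rV[R]_d | ratr q < x 0 j] else set0.

Lemma measurable_rational_halfspace n : measurable (rational_halfspace n).
Proof.
rewrite /rational_halfspace; case: choice.unpickle => // -[j q].
have := measurable_coord j measurableT (measurable_itv `]ratr q, +oo[).
by rewrite setTI; congr (measurable _); apply/seteqP; split => x /=; rewrite in_itv/= andbT.
Qed.

(* The supremum of the rationals recorded in [s] as lying below the j-th
   coordinate, so that decoding inverts encoding by rational half-spaces. *)
Definition decode_coord (s : nat -> bool) (j : 'I_d) : \bar R :=
  esups (fun n => if @choice.unpickle ('I_d * rat)%type n is Some (i, q) then
     (if (i == j) && s n then (ratr q)%:E else -oo%E) else -oo%E) 0%N.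

Definition decode_euclid (s : code) : euclid R d :=
  \row_j fine (decode_coord s j).

Lemma measurable_decode_euclid : measurable_fun setT decode_euclid.
Proof.
apply: measurable_fun_euclid => j.
rewrite (_ : (fun s => _) = fun s : code => fine (decode_coord s j)); last first.
  by apply/funext => s; rewrite mxE.
apply: (measurableT_comp (fine_measurable measurableT)).
apply: measurable_fun_esups => n.
case: choice.unpickle => [[i q]|]; last exact: measurable_cst.
case: (i == j) => /=; last exact: measurable_cst.
apply: measurable_fun_ifT => //.
move=> _ B mB; rewrite setTI.
have [Bt|Bt] := pselect (B true); have [Bf|Bf] := pselect (B false).
- by rewrite (_ : _ @^-1` _ = setT)//; apply/seteqP; split => s //= _; case: (s n).
- rewrite (_ : _ @^-1` _ = [set s : nat -> bool | s n]); first exact: measurable_code_coord.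
  by apply/seteqP; split => s /=; case: (s n).
- rewrite (_ : _ @^-1` _ = ~` [set s : nat -> bool | s n]).
    by apply: measurableC; exact: measurable_code_coord.
  by apply/seteqP; split => s /=; case: (s n).
- by rewrite (_ : _ @^-1` _ = set0)//; apply/seteqP; split => s //=; case: (s n).
Qed.

Lemma decode_euclidK : cancel (encode rational_halfspace) decode_euclid.
Proof.
move=> x; apply/rowP => j; rewrite mxE.
suff -> : decode_coord (encode rational_halfspace x) j = ((x : 'rV[R]_d) 0 j)%:E by [].
apply/eqP; rewrite eq_le; apply/andP; split.
  apply: ge_ereal_sup => _ [n _ <-] /=; case E : choice.unpickle => [[i q]|]; last by rewrite leNye.
  case: ifPn => [/andP[/eqP ij]|_]; last by rewrite leNye.
  by rewrite /encode /rational_halfspace E -ij => /asboolP/= h; rewrite lee_fin ltW.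
rewrite leNgt; apply/negP => h.
have /= [q hq hx] : exists2 q : rat, (decode_coord (encode rational_halfspace x) j < (ratr q)%:E)%E &
    ratr q < (x : 'rV[R]_d) 0 j.
  move: h; case: (decode_coord _ _) => [r|//|_].
    by rewrite lte_fin => /rat_in_itvoo[q]; rewrite in_itv/= => /andP[? ?]; exists q.
  have : (x : 'rV[R]_d) 0 j - 1 < (x : 'rV[R]_d) 0 j by rewrite gtrBl.
  by move=> /rat_in_itvoo[q]; rewrite in_itv/= => /andP[? ?]; exists q; rewrite ?ltNye.
move: hq; rewrite ltNge => /negP; apply.
apply: ereal_sup_ubound; exists (choice.pickle (j, q)) => //=.
rewrite choice.pickleK eqxx /= /encode /rational_halfspace choice.pickleK.
by case: asboolP.
Qed.

End euclid_borel.

Section lattice_borel.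
Context (R : realType) {d : nat}.

Definition lattice_embed (n : lattice d) : 'rV[R]_d := vec_of_int R n.

(** Integer points are decoded as reals and then rounded: [floor] fixes the integers and turns the
    value of an arbitrary code into a lattice point. *)
Definition decode_lattice (s : code) : lattice d := map_mx Num.floor (@decode_euclid R d s).

Lemma decode_latticeK :
  cancel (encode (fun n => lattice_embed @^-1` (@rational_halfspace R d n))) decode_lattice.
Proof.
move=> x; rewrite /decode_lattice.
have -> : encode (fun n => lattice_embed @^-1` (@rational_halfspace R d n)) x =
  encode (@rational_halfspace R d) (lattice_embed x) by [].
by rewrite decode_euclidK; apply/rowP => j; rewrite !mxE intrKfloor.
Qed.

Lemma measurable_decode_lattice : measurable_fun setT decode_lattice.
Proof.
move=> _ A _; rewrite setTI.
rewrite (_ : _ @^-1` A = \bigcup_(z : 'rV[int]_d) (if `[< A z >] then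
    @decode_euclid R d @^-1` [set x : 'rV[R]_d | map_mx Num.floor x = z] else set0)); last first.
  apply/seteqP; split => s /=.
    by move=> As; exists (decode_lattice s) => //; case: asboolP.
  by move=> [z _]; case: asboolP => // Az /= E; rewrite /decode_lattice E.
apply: countable_bigcupT_measurable => // z; case: ifP => // _.
rewrite -[X in measurable X]setTI; apply: measurable_decode_euclid => //.
rewrite (_ : [set x | _] = \bigcap_(j : 'I_d) (fun x : 'rV[R]_d => x 0 j) @^-1` `[(z 0 j)%:~R, (z 0 j + 1)%:~R[).
  rewrite -[X in measurable X]setCK setC_bigcap; apply: measurableC.
  apply: countable_bigcupT_measurable => // j; apply: measurableC.
  by rewrite -[X in measurable X]setTI; apply: measurable_coord.
apply/seteqP; split => x /=.
  by move=> <- j _ /=; rewrite in_itv/= mxE floor_le floorD1_gt.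
move=> h; apply/rowP => j; have /= := h j I; rewrite in_itv/= mxE => hj.
by apply/eqP; rewrite floor_eq.
Qed.

Lemma lattice_halfspaces : @measurable _ (lattice d) `<=`
  <<s [set A | exists j (r : R), A = [set x : lattice d | lattice_embed x 0 j < r]] >>.
Proof.
set G := (X in <<s X >>); move=> A _; pose T := g_sigma_algebraType G.
suff : measurable (A : set T) by [].
have mlt j r : measurable ([set x : lattice d | lattice_embed x 0 j < r] : set T).
  by apply: sub_gen_smallest; exists j, r.
rewrite (_ : A = \bigcup_(z : 'rV[int]_d) (if `[< A z >] then
   \bigcap_(j : 'I_d) ([set x : lattice d | lattice_embed x 0 j < (z 0 j + 1)%:~R] `&`
    ~` [set x : lattice d | lattice_embed x 0 j < (z 0 j)%:~R]) else set0)).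
  apply: countable_bigcupT_measurable => // z; case: ifP => // _.
  rewrite -[X in measurable X]setCK setC_bigcap; apply: measurableC.
  apply: countable_bigcupT_measurable => // j; apply: measurableC.
  by apply: measurableI => //; exact: measurableC.
apply/seteqP; split => x.
  move=> Ax; exists x => //; case: asboolP => // _ j _ /=.
  by rewrite /lattice_embed !mxE !ltr_int ltrDl ltxx; split.
move=> [z _]; case: asboolP => // Az h; rewrite (_ : x = z)//.
apply/rowP => j; have [] := h j I; rewrite /= /lattice_embed !mxE !ltr_int.
by move=> h1 /negP; rewrite -leNgt => h2; apply/eqP; rewrite eq_le h2 andbT -ltzD1.
Qed.

Lemma bornologyZ : bornology (@finite_set (lattice d)).
Proof.
by split=> // [|A B]; [exact: sub_finite_set|rewrite finite_setU].
Qed.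

End lattice_borel.

Section vanishing_variance.
Context {R : realType} {dT dO} {T : measurableType dT} {Omega : measurableType dO}.
Variables (bnd : set (set T)) (P : probability Omega R).

(** All that the determination argument asks of the spectral side at one frequency; the two physical
    spaces differ in how this is established. *)
Definition vanishing_variance (Xi : Omega -> lfc_space R bnd) (a : T -> R[i]) : Prop :=
  exists (K : nat -> set T) (phi : nat -> T -> R[i]),
  [/\ (forall n, measurable (K n) /\ bnd (K n)),
      (forall n, cbounded_supported (K n) (phi n)),
      (forall n x, `|complex.Re (phi n x)| <= 1 /\ `|complex.Im (phi n x)| <= 1),
      (forall x, ccvg (phi ^~ x) (a x)) &
      (fun n => complex.Re (ccovariance P (fun w => lfc_integral (Xi w) (phi n))
         (fun w => lfc_integral (Xi w) (phi n)))) @ \oo --> 0].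

Lemma vanishing_variance_determined (bb : bornology bnd) (Xi : {RV P >-> lfc_space R bnd})
    (D : set T) (restr restr' : lfc_space R bnd -> lfc_space R bnd)
    (d : nat) (iota : T -> 'rV[R]_d) (V : set 'rV[R]_d)
    (E : nat -> set T) (decode : code -> T) :
  second_order P Xi -> measurable D -> bnd D ->
  (forall mu A, measurable A -> bnd A -> restr mu A = mu (A `&` ~` D)) ->
  (forall mu A, measurable A -> bnd A -> restr' mu A = mu (A `&` D)) ->
  (forall j, measurable_fun setT (fun x => iota x 0 j)) ->
  (exists L : R, forall x j, D x -> `|iota x 0 j| <= L) ->
  @measurable _ T `<=` <<s [set A | exists j (r : R), A = [set x : T | iota x 0 j < r]] >> ->
  (forall n, measurable (E n)) -> measurable_fun setT decode ->
  cancel (encode E) decode ->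
  open V -> V !=set0 ->
  (forall a, V a -> vanishing_variance Xi (fun x => expi (dotp a (iota x)))) ->
  exists2 F : lfc_space R bnd -> lfc_space R bnd, measurable_fun setT F &
    {ae P, forall w, restr' (Xi w) = F (restr (Xi w))}.
Proof.
move=> P2 mD bD restrE restrE' miota iotaD iota_gen mE mdec decK oV V0 vanish.
have mXi : measurable_fun setT Xi by exact: measurable_funP.
have mwave (a : 'rV[R]_d) : measurable_fun setT (fun x => dotp a (iota x)).
  by apply: measurable_sum => j; apply: measurable_funM.
have wb a : cbounded_supported setT (fun x : T => expi (dotp a (iota x))).
  exact: cbounded_supported_expi (mwave a).
have Vdet a : V a -> cdetermined P Xi restr (fun x => (\1_D x)%:C%C * expi (dotp a (iota x))).
  move=> Va; have [K [phi [h1 h2 h3 h4 h5]]] := vanish a Va.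
  exact: (wave_determined bb mXi mD bD restrE P2 h1 h2 h3 (wb a) h4 h5).
have Vopen a : V a -> forall j : 'I_d, exists2 e : R, 0 < e &
    forall t, `|t| < e -> V (a + t *: delta_mx 0 j).
  move=> Va j; have /nbhs_ballP[e /= e0 eV] : nbhs a V by exact: open_nbhs_nbhs.
  exists e => // t te; apply: eV; split=> // i k; rewrite ord1 !mxE.
  rewrite /ball/= opprD addrA subrr add0r normrN.
  by case: (k == j) => /=; rewrite ?mulr1 ?mulr0 ?normr0.
have [F mF FP] := determined_restriction bb mD bD miota iotaD V0 Vopen iota_gen Vdet mE mdec decK.
(* Agreement on bounded measurable sets is equality of measures, all other values being 0 by
   convention. *)
exists F => //; apply: filterS FP => w hw; apply: lfc_eq; apply/funext => A.
have [[mA bA]|nA] := pselect (measurable A /\ bnd A); last by rewrite !lfc_out.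
by rewrite restrE'// hw.
Qed.

End vanishing_variance.

Lemma vanishing_variance_determinedR {R : realType} {d} {dO} {Omega : measurableType dO}
    (P : probability Omega R) (Xi : {RV P >-> cmeasR R d}) (D : set (euclid R d))
    (mD : measurable D) (V : set 'rV[R]_d) :
  second_order P Xi -> boundedR D -> open V -> V !=set0 ->
  (forall a, V a -> vanishing_variance P Xi (fun x : euclid R d => expi (dotp a x))) ->
  exists2 F : cmeasR R d -> cmeasR R d, measurable_fun [set: cmeasR R d] F &
    {ae P, forall w, restrictR mD (Xi w) = F (restrictR (measurableC mD) (Xi w))}.
Proof.
move=> P2 bD oV V0 vanish.
have restrE (C : set (euclid R d)) (mC : measurable C) (mu : cmeasR R d) A :
    measurable A -> boundedR A -> restrictR mC mu A = mu (A `&` C).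
  by move=> mA bA; rewrite /= /lfc_comp_val; case: pselect => // -[].
apply: (vanishing_variance_determined (iota := fun x : euclid R d => x : 'rV[R]_d)
  (restr := restrictR (measurableC mD)) (bornologyR) P2 mD bD _ _ _ _ _ (@measurable_rational_halfspace R d)
   (@measurable_decode_euclid R d) (@decode_euclidK R d) oV V0 vanish).
- exact: restrE.
- exact: restrE.
- exact: measurable_coord.
- exact: boundedR_coord.
- by rewrite measurable_euclid_halfspaces.
Qed.

Lemma vanishing_variance_determinedZ {R : realType} {d} {dO} {Omega : measurableType dO}
    (P : probability Omega R) (Xi : {RV P >-> cmeasZ R d}) (D : set (lattice d))
    (V : set 'rV[R]_d) :
  second_order P Xi -> finite_set D -> open V -> V !=set0 ->
  (forall a, V a -> vanishing_variance P Xi (fun x : lattice d => expi (dotp a (vec_of_int R x)))) ->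
  exists2 F : cmeasZ R d -> cmeasZ R d, measurable_fun [set: cmeasZ R d] F &
    {ae P, forall w, restrictZ D (Xi w) = F (restrictZ (~` D) (Xi w))}.
Proof.
move=> P2 fD oV V0 vanish.
have restrE (C : set (lattice d)) (mu : cmeasZ R d) A :
    measurable A -> finite_set A -> restrictZ C mu A = mu (A `&` C).
  by move=> mA bA; rewrite /= /lfc_comp_val; case: pselect => // -[].
apply: (vanishing_variance_determined (iota := fun x : lattice d => vec_of_int R x)
  (restr := restrictZ (~` D)) (bornologyZ) P2 (measurable_lattice D) fD _ _ _ _ _
   (E := fun n => (@lattice_embed R d) @^-1` (@rational_halfspace R d n)) _
   (@measurable_decode_lattice R d) (@decode_latticeK R d) oV V0 vanish).
- exact: restrE.
- exact: restrE.
- by move=> j _ B mB; exact: measurable_lattice.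
- have [s hs] : exists s : seq (lattice d), forall x, D x -> x \in s.
    by move/finite_seqP: fD => [s ->]; exists s.
  exists (\sum_(y <- s) `|vec_of_int R y|) => x j /hs xs.
  apply: le_trans (norm_coord_le _ _) _.
  by rewrite (big_rem x)//= lerDl sumr_ge0.
- exact: lattice_halfspaces.
- by move=> n; exact: measurable_lattice.
Qed.

(** * Lebesgue measure on R^d *)

Section sigma_finite_pack.
Context {d} {T : measurableType d} {R : realType}.
Variables (m : {measure set T -> \bar R}) (sm : sigma_finite setT m).

Let sfm : set T -> \bar R := m.
HB.instance Definition _ := Measure.on sfm.
HB.instance Definition _ := Measure_isSigmaFinite.Build _ _ _ sfm sm.

Lemma sigma_finite_measure_ex :
  exists mu : {sigma_finite_measure set T -> \bar R}, (mu : set T -> \bar R) = m.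
Proof. by exists sfm. Qed.

End sigma_finite_pack.

Lemma product_measure_sigma_finite {d1 d2} {T1 : measurableType d1} {T2 : measurableType d2}
    {R : realType} (m1 : {sigma_finite_measure set T1 -> \bar R})
    (m2 : {sigma_finite_measure set T2 -> \bar R}) : sigma_finite setT (m1 \x m2)%E.
Proof.
have /sigma_finiteP[F [TF ndF Foo]] := sigma_finiteT m1.
have /sigma_finiteP[G [TG ndG Goo]] := sigma_finiteT m2.
exists (fun n => F n `*` G n).
  rewrite -setXTT TF TG predeqE => -[x y]; split.
    move=> [/= [n _ Fnx] [k _ Gky]]; exists (maxn n k) => //; split.
    - by move: x Fnx; exact/subsetPset/ndF/leq_maxl.
    - by move: y Gky; exact/subsetPset/ndG/leq_maxr.
  by move=> [n _ []/= ? ?]; split; exists n.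
move=> k; have [? ?] := Foo k; have [? ?] := Goo k.
split; first exact: measurableX.
by rewrite product_measure1E// lte_mul_pinfty// ge0_fin_numE.
Qed.

Section lebesgue_euclid.
Context {R : realType}.

Definition cons_rV d (p : measurableTypeR R * euclid R d) : euclid R d.+1 :=
  row_mx (p.1)%:M (p.2 : 'rV[R]_d) : 'rV[R]_d.+1.

Lemma cons_rV0 d p : (@cons_rV d p : 'rV[R]_d.+1) 0 0 = p.1.
Proof.
rewrite /cons_rV (_ : 0 = @lshift 1 d 0); last exact/val_inj.
by rewrite (@row_mxEl R 1 1 d) mxE mulr1n.
Qed.

Lemma cons_rVS d p (j : 'I_d) : (@cons_rV d p : 'rV[R]_d.+1) 0 (lift 0 j) = (p.2 : 'rV[R]_d) 0 j.
Proof.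
rewrite /cons_rV (_ : lift 0 j = @rshift 1 d j); last exact/val_inj.
by rewrite (@row_mxEr R 1 1 d).
Qed.

Lemma measurable_cons_rV d : measurable_fun setT (@cons_rV d).
Proof.
apply: measurable_fun_euclid => j; have [k ->|->] := unliftP 0 j.
  rewrite (_ : (fun x => _) = fun p => (p.2 : 'rV[R]_d) 0 k).
    by apply: (measurableT_comp (measurable_coord k)).
  by apply/funext => p; rewrite cons_rVS.
rewrite (_ : (fun x => _) = fst)//.
by apply/funext => p; rewrite cons_rV0.
Qed.

(** [lebesgue_rV] is a bare set function defined by recursion; its equality with a packed measure
    gives access to the integration theorems. The exhausting sets are pulled back from the product
    along the measurable left inverse t of [cons_rV]. *)
Lemma lebesgue_rV_sigma_finite d : exists mu : {sigma_finite_measure set (euclid R d) -> \bar R},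
  (mu : set _ -> \bar R) = lebesgue_rV d.
Proof.
elim: d => [|d [mu muE]].
  by exists (@dirac _ (euclid R 0) (0 : 'rV[R]_0) R).
pose m : {measure set (euclid R d.+1) -> \bar R} :=
  measure_function_pushforward__canonical__measure_function_Measure
   (@lebesgue_measure R \x mu)%E (@measurable_cons_rV d).
have mE : (m : set _ -> \bar R) = lebesgue_rV d.+1 by rewrite /= -muE.
rewrite -mE; apply: sigma_finite_measure_ex.
have [F FT Ffin] := product_measure_sigma_finite (@lebesgue_measure R) mu.
pose t (x : euclid R d.+1) : measurableTypeR R * euclid R d :=
  ((x : 'rV[R]_d.+1) 0 0, \row_j (x : 'rV[R]_d.+1) 0 (lift 0 j)).
have mt : measurable_fun setT t.
  apply/measurable_fun_pairP; split; first exact: measurable_coord.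
  apply: measurable_fun_euclid => j.
  rewrite (_ : (fun x => _) = fun x : 'rV[R]_d.+1 => x 0 (lift 0 j)); first exact: measurable_coord.
  by apply/funext => x; rewrite /= mxE.
have tK : cancel (@cons_rV d) t.
  move=> [a b]; rewrite /t cons_rV0; congr (_, _); apply/rowP => j.
  by rewrite mxE cons_rVS.
exists (fun n => t @^-1` F n).
  by rewrite -preimage_bigcup -FT.
move=> n; split; first by rewrite -[X in measurable X]setTI; apply: mt => //; have [] := Ffin n.
rewrite /= /pushforward -comp_preimage (_ : t \o _ = id); last by apply/funext => p /=; rewrite tK.
by have [] := Ffin n.
Qed.

End lebesgue_euclid.

Section integral_of_products.
Context {d1 d2} {T1 : measurableType d1} {T2 : measurableType d2} {R : realType}.
Variables (m1 : {sigma_finite_measure set T1 -> \bar R})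
  (m2 : {sigma_finite_measure set T2 -> \bar R}).

Lemma integral_prodM (a : T1 -> R) (b : T2 -> R) :
  m1.-integrable setT (EFin \o a) -> m2.-integrable setT (EFin \o b) ->
  (m1 \x m2)%E.-integrable setT (fun p => (a p.1 * b p.2)%:E) /\
  fine (\int[m1 \x m2]_p (a p.1 * b p.2)%:E)%E =
    fine (\int[m1]_x (a x)%:E)%E * fine (\int[m2]_y (b y)%:E)%E.
Proof.
move=> ia ib.
have ma : measurable_fun setT a by apply/measurable_EFinP; exact: measurable_int ia.
have mb : measurable_fun setT b by apply/measurable_EFinP; exact: measurable_int ib.
have mab : measurable_fun setT (fun p : T1 * T2 => (a p.1 * b p.2)%:E).
  by apply/measurable_EFinP; apply: measurable_funM; [exact: (measurableT_comp ma)|exact: (measurableT_comp mb)].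
have iab : (m1 \x m2)%E.-integrable setT (fun p => (a p.1 * b p.2)%:E).
  apply/integrable12ltyP => //.
  move/integrableP : ib => [_ ib].
  under eq_integral => x _.
    under eq_integral => y _ do rewrite /= normrM EFinM.
    rewrite ge0_integralZl//; last first.
      by apply/measurable_EFinP; exact: measurableT_comp.
    over.
  rewrite ge0_integralZr//; first last.
  - exact: integral_ge0.
  - by apply/measurable_EFinP; exact: measurableT_comp.
  move/integrableP : ia => [_ ia].
  rewrite lte_mul_pinfty//; first exact: integral_ge0.
  by rewrite ge0_fin_numE//; exact: integral_ge0.
split=> //; rewrite -integral12_prod_meas1//= /fubini_F/=.
under eq_integral => x _.
  under eq_integral => y _ do rewrite EFinM.
  rewrite integralZl//; over.
rewrite /=.
have -> : (\int[m2]_y (b y)%:E = (fine (\int[m2]_y (b y)%:E))%:E)%E.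
  by rewrite fineK//; exact: integrable_fin_num.
rewrite integralZr//= fineM//; exact: integrable_fin_num.
Qed.

Lemma cintegral_prodM (a : T1 -> R[i]) (b : T2 -> R[i]) :
  cintegrable m1 a -> cintegrable m2 b ->
  cintegrable (m1 \x m2)%E (fun p => a p.1 * b p.2) /\
  cintegral (m1 \x m2)%E setT (fun p => a p.1 * b p.2) =
    cintegral m1 setT a * cintegral m2 setT b.
Proof.
move=> [ar ai] [br bi].
have [irr err] := integral_prodM ar br; have [iii eii] := integral_prodM ai bi.
have [iri eri] := integral_prodM ar bi; have [iir eir] := integral_prodM ai br.
have reE p : complex.Re (a p.1 * b p.2) =
    complex.Re (a p.1) * complex.Re (b p.2) - complex.Im (a p.1) * complex.Im (b p.2).
  by case: (a _) (b _) => ? ? [].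
have imE p : complex.Im (a p.1 * b p.2) =
    complex.Re (a p.1) * complex.Im (b p.2) + complex.Im (a p.1) * complex.Re (b p.2).
  by case: (a _) (b _) => ? ? [].
split.
  split.
    by under eq_fun do rewrite reE EFinB; apply: integrableB.
  by under eq_fun do rewrite imE EFinD; apply: integrableD.
rewrite /cintegral; apply/eqP; rewrite eq_complex/=; apply/andP; split; apply/eqP.
  under eq_integral do rewrite reE EFinB.
  rewrite integralB// fineB; [by rewrite err eii|exact: integrable_fin_num..].
under eq_integral do rewrite imE EFinD.
rewrite integralD// fineD; [by rewrite eri eir|exact: integrable_fin_num..].
Qed.

End integral_of_products.

Lemma cintegral_pushforward {d1 d2} {T1 : measurableType d1} {T2 : measurableType d2} {R : realType}
    (m : {measure set T1 -> \bar R}) (h : T1 -> T2) (f : T2 -> R[i]) :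
  measurable_fun setT h ->
  measurable_fun setT (fun x => complex.Re (f x)) ->
  measurable_fun setT (fun x => complex.Im (f x)) ->
  cintegrable m (f \o h) ->
  cintegrable (pushforward m h) f /\
  cintegral (pushforward m h) setT f = cintegral m setT (f \o h).
Proof.
move=> mh mr mi [ir ii].
move/measurable_EFinP : mr => mr; move/measurable_EFinP : mi => mi.
split; first by split; apply: (integrable_pushforward mh).
by rewrite /cintegral (integral_pushforward mh mr ir)// (integral_pushforward mh mi ii).
Qed.

Section lebesgue_product.
Context {R : realType}.

Lemma measurable_cprod_coord d (w : 'I_d -> measurableTypeR R -> R[i]) :
  (forall j, measurable_fun setT (fun x => complex.Re (w j x)) /\
     measurable_fun setT (fun x => complex.Im (w j x))) ->
  measurable_fun [set: euclid R d] (fun x : euclid R d => complex.Re (\prod_j w j ((x : 'rV[R]_d) 0 j))) /\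
  measurable_fun [set: euclid R d] (fun x : euclid R d => complex.Im (\prod_j w j ((x : 'rV[R]_d) 0 j))).
Proof.
move=> mw; elim: index_enum => [|j s [IHr IHi]].
  split; first by rewrite (_ : (fun x => _) = cst 1)//; apply/funext => x; rewrite big_nil.
  by rewrite (_ : (fun x => _) = cst 0)//; apply/funext => x; rewrite big_nil.
have [mr mi] := mw j.
have mr' := measurableT_comp mr (measurable_coord j).
have mi' := measurableT_comp mi (measurable_coord j).
split.
  rewrite (_ : (fun x => _) = fun x : euclid R d =>
    complex.Re (w j ((x : 'rV[R]_d) 0 j)) * complex.Re (\prod_(i <- s) w i ((x : 'rV[R]_d) 0 i)) -
    complex.Im (w j ((x : 'rV[R]_d) 0 j)) * complex.Im (\prod_(i <- s) w i ((x : 'rV[R]_d) 0 i))).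
    by apply: measurable_funB; apply: measurable_funM.
  by apply/funext => x; rewrite big_cons; case: (w j _) (\prod_(_ <- _) _) => ? ? [].
rewrite (_ : (fun x => _) = fun x : euclid R d =>
    complex.Re (w j ((x : 'rV[R]_d) 0 j)) * complex.Im (\prod_(i <- s) w i ((x : 'rV[R]_d) 0 i)) +
    complex.Im (w j ((x : 'rV[R]_d) 0 j)) * complex.Re (\prod_(i <- s) w i ((x : 'rV[R]_d) 0 i))).
  by apply: measurable_funD; apply: measurable_funM.
by apply/funext => x; rewrite big_cons; case: (w j _) (\prod_(_ <- _) _) => ? ? [].
Qed.

(** Induction on the dimension along the recursive definition of [lebesgue_rV]: image under
    [cons_rV], then Fubini. In dimension 0 the measure is a unit mass and the product is empty. *)
Lemma cintegral_lebesgue_prod d (w : 'I_d -> measurableTypeR R -> R[i]) :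
  (forall j, cintegrable lebesgue_measure (w j)) ->
  cintegrable (lebesgue_rV d) (fun x : euclid R d => \prod_j w j ((x : 'rV[R]_d) 0 j)) /\
  cintegral (lebesgue_rV d) setT (fun x : euclid R d => \prod_j w j ((x : 'rV[R]_d) 0 j)) =
    \prod_j cintegral lebesgue_measure setT (w j).
Proof.
elim: d w => [|d IH] w iw.
  rewrite big_ord0.
  have E : (fun x : euclid R 0 => \prod_j w j ((x : 'rV[R]_0) 0 j)) = cst 1.
    by apply/funext => x; rewrite big_ord0.
  have fin (c : R) : (@dirac _ (euclid R 0) (0 : 'rV[R]_0) R).-integrable setT (cst c%:E).
    by apply: finite_measure_integrable_cst.
  rewrite E; split; first by split; exact: fin.
  rewrite /cintegral /= (_ : (fun x => _) = cst 1%:E)// (_ : (fun x => 0%:E) = cst 0%:E)//.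
  have int (c : R) : (\int[@dirac _ (euclid R 0) (0%R : 'rV[R]_0) R]_x (cst c%:E) x = c%:E)%E.
    by rewrite integral_dirac// diracT mul1e.
  by rewrite !int.
have [mu muE] := @lebesgue_rV_sigma_finite R d.
have [IH1 IH2] := IH (fun j => w (lift 0 j)) (fun j => iw _).
rewrite -muE in IH1 IH2.
have [p1 p2] := cintegral_prodM (iw 0) IH1.
have mw j : measurable_fun setT (fun x => complex.Re (w j x)) /\
     measurable_fun setT (fun x => complex.Im (w j x)).
  by have [/measurable_int/measurable_EFinP ? /measurable_int/measurable_EFinP ?] := iw j.
have [mr mi] := measurable_cprod_coord mw.
have cE : (fun x : euclid R d.+1 => \prod_j w j ((x : 'rV[R]_d.+1) 0 j)) \o @cons_rV R d =
   fun p => w 0 p.1 * \prod_(j < d) w (lift 0 j) ((p.2 : 'rV[R]_d) 0 j).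
  apply/funext => p /=; rewrite big_ord_recl cons_rV0; congr (_ * _).
  by apply: eq_bigr => j _; rewrite cons_rVS.
rewrite -cE in p1 p2.
have [h1 h2] := cintegral_pushforward (@measurable_cons_rV R d) mr mi p1.
by rewrite [lebesgue_rV _]/= -muE; split => //; rewrite h2 p2 IH2 big_ord_recl.
Qed.

End lebesgue_product.

(** * Smooth functions *)

Section smooth_functions_of_one_variable.
Context {R : realType}.

(* A coinductive notion: a function is smooth if it belongs to a set of
   functions that is stable under differentiation. *)
Definition smooth1 (u : R -> R) : Prop := exists2 A : set (R -> R), A u &
  forall f, A f -> exists2 g, A g & forall t : R, is_derive t 1 f (g t).

Lemma smooth1_derive u : smooth1 u ->
  exists2 u', smooth1 u' & forall t : R, is_derive t 1 u (u' t).
Proof.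
move=> [A Au Ad]; have [u' Au' du] := Ad u Au.
by exists u' => //; exists A.
Qed.

Lemma smooth1_continuous u : smooth1 u -> continuous u.
Proof.
move=> /smooth1_derive[u' _ du] x.
by apply: differentiable_continuous; apply/derivable1_diffP; have := du x.
Qed.

(** The witness set in the definition of [smooth1] for sums and products: the closure of the smooth
    functions under both operations is stable under differentiation, by the Leibniz rule. *)
Inductive smooth1_alg : (R -> R) -> Prop :=
| smooth1_alg_base u : smooth1 u -> smooth1_alg u
| smooth1_alg_add u v : smooth1_alg u -> smooth1_alg v -> smooth1_alg (u \+ v)
| smooth1_alg_mul u v : smooth1_alg u -> smooth1_alg v -> smooth1_alg (u \* v).

Lemma smooth1_algW u : smooth1_alg u -> smooth1 u.
Proof.
move=> au; exists smooth1_alg => // f; elim.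
- move=> v /smooth1_derive[v' sv' dv]; exists v' => //; exact: smooth1_alg_base.
- move=> v w _ [v' sv' dv] _ [w' sw' dw]; exists (v' \+ w'); first exact: smooth1_alg_add.
  by move=> t; apply: is_deriveD.
- move=> v w av [v' sv' dv] aw [w' sw' dw].
  exists ((v \* w') \+ (w \* v')); first by apply: smooth1_alg_add; exact: smooth1_alg_mul.
  by move=> t; apply: is_deriveM.
Qed.

Lemma smooth1D u v : smooth1 u -> smooth1 v -> smooth1 (fun t => u t + v t).
Proof.
by move=> su sv; apply: smooth1_algW; apply: smooth1_alg_add; exact: smooth1_alg_base.
Qed.

Lemma smooth1M u v : smooth1 u -> smooth1 v -> smooth1 (fun t => u t * v t).
Proof.
by move=> su sv; apply: smooth1_algW; apply: smooth1_alg_mul; exact: smooth1_alg_base.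
Qed.

Lemma smooth1_cst c : smooth1 (fun=> c).
Proof.
exists [set f | exists c, f = fun=> c]; first by exists c.
by move=> _ [e ->]; exists (fun=> 0); [exists 0|move=> t; exact: is_derive_cst].
Qed.

Lemma is_derive_affine (a b t : R) : is_derive t 1 (fun t => a * t + b) a.
Proof.
have h : is_derive t 1 (a *: id + cst b) (a *: 1 + 0) by apply: is_deriveD.
by move: h; rewrite addr0 /GRing.scale/= mulr1.
Qed.

Lemma smooth1_affine a b : smooth1 (fun t => a * t + b).
Proof.
exists [set f | exists a b, f = fun t => a * t + b]; first by exists a, b.
move=> _ [c [e ->]]; exists (fun=> c).
  by exists 0, c; apply/funext => t; rewrite mul0r add0r.
by move=> t; exact: is_derive_affine.
Qed.

Lemma smooth1_comp_affine u a b : smooth1 u -> smooth1 (fun t => u (a * t + b)).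
Proof.
move=> [A Au Ad].
exists [set f | exists c v, A v /\ f = fun t => c * v (a * t + b)].
  by exists 1, u; split => //; apply/funext => t; rewrite mul1r.
move=> _ [c [v [Av ->]]]; have [v' Av' dv] := Ad v Av.
exists (fun t => (c * a) * v' (a * t + b)); first by exists (c * a), v'.
move=> t.
have h : is_derive t 1 (fun t => a * t + b) a.
  exact: is_derive_affine.
have hc : is_derive t 1 (v \o (fun t => a * t + b)) (v' (a * t + b) * a) by exact: is_derive1_comp.
rewrite (_ : c * a * _ = c *: (v' (a * t + b) * a)); last by rewrite /GRing.scale/= mulrA mulrAC.
exact: (is_deriveZ c).
Qed.

Lemma smooth1_cos a b : smooth1 (fun t => cos (a * t + b)).
Proof.
suff : smooth1 cos by move/(smooth1_comp_affine a b).
(* The phase e varies because the derivative of a cosine is the cosine shifted by pi / 2; the sine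
   is one of these functions. *)
exists [set f | exists c e : R, f = fun t => c * cos (t + e)].
  by exists 1, 0; apply/funext => t; rewrite mul1r addr0.
move=> _ [c [e ->]]; exists (fun t => c * cos (t + (e + pi / 2))); first by exists c, (e + pi / 2).
move=> t; have h : is_derive t 1 (fun t => t + e) 1.
  by apply: is_derive_eq; rewrite addr0.
have hc : is_derive t 1 (cos \o (fun t => t + e)) (- sin (t + e) * 1) by exact: is_derive1_comp.
rewrite addrA cosDpihalf.
rewrite (_ : c * _ = c *: (- sin (t + e) * 1)); last by rewrite mulr1.
exact: (is_deriveZ c).
Qed.

End smooth_functions_of_one_variable.

Section smooth_functions.
Context {R : realType} {d : nat}.

Lemma dotp_is_linear (l : 'rV[R]_d) : linear (dotp l).
Proof.
move=> c x y; rewrite /dotp /GRing.scale/= mulr_sumr -big_split; apply: eq_bigr => i _.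
by rewrite !mxE mulrDr mulrCA.
Qed.
HB.instance Definition _ (l : 'rV[R]_d) := GRing.isLinear.Build R 'rV[R]_d R _ (dotp l) (dotp_is_linear l).

Lemma dotp_continuous (l : 'rV[R]_d) : continuous (dotp l).
Proof.
move=> x; apply: differentiable_continuous.
rewrite (_ : dotp l = \sum_(i < d) (fun y : 'rV[R]_d => l 0 i * y 0 i)); last first.
  by apply/funext => y; rewrite fct_sumE.
apply: differentiable_sum => i; apply: differentiableZ; exact: differentiable_coord.
Qed.

Lemma ridge_derive (u : R -> R) (u' : R) (l x : 'rV[R]_d) b :
  is_derive (dotp l x + b) 1 u u' ->
  differentiable (fun y => u (dotp l y + b)) x /\
  forall v, 'D_v (fun y => u (dotp l y + b)) x = dotp l v * u'.
Proof.
move=> du.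
have cl : continuous (dotp l) by exact: dotp_continuous.
have dl : differentiable (dotp l + cst b) x.
  by apply: differentiableD => //; exact: linear_differentiable.
have dd : differentiable u ((dotp l + cst b) x) by apply/derivable1_diffP; case: du.
have E : (fun y => u (dotp l y + b)) = u \o (dotp l + cst b) by [].
split; first by rewrite E; exact: differentiable_comp.
move=> v; rewrite E deriveE; last exact: differentiable_comp.
rewrite diff_comp// /= diffD//; last exact: linear_differentiable.
rewrite /= diff_lin// diff_cst /= addr0 diff1E// derive1E.
by case: du => _; rewrite /= => ->.
Qed.

(** Ridge functions, sums and products cover the waves, kernels and packets below, and the class
    they generate is stable under directional derivatives; [smooth] then follows by iteration. *)
Inductive smooth_alg : ('rV[R]_d -> R) -> Prop :=
| smooth_alg_ridge u l b : smooth1 u -> smooth_alg (fun x => u (dotp l x + b))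
| smooth_alg_add f g : smooth_alg f -> smooth_alg g -> smooth_alg (fun x => f x + g x)
| smooth_alg_mul f g : smooth_alg f -> smooth_alg g -> smooth_alg (fun x => f x * g x).

Lemma smooth_alg_cst c : smooth_alg (fun=> c).
Proof. exact: (smooth_alg_ridge 0 0 (smooth1_cst c)). Qed.

Lemma smooth_alg_derive f : smooth_alg f ->
  (forall x, differentiable f x) /\ forall v, smooth_alg ('D_v f).
Proof.
elim.
- move=> u l b /smooth1_derive[u' su' du]; split.
    by move=> x; have [] := ridge_derive (du (dotp l x + b)).
  move=> v; rewrite (_ : 'D_v _ = (fun x => dotp l v * u' (dotp l x + b))).
    
    by apply: (smooth_alg_mul (smooth_alg_cst _)); exact: smooth_alg_ridge.
  by apply/funext => x; have [_ ->] := ridge_derive (du (dotp l x + b)).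
- move=> g h ag [dg Dg] ah [dh Dh]; split; first by move=> x; exact: differentiableD.
  move=> v; rewrite (_ : 'D_v _ = fun x => 'D_v g x + 'D_v h x); first exact: smooth_alg_add.
  by apply/funext => x; rewrite (deriveD _ _)//; exact: diff_derivable.
- move=> g h ag [dg Dg] ah [dh Dh]; split; first by move=> x; exact: differentiableM.
  move=> v; rewrite (_ : 'D_v _ = fun x => g x * 'D_v h x + h x * 'D_v g x).
    by apply: smooth_alg_add; exact: smooth_alg_mul.
  by apply/funext => x; rewrite (deriveM _ _)//; exact: diff_derivable.
Qed.

Lemma smooth_alg_continuous f : smooth_alg f -> continuous f.
Proof. by move=> /smooth_alg_derive[df _] x; apply: differentiable_continuous. Qed.

Lemma dotp_delta (j : 'I_d) (x : 'rV[R]_d) : dotp (delta_mx 0 j) x = x 0 j.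
Proof.
rewrite /dotp (bigD1 j)//= mxE !eqxx mul1r big1 ?addr0// => i ij.
by rewrite mxE (negbTE ij) andbF mul0r.
Qed.

Lemma smooth_alg_coord u j : smooth1 u -> smooth_alg (fun x => u (x 0 j)).
Proof.
move=> su; have := smooth_alg_ridge (delta_mx 0 j) 0 su.
by congr smooth_alg; apply/funext => x; rewrite dotp_delta addr0.
Qed.

Lemma smooth_alg_prod (I : Type) (r : seq I) (F : I -> 'rV[R]_d -> R) :
  (forall i, smooth_alg (F i)) -> smooth_alg (fun x => \prod_(i <- r) F i x).
Proof.
move=> sF; elim: r => [|i r IH].
  by rewrite (_ : (fun x => _) = fun=> 1); [exact: smooth_alg_cst|apply/funext => x; rewrite big_nil].
rewrite (_ : (fun x => _) = fun x => F i x * \prod_(j <- r) F j x); first exact: smooth_alg_mul.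
by apply/funext => x; rewrite big_cons.
Qed.

Lemma smooth_algX f n : smooth_alg f -> smooth_alg (fun x => f x ^+ n).
Proof.
move=> sf; have := smooth_alg_prod (index_enum 'I_n) (fun=> sf).
by congr smooth_alg; apply/funext => x; rewrite prodr_const card_ord.
Qed.

Lemma smooth_alg_pderiv s f : smooth_alg f -> smooth_alg (pderiv s f).
Proof.
move=> af; elim: s => //= i s IH; exact: (smooth_alg_derive IH).2.
Qed.

Lemma smooth_algW (f : 'rV[R]_d -> R[i]) :
  smooth_alg (fun x => complex.Re (f x)) -> smooth_alg (fun x => complex.Im (f x)) ->
  smooth f.
Proof.
move=> ar ai s x; split.
  exact: (smooth_alg_derive (smooth_alg_pderiv s ar)).1.
exact: (smooth_alg_derive (smooth_alg_pderiv s ai)).1.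
Qed.

Lemma smooth_alg_wave (l : 'rV[R]_d) b :
  smooth_alg (fun x => complex.Re (expi (dotp l x + b))) /\
  smooth_alg (fun x => complex.Im (expi (dotp l x + b))).
Proof.
split.
  have := smooth_alg_ridge l b (smooth1_cos 1 0).
  by rewrite (_ : (fun x => _) = fun x => cos (dotp l x + b))//; apply/funext => x; rewrite mul1r addr0.
have := smooth_alg_ridge l b (smooth1_cos 1 (- (pi / 2))).
rewrite (_ : (fun x => _) = fun x => sin (dotp l x + b))//; apply/funext => x.
by rewrite mul1r cosB cos_pihalf sin_pihalf mulr0 add0r mulr1.
Qed.

Lemma smooth_alg_re_im_mul (f g : 'rV[R]_d -> R[i]) :
  smooth_alg (fun x => complex.Re (f x)) /\ smooth_alg (fun x => complex.Im (f x)) ->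
  smooth_alg (fun x => complex.Re (g x)) /\ smooth_alg (fun x => complex.Im (g x)) ->
  smooth_alg (fun x => complex.Re (f x * g x)) /\ smooth_alg (fun x => complex.Im (f x * g x)).
Proof.
move=> [fr fi] [gr gi]; split.
  rewrite (_ : (fun x => _) = fun x => complex.Re (f x) * complex.Re (g x) +
     -1 * (complex.Im (f x) * complex.Im (g x))).
    apply: smooth_alg_add; first exact: smooth_alg_mul.
    by apply: (smooth_alg_mul (smooth_alg_cst _)); exact: smooth_alg_mul.
  by apply/funext => x; rewrite mulN1r; case: (f x) (g x) => ? ? [? ?].
rewrite (_ : (fun x => _) = fun x => complex.Re (f x) * complex.Im (g x) +
     complex.Im (f x) * complex.Re (g x)).
  by apply: smooth_alg_add; apply: smooth_alg_mul.
by apply/funext => x; case: (f x) (g x) => ? ? [? ?].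
Qed.

End smooth_functions.

(** * Vanishing variance on the lattice *)

Lemma bounded_integrable {R : realType} {d} {T : measurableType d}
    (mu : {finite_measure set T -> \bar R}) (g : T -> R) (C : R) :
  measurable_fun setT g -> (forall x, `|g x| <= C) -> mu.-integrable setT (EFin \o g).
Proof.
move=> mg gC; apply: measurable_bounded_integrable => //.
  exact: fin_num_fun_lty.
by exists C; split; [exact: num_real|move=> r Cr x _ /=; exact: le_trans (gC x) (ltW Cr)].
Qed.

Section complex_integrals.
Context {R : realType} {d} {T : measurableType d} (mu : {measure set T -> \bar R}).

Lemma cintegral_lin (c : R[i]) (f g : T -> R[i]) :
  cintegrable mu f -> cintegrable mu g ->
  cintegrable mu (fun x => c * f x + g x) /\
  cintegral mu setT (fun x => c * f x + g x) = c * cintegral mu setT f + cintegral mu setT g.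
Proof.
move=> [fr fi] [gr gi]; case: c => a b.
have reE x : complex.Re ((a +i* b)%C * f x + g x) =
    a * complex.Re (f x) - b * complex.Im (f x) + complex.Re (g x).
  by case: (f x) (g x) => ? ? [].
have imE x : complex.Im ((a +i* b)%C * f x + g x) =
    a * complex.Im (f x) + b * complex.Re (f x) + complex.Im (g x).
  by case: (f x) (g x) => ? ? [].
have i1 e (h : T -> R) : mu.-integrable setT (EFin \o h) -> mu.-integrable setT (fun x => (e%:E * (h x)%:E)%E).
  by move=> ih; exact: integrableZl.
split.
  split.
    rewrite (_ : (fun x => _) = fun x => (a%:E * (complex.Re (f x))%:E -
       b%:E * (complex.Im (f x))%:E + (complex.Re (g x))%:E)%E).
      by apply: integrableD => //; apply: integrableB => //; exact: i1.
    by apply/funext => x; rewrite reE EFinD EFinB !EFinM.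
  rewrite (_ : (fun x => _) = fun x => (a%:E * (complex.Im (f x))%:E +
       b%:E * (complex.Re (f x))%:E + (complex.Im (g x))%:E)%E).
    by apply: integrableD => //; apply: integrableD => //; exact: i1.
  by apply/funext => x; rewrite imE !EFinD !EFinM.
have ifn (h : T -> R) : mu.-integrable setT (EFin \o h) -> (\int[mu]_x (h x)%:E)%E \is a fin_num.
  by move=> ih; exact: integrable_fin_num.
apply/eqP; rewrite eq_complex/=; apply/andP; split; apply/eqP.
  under eq_integral => x _ do rewrite reE EFinD EFinB !EFinM.
  rewrite integralD//; last by apply: integrableB => //; exact: i1.
  rewrite integralB//; [|exact: i1|exact: i1].
  rewrite !integralZl// fineD//; last 2 first.
  - by rewrite fin_numB !fin_numM// ifn.
  - exact: ifn.
  by rewrite fineB ?fin_numM ?ifn// !fineM ?ifn.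
under eq_integral => x _ do rewrite imE !EFinD !EFinM.
rewrite integralD//; last by apply: integrableD => //; exact: i1.
rewrite integralD//; [|exact: i1|exact: i1].
rewrite !integralZl// fineD//; last 2 first.
- by rewrite fin_numD !fin_numM// ifn.
- exact: ifn.
by rewrite fineD ?fin_numM ?ifn// !fineM ?ifn.
Qed.

Lemma cintegrable0 : cintegrable mu (fun=> 0).
Proof. by split; exact: integrable0. Qed.

Lemma cintegral0 : cintegral mu setT (fun=> 0) = 0.
Proof. by rewrite /cintegral/= !integral0. Qed.

Lemma cintegral_sum (I : Type) (r : seq I) (c : I -> R[i]) (f : I -> T -> R[i]) :
  (forall i, cintegrable mu (f i)) ->
  cintegrable mu (fun x => \sum_(i <- r) c i * f i x) /\
  cintegral mu setT (fun x => \sum_(i <- r) c i * f i x) =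
    \sum_(i <- r) c i * cintegral mu setT (f i).
Proof.
move=> fi; elim: r => [|i r [IHi IH]].
  rewrite big_nil (_ : (fun x => _) = fun=> 0).
    by split; [exact: cintegrable0|exact: cintegral0].
  by apply/funext => x; rewrite big_nil.
rewrite (_ : (fun x => _) = fun x => c i * f i x + \sum_(j <- r) c j * f j x); last first.
  by apply/funext => x; rewrite big_cons.
by have [h1 h2] := cintegral_lin (c i) (fi i) IHi; rewrite h2 IH big_cons.
Qed.

End complex_integrals.

Lemma cintegral_mkcond {R : realType} {d} {T : measurableType d} (mu : {measure set T -> \bar R})
    (D : set T) (f : T -> R[i]) :
  cintegral mu D f = cintegral mu setT (fun x => (\1_D x)%:C%C * f x).
Proof.
rewrite /cintegral; congr (_ +i* _)%C; congr fine.
  rewrite integral_mkcond; apply: eq_integral => x _; rewrite /patch indicE.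
  by case: ifP => _; case: (f x) => ? ? /=; rewrite !(mul1r,mul0r) subr0.
rewrite integral_mkcond; apply: eq_integral => x _; rewrite /patch indicE.
by case: ifP => _; case: (f x) => ? ? /=; rewrite !(mul1r,mul0r) addr0.
Qed.

Lemma FTC2_derive {R : realType} (f F : R -> R) (a b : R) : a < b -> continuous f ->
  (forall x : R, is_derive x 1 F (f x)) ->
  (\int[lebesgue_measure]_(x in `[a, b]) (f x)%:E = (F b - F a)%:E)%E.
Proof.
move=> ab cf dF.
have cF : continuous F.
  by move=> x; apply: differentiable_continuous; apply/derivable1_diffP; have := dF x.
rewrite (continuous_FTC2 (F := F))//.
- exact: continuous_subspaceT.
- split; [by move=> x _; have := dF x|..].
    by apply: cvg_at_right_filter; exact: cF.
  by apply: cvg_at_left_filter; exact: cF.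
- by move=> x _; rewrite derive1E; have [_ ->] := dF x.
Qed.

Section exponentials.
Context {R : realType}.

Lemma expi_2pi (m : int) : expi (2 * pi * m%:~R : R) = 1.
Proof.
have h n : expi (2 * pi * n%:R : R) = 1.
  elim: n => [|n IH]; first by rewrite mulr0 expi0.
  by rewrite -[n.+1]addn1 natrD mulrDr mulr1 expiD IH mul1r /expi mulr_natl cos2pi sin2pi.
case: m => n; first exact: h.
by rewrite NegzE mulrNz mulrN -[LHS]mulr1 -(h n.+1) expiNK.
Qed.

Lemma expi_period (m : int) (t : R) : expi (2 * pi * m%:~R + t) = expi t.
Proof. by rewrite expiD expi_2pi mul1r. Qed.

Let integral_period (g : R -> R) : continuous g ->
  lebesgue_measure.-integrable setT (fun k : measurableTypeR R => (\1_(`[0, 2 * pi[%classic) k * g k)%:E) /\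
  (\int[lebesgue_measure]_(k in setT) (\1_(`[0, 2 * pi[%classic) k * g k)%:E =
    \int[lebesgue_measure]_(k in `[0%R, (2 * pi)%R]) (g k)%:E)%E.
Proof.
move=> cg; have pi20 : 0 <= 2 * pi :> R by rewrite mulr_ge0// pi_ge0.
have E : (fun k : measurableTypeR R => (\1_(`[0, 2 * pi[%classic) k * g k)%:E) = (EFin \o g) \_ `[0, 2 * pi[.
  by apply/funext => k; rewrite /patch indicE; case: ifP => _; rewrite !(mul1r,mul0r).
have ig : lebesgue_measure.-integrable `[0, 2 * pi] (EFin \o g).
  by apply: continuous_compact_integrable; [exact: segment_compact|exact: continuous_subspaceT].
split.
  rewrite E -integrable_mkcond//; apply: integrableS ig => //.
  by apply: subset_itvl; rewrite bnd_simp.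
transitivity (\int[lebesgue_measure]_(k in setT) ((EFin \o g) \_ `[0%R, (2 * pi)%R[) k)%E; first by rewrite -E.
rewrite -integral_mkcond integral_itv_bndo_bndc//.
by apply/measurable_EFinP; apply: measurable_funTS; exact: continuous_measurable_fun.
Qed.

Let integral_cos_period (m : int) (b : R) : m != 0 ->
  (\int[lebesgue_measure]_(k in `[0%R, (2 * pi)%R]) (cos (m%:~R * k + b))%:E = 0)%E.
Proof.
move=> m0; have m0' : m%:~R != 0 :> R by rewrite intr_eq0.
have pi20 : 0 < 2 * pi :> R by rewrite mulr_gt0// pi_gt0.
apply: etrans (@FTC2_derive R _ (fun k => m%:~R^-1 * sin (m%:~R * k + b)) _ _ pi20 _ _) _; last first.
- congr EFin; rewrite mulr0 -mulrBr mulrC; have := expi_period m b; rewrite [m%:~R * _]mulrC add0r.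
  by rewrite /expi => -[_ ->]; rewrite subrr mul0r.
- move=> x.
  have h : is_derive x 1 (sin \o (fun t => m%:~R * t + b)) (cos (m%:~R * x + b) * m%:~R).
    by apply: is_derive1_comp; exact: is_derive_affine.
  rewrite (_ : cos _ = m%:~R^-1 *: (cos (m%:~R * x + b) * m%:~R)); first exact: is_deriveZ.
  by rewrite /GRing.scale/= mulrCA mulVf// mulr1.
- by move=> x; apply: smooth1_continuous; exact: smooth1_cos.
Qed.

Lemma integral_wave_period (m : int) :
  cintegrable lebesgue_measure (fun k : measurableTypeR R =>
    (\1_(`[0, 2 * pi[%classic) k)%:C%C * expi (m%:~R * k)) /\
  cintegral lebesgue_measure setT (fun k : measurableTypeR R =>
    (\1_(`[0, 2 * pi[%classic) k)%:C%C * expi (m%:~R * k)) =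
    if m == 0 then (2 * pi)%:C%C else 0.
Proof.
set f := (fun k : measurableTypeR R => _).
have reE k : complex.Re (f k) = \1_(`[0, 2 * pi[%classic) k * cos (m%:~R * k + 0).
  by rewrite /f /expi/= mul0r subr0 addr0.
have imE k : complex.Im (f k) = \1_(`[0, 2 * pi[%classic) k * cos (m%:~R * k + - (pi / 2)).
  by rewrite /f /expi/= mul0r addr0 cosB cos_pihalf sin_pihalf mulr0 add0r mulr1.
have cc (b : R) : continuous (fun k : R => cos (m%:~R * k + b)).
  by move=> x; apply: smooth1_continuous; exact: smooth1_cos.
have [ir er] := integral_period (cc 0).
have [ii ei] := integral_period (cc (- (pi / 2))).
split.
  by split; [under eq_fun do rewrite reE|under eq_fun do rewrite imE].
rewrite /cintegral.
rewrite (eq_integral _ _ (fun k _ => congr1 EFin (reE k))).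
rewrite (eq_integral _ _ (fun k _ => congr1 EFin (imE k))) er ei; case: ifPn => [/eqP->|m0]; last by rewrite !integral_cos_period.
rewrite (_ : (fun k => _) = cst (cos 0)%:E); last by apply/funext => k; rewrite mul0r addr0.
rewrite (_ : (fun k => _) = cst (cos (- (pi / 2)))%:E); last by apply/funext => k; rewrite mul0r add0r.
rewrite !integral_cst//= cosN cos_pihalf cos0 mul0e mul1e lebesgue_measure_itv/= lte_fin.
by rewrite mulr_gt0 ?pi_gt0//= oppr0 addr0.
Qed.

End exponentials.

(** * Lattice waves on the torus *)

Section torus_functions.
Context {R : realType} {d : nat}.

Definition lattice_wave (l : 'rV[int]_d) (k : 'rV[R]_d) : R[i] := expi (dotp (vec_of_int R l) k).

Lemma dotp_vec_of_int (l n : 'rV[int]_d) :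
  dotp (vec_of_int R l) ((2 * pi) *: vec_of_int R n) = 2 * pi * (\sum_i l 0 i * n 0 i)%:~R.
Proof.
rewrite linearZ /= /GRing.scale/=; congr (_ * _).
by rewrite /dotp rmorph_sum; apply: eq_bigr => i _; rewrite !mxE rmorphM.
Qed.

Lemma lattice_wave_periodic l : Defs.periodic (lattice_wave l).
Proof.
move=> n x; rewrite /lattice_wave linearD/= dotp_vec_of_int addrC; exact: expi_period.
Qed.

Lemma smooth_alg_lattice_wave l :
  smooth_alg (fun x => complex.Re (lattice_wave l x)) /\
  smooth_alg (fun x => complex.Im (lattice_wave l x)).
Proof.
have [h1 h2] := @smooth_alg_wave R d (vec_of_int R l) 0.
by rewrite /lattice_wave; split; [move: h1|move: h2]; congr smooth_alg; apply/funext => x; rewrite addr0.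
Qed.

Lemma smooth_lattice_wave l : smooth (lattice_wave l).
Proof. by have [? ?] := smooth_alg_lattice_wave l; exact: smooth_algW. Qed.

Definition torus_pi (x : 'rV[R]_d) : torus R d := (\pi_(torus R d) x)%qT.

Lemma torus_pi_eq x y : torus_pi x = torus_pi y <->
  exists n : 'rV[int]_d, x - y = (2 * pi) *: vec_of_int R n.
Proof.
split.
  by move=> /(@eqmodP _ (torus_equiv R d)) /asboolP.
by move=> h; apply/(@eqmodP _ (torus_equiv R d)); apply/asboolP.
Qed.

Lemma torus_piK (k : torus R d) : torus_pi (repr k) = k.
Proof. exact: reprK. Qed.

Lemma periodic_repr (T : Type) (f : 'rV[R]_d -> T) x :
  (forall (n : 'rV[int]_d) x, f (x + (2 * pi) *: vec_of_int R n) = f x) ->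
  f (repr (torus_pi x)) = f x.
Proof.
move=> pf; have /torus_pi_eq[n E] := torus_piK (torus_pi x).
by rewrite -(subrK x (repr _)) E addrC pf.
Qed.

Lemma torus_pi_continuous : continuous torus_pi.
Proof. exact: pi_continuous. Qed.

(** [repr] is a mere choice of representatives. For periodic f, the preimage of an open interval
    under f after [repr] is nevertheless open in the quotient topology, because its pull-back along
    the projection is the preimage under f. *)
Lemma measurable_torus (f : 'rV[R]_d -> R) : continuous f ->
  (forall (n : 'rV[int]_d) x, f (x + (2 * pi) *: vec_of_int R n) = f x) ->
  measurable_fun [set: borel_torus R d] (fun k : torus R d => f (repr k)).
Proof.
move=> cf pf.
apply: (@measurability _ _ (borel_torus R d) (measurableTypeR R) setT _ (RGenOpens.G (R:=R))).
  exact: RGenOpens.measurableE.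
move=> _ [_ [a [b ->]] <-]; rewrite setTI; apply: sub_gen_smallest.
rewrite /open/= /quotient_open.
rewrite (_ : _ @^-1` _ = f @^-1` `]a, b[).
  by apply: open_comp; [move=> x _; exact: cf|exact: interval_open].
by apply/seteqP; split => x /=; rewrite periodic_repr.
Qed.

Lemma lattice_wave_continuous l : continuous (fun x => complex.Re (lattice_wave l x)) /\
  continuous (fun x => complex.Im (lattice_wave l x)).
Proof.
have [/smooth_alg_derive[h1 _] /smooth_alg_derive[h2 _]] := smooth_alg_lattice_wave l.
by split => x; apply: differentiable_continuous.
Qed.

Lemma expi_le1 (t : R) : `|complex.Re (expi t)| <= 1 /\ `|complex.Im (expi t)| <= 1.
Proof. by rewrite /expi/= !ler_norml cos_geN1 cos_le1 sin_geN1 sin_le1. Qed.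

Lemma lattice_wave_integrable (S : {finite_measure set (borel_torus R d) -> \bar R}) l :
  cintegrable S (fun k : torus R d => lattice_wave l (repr k)).
Proof.
have [c1 c2] := lattice_wave_continuous l.
split; apply: (@bounded_integrable _ _ _ _ _ 1).
- apply: (measurable_torus c1) => n x; exact: congr1 (lattice_wave_periodic l n x).
- by move=> x; have [] := expi_le1 (dotp (vec_of_int R l) (repr x)).
- apply: (measurable_torus c2) => n x; exact: congr1 (lattice_wave_periodic l n x).
- by move=> x; have [] := expi_le1 (dotp (vec_of_int R l) (repr x)).
Qed.

Lemma expi_sum (I : Type) (r : seq I) (f : I -> R) :
  expi (\sum_(i <- r) f i) = \prod_(i <- r) expi (f i).
Proof.
elim: r => [|i r IH]; first by rewrite !big_nil expi0.
by rewrite !big_cons expiD IH.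
Qed.

(** The integrand on the fundamental cell is a product over coordinates, so orthogonality reduces to
    one period in one variable. The coefficients are unnormalized, whence (2 pi)^d. *)
Lemma fourier_coefficient_wave (l n : 'rV[int]_d) :
  fourier_coefficient (lattice_wave l) n = if n == l then ((2 * pi) ^+ d)%:C%C else 0.
Proof.
have [mu muE] := @lebesgue_rV_sigma_finite R d.
rewrite /fourier_coefficient -muE cintegral_mkcond muE.
pose w j (k : measurableTypeR R) : R[i] :=
  (\1_(`[0, 2 * pi[%classic) k)%:C%C * expi ((l 0 j - n 0 j)%:~R * k).
have [_ ] := @cintegral_lebesgue_prod R d w (fun j => (integral_wave_period _).1).
rewrite (_ : (fun x => \prod_j _) = fun x : euclid R d => (\1_fundamental_cell x)%:C%C *
    (lattice_wave l x * expi (- dotp x (vec_of_int R n)))).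
  move=> h; apply: (etrans h); case: eqP => [nl|nl].
    rewrite (eq_bigr (fun=> (2 * pi)%:C%C)); last first.
      by move=> j _; rewrite (integral_wave_period _).2 nl subrr eqxx.
    by rewrite prodr_const card_ord rmorphXn.
  have [j jnl] : exists j, l 0 j != n 0 j.
    apply/not_existsP => q; apply: nl; apply/rowP => j; apply/esym/eqP/negPn/negP; exact: q.
  by rewrite (bigD1 j)//= (integral_wave_period _).2 subr_eq0 (negbTE jnl) mul0r.
apply/funext => x; rewrite big_split/=; congr (_ * _).
  rewrite -rmorph_prod; congr (_ %:C)%C; rewrite indicE.
  have [xc|xc] := boolP (x \in _).
    rewrite big1// => j _; rewrite indicE mem_set//= in_itv/=.
    exact: (set_mem xc).
  have [j hj] : exists j, ~~ (0 <= (x : 'rV[R]_d) 0 j < 2 * pi).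
    apply/not_existsP => h; move/negP: xc; apply; apply/mem_set => j.
    by apply/negPn/negP; exact: h.
  by rewrite (bigD1 j)//= indicE memNset ?mul0r//= in_itv/=; exact/negP.
rewrite /lattice_wave -expiD -expi_sum; congr expi.
rewrite /dotp -sumrB; apply: eq_bigr => j _.
by rewrite !mxE rmorphB/=; ring.
Qed.

Lemma box_bounded_finite N : finite_set (@box d N).
Proof.
pose g (f : {ffun 'I_d -> 'I_(N + N).+1}) : 'rV[int]_d := \row_j ((f j)%:Z - N%:Z).
apply: (@sub_finite_set _ _ (g @` setT)); last exact: finite_image.
move=> n /= hn; exists [ffun j => inord (absz (n 0 j + N%:Z)%R)] => //.
apply/rowP => j; rewrite mxE ffunE; have := hn j; rewrite ler_norml => /andP[h1 h2].
rewrite inordK; last by rewrite ltnS -lez_nat gez0_abs; lia.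
by rewrite gez0_abs; lia.
Qed.

(** Tested on a wave, the defining series has at most one nonzero term, so its partial sums are
    eventually constant. *)
Lemma structure_function_wave beta (S : {finite_measure set (borel_torus R d) -> \bar R}) l :
  structure_functionZ beta S ->
  cintegral S setT (fun k : torus R d => lattice_wave l (repr k)) = ((2 * pi) ^+ d)%:C%C * beta l.
Proof.
move=> /(_ _ (smooth_lattice_wave l) (@lattice_wave_periodic l)) [hr hi].
have E : \forall N \near \oo, \sum_(n \in box N) beta n * fourier_coefficient (lattice_wave l) n =
    ((2 * pi) ^+ d)%:C%C * beta l.
  (* From this size on, the box contains l. *)
  exists (\sum_j absz (l ord0 j))%N => // N /= lN.
  rewrite (fsbigD1 l)//=; last 2 first.
  - exact: box_bounded_finite.
  - move=> j; rewrite -lez_nat in lN; apply: le_trans lN.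
    by rewrite (bigD1 j)//= -abszE lez_nat leq_addr.
  rewrite fourier_coefficient_wave eqxx mulrC fsbig1 ?addr0// => n [_ /eqP nl].
  by rewrite fourier_coefficient_wave (negbTE nl) mulr0.
have F (g : R[i] -> R) (c : R) : (fun N => g (\sum_(n \in box N) beta n *
    fourier_coefficient (lattice_wave l) n)) @ \oo --> c -> g (((2 * pi) ^+ d)%:C%C * beta l) = c.
  move=> h; apply: (@cvg_unique _ (@Rhausdorff R) _ _ _ _ _ h).
  by apply: cvg_near_cst; apply: filterS E => N ->.
by apply/eqP; rewrite eq_complex (F _ _ hr) (F _ _ hi) !eqxx.
Qed.

End torus_functions.

Section squared_modulus.
Context {R : realType}.

Definition sqnorm (z : R[i]) : R := complex.Re z ^+ 2 + complex.Im z ^+ 2.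

Lemma sqnormM (y z : R[i]) : sqnorm (y * z) = sqnorm y * sqnorm z.
Proof. by case: y z => a b [c e]; rewrite /sqnorm/=; ring. Qed.

Lemma sqnorm_real (r : R) : sqnorm r%:C%C = r ^+ 2.
Proof. by rewrite /sqnorm/= expr0n addr0. Qed.

Lemma sqnorm_prod (I : Type) (r : seq I) (F : I -> R[i]) :
  sqnorm (\prod_(i <- r) F i) = \prod_(i <- r) sqnorm (F i).
Proof.
elim: r => [|i r IH]; last by rewrite !big_cons sqnormM IH.
by rewrite !big_nil /sqnorm/= expr0n expr1n addr0.
Qed.

Lemma sqnormX z n : sqnorm (z ^+ n) = sqnorm z ^+ n.
Proof.
elim: n => [|n IH]; last by rewrite !exprS sqnormM IH.
by rewrite !expr0 /sqnorm/= expr0n expr1n addr0.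
Qed.

Lemma sqnorm_expi t : sqnorm (expi t) = 1.
Proof. by rewrite /sqnorm/= cos2Dsin2. Qed.

Lemma mul_conj_sqnorm (z : R[i]) : z * (z^*)%C = (sqnorm z)%:C%C.
Proof.
case: z => a b; rewrite /sqnorm /=; apply/eqP; rewrite eq_complex /=.
by apply/andP; split; apply/eqP; ring.
Qed.

Lemma expi_conj (t : R) : ((expi t)^*)%C = expi (- t).
Proof. by rewrite /expi cosN sinN. Qed.

End squared_modulus.

Section central_binomials.
Context {R : realType}.

(** The weight of one coordinate, to be taken at p = |s_j| by the symmetry of binomial coefficients.
    It is 0 for p > N because the coefficient is, which gives the kernel its bounded support. *)
Definition binomial_ratio (N p : nat) : R := 'C(N.*2, N + p)%:R / 'C(N.*2, N)%:R.

Let centralC_gt0 N : 0 < 'C(N.*2, N)%:R :> R.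
Proof. by rewrite ltr0n bin_gt0 -addnn leq_addr. Qed.

Lemma binomial_ratioS N p :
  binomial_ratio N p.+1 = binomial_ratio N p * ((N - p)%:R / (N + p).+1%:R).
Proof.
rewrite /binomial_ratio addnS [RHS]mulrAC; congr (_ / _).
apply: (@mulfI _ (N + p).+1%:R); first by rewrite pnatr_eq0.
rewrite -natrM mul_bin_left -[in LHS]addnn subnDl natrM addnn.
by rewrite [RHS]mulrC -[RHS]mulrA mulfVK ?pnatr_eq0// mulrC.
Qed.

Lemma binomial_ratio_itv N p : 0 <= binomial_ratio N p <= 1.
Proof.
elim: p => [|p /andP[IH0 IH1]].
  by rewrite /binomial_ratio addn0 divff ?gt_eqF// ler01 lexx.
have h0 : 0 <= (N - p)%:R / (N + p).+1%:R :> R by rewrite divr_ge0.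
have h1 : (N - p)%:R / (N + p).+1%:R <= 1 :> R.
  by rewrite ler_pdivrMr// mul1r ler_nat; lia.
by rewrite binomial_ratioS mulr_ge0//= mulr_ile1.
Qed.

Lemma cvg_binomial_ratio p : binomial_ratio ^~ p @ \oo --> (1 : R).
Proof.
elim: p => [|p IH].
  rewrite (_ : (fun n => _) = cst 1); first exact: cvg_cst.
  by apply/funext => N; rewrite /binomial_ratio addn0 divff// gt_eqF.
rewrite (_ : (fun n => _) = fun N => binomial_ratio N p * ((N - p)%:R / (N + p).+1%:R)); last first.
  by apply/funext => N; rewrite binomial_ratioS.
rewrite -[X in _ --> X]mulr1; apply: cvgM IH _.
(* Shifting the index by p removes the truncation in the subtraction N - p. *)
rewrite -(@cvg_shiftn p) /=.
rewrite (_ : (fun n => _) = fun N : nat => 1 - (p.*2).+1%:R * (N + p.*2).+1%:R^-1 :> R); last first.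
  apply/funext => N; rewrite addnK -addnA addnn.
  have n0 : (N + p.*2).+1%:R != 0 :> R by rewrite pnatr_eq0.
  apply: (mulIf n0); rewrite mulfVK// mulrBl mul1r mulfVK//.
  by rewrite -natrB ?ltnS ?leq_addl//; congr (_%:R); lia.
have h : (fun N : nat => (N + p.*2).+1%:R^-1 : R) @ \oo --> (0 : R).
  by have := @cvg_harmonic R; rewrite -(@cvg_shiftn p.*2); exact.
have : (fun N : nat => 1 - (p.*2).+1%:R * (N + p.*2).+1%:R^-1 :> R) @ \oo --> 1 - (p.*2).+1%:R * (0 : R).
  by apply: cvgB; [exact: cvg_cst|apply: cvgM => //; exact: cvg_cst].
by rewrite mulr0 subr0.
Qed.

(** The central coefficient is the largest of the 2N + 1 coefficients adding up to 4^N; the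
    induction uses the recurrence of central coefficients instead. The polynomial factor is harmless
    against the geometric decay off the vanishing set. *)
Lemma centralC_ge N : 4 ^+ N <= (N.*2.+1)%:R * 'C(N.*2, N)%:R :> R.
Proof.
rewrite -natrX -natrM ler_nat; elim: N => // N IH.
have h : (N.+1 * 'C(N.+1.*2, N.+1) = 2 * (N.*2.+1 * 'C(N.*2, N)))%N.
  have e1 := mul_bin_diag N.*2.+2 N; have e2 := mul_bin_down N.*2.+1 N.
  rewrite doubleS -e1 /= -doubleS -mul2n -mulnA; congr (2 * _)%N.
  by rewrite -[X in (_ = X)]/(N.*2.+1 * 'C(N.*2.+1.-1, N))%N e2; congr (_ * _)%N; lia.
rewrite -(@leq_pmul2l N.+1)// expnS.
rewrite [X in (_ <= X)%N]mulnCA h [X in (X <= _)%N]mulnA [X in (_ <= X)%N]mulnA.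
have h2 : (N.+1 * 4 <= (N.+1.*2.+1) * 2)%N by lia.
exact: leq_mul.
Qed.

(** Each factor n + 1 is paid for by replacing r with its square root. *)
Lemma cvg_natpow_expr (D : nat) (r : R) : 0 <= r < 1 ->
  (fun n : nat => n.+1%:R ^+ D * r ^+ n) @ \oo --> (0 : R).
Proof.
elim: D r => [|D IH] r /andP[r0 r1].
  under eq_fun do rewrite mul1r; apply: cvg_expr; rewrite ger0_norm//.
have s0 : 0 <= Num.sqrt r by exact: sqrtr_ge0.
have s1 : Num.sqrt r < 1 by rewrite -sqrtr1 ltr_sqrt.
rewrite (_ : (fun n => _) = fun n : nat => (n.+1%:R ^+ D * Num.sqrt r ^+ n) * (n.+1%:R * Num.sqrt r ^+ n)).
  rewrite -[X in _ --> X](mul0r 0); apply: cvgM; first by apply: IH; rewrite s0.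
  rewrite (_ : (fun n => _) = fun n : nat => n%:R * Num.sqrt r ^+ n + Num.sqrt r ^+ n).
    rewrite -[X in _ --> X](addr0 0); apply: cvgD; first by apply: cvg_natmul_expr; rewrite s0.
    by apply: cvg_expr; rewrite ger0_norm.
  by apply/funext => n; rewrite -natr1 mulrDl mul1r.
apply/funext => n; rewrite exprS -{1}(sqr_sqrtr r0) -exprM mulnC exprM expr2; ring.
Qed.

End central_binomials.

(** * Binomial kernels and their transforms *)

Section lattice_kernel.
Context {R : realType} {d : nat}.
Variable a : 'rV[R]_d.

Definition lattice_kernel (N : nat) (s : 'rV[int]_d) : R[i] :=
  (\prod_j binomial_ratio N (absz (s 0 j)%R))%:C%C * expi (dotp a (vec_of_int R s)).

Lemma lattice_kernel_out N s : ~ box N s -> lattice_kernel N s = 0.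
Proof.
move=> nb; have [j hj] : exists j, ~~ (`|s 0 j| <= N%:Z).
  by apply/not_existsP => q; apply: nb => j; apply/negPn/negP; exact: q.
rewrite /lattice_kernel (bigD1 j)//= /binomial_ratio bin_small ?mul0r ?mul0r//.
by move: hj; lia.
Qed.

Lemma lattice_kernel_le1 N s :
  `|complex.Re (lattice_kernel N s)| <= 1 /\ `|complex.Im (lattice_kernel N s)| <= 1.
Proof.
have /andP[p0 p1] : 0 <= (\prod_j binomial_ratio N (absz (s 0 j)%R) : R) <= 1.
  apply: (big_ind (fun x : R => 0 <= x <= 1)); first by rewrite ler01 lexx.
    by move=> x y /andP[x0 x1] /andP[y0 y1]; rewrite mulr_ge0//= mulr_ile1.
  by move=> j _; exact: binomial_ratio_itv.
have [e1 e2] := expi_le1 (dotp a (vec_of_int R s)).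
rewrite /lattice_kernel; move: e1 e2; case: (expi _) => x y /= e1 e2.
by rewrite !mul0r subr0 addr0 !normrM (ger0_norm p0); split; rewrite mulr_ile1.
Qed.

Lemma cvg_lattice_kernel s : ccvg (lattice_kernel ^~ s) (expi (dotp a (vec_of_int R s))).
Proof.
rewrite -[X in ccvg _ X]mul1r; apply: ccvgM; last exact: ccvg_cst.
split => /=; last exact: cvg_cst.
elim: (index_enum _) => [|j r IH].
  by under eq_fun do rewrite big_nil; exact: cvg_cst.
under eq_fun do rewrite big_cons.
have : (fun N => binomial_ratio N (absz (s 0 j)%R) * \prod_(i <- r) binomial_ratio N (absz (s 0 i)%R)) @ \oo --> (1 * 1 : R).
  by apply: cvgM => //; exact: cvg_binomial_ratio.
by rewrite mulr1.
Qed.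

Lemma lattice_kernel_bounded N :
  cbounded_supported (box N : set (lattice d)) (lattice_kernel N : lattice d -> R[i]).
Proof.
split; split.
- by move=> _ A _; exact: measurable_lattice.
- by exists 1 => x; have [] := lattice_kernel_le1 N x.
- by move=> x nx; rewrite lattice_kernel_out.
- by move=> _ A _; exact: measurable_lattice.
- by exists 1 => x; have [] := lattice_kernel_le1 N x.
- by move=> x nx; rewrite lattice_kernel_out.
Qed.

(** Indexing the box by finite functions turns the lattice sums into finite big operators and lets a
    product of one-variable sums be distributed. *)
Definition box_point (N : nat) (f : {ffun 'I_d -> 'I_(N.*2.+1)}) : 'rV[int]_d :=
  \row_j ((f j)%:Z - N%:Z).

Lemma box_point_inj N : injective (@box_point N).
Proof.
move=> f g fg; apply/ffunP => j; apply/val_inj => /=.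
have := congr1 (fun x : 'rV[int]_d => x 0 j) fg; rewrite !mxE; lia.
Qed.

Lemma box_pointP N s : box N s -> exists f, s = @box_point N f.
Proof.
move=> bs; exists [ffun j => inord (absz (s 0 j + N%:Z)%R)].
apply/rowP => j; rewrite mxE ffunE; have := bs j; rewrite ler_norml => /andP[h1 h2].
rewrite inordK; last by rewrite ltnS -lez_nat gez0_abs; lia.
by rewrite gez0_abs; lia.
Qed.

Lemma sum_box (V : nmodType) N (G : 'rV[int]_d -> V) :
  (forall s, ~ box N s -> G s = 0) ->
  \sum_(s \in [set: 'rV[int]_d]) G s = \sum_(f : {ffun 'I_d -> 'I_(N.*2.+1)}) G (@box_point N f).
Proof.
move=> G0; rewrite (fsbigE [seq @box_point N f | f <- index_enum {ffun 'I_d -> 'I_(N.*2.+1)}])//=.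
- by rewrite big_map big_mkcond/=; apply: eq_bigr => f _; rewrite in_setT.
- by rewrite map_inj_uniq; [exact: index_enum_uniq|exact: box_point_inj].
- move=> s _ sr; apply: G0 => /box_pointP[f E]; move/negP: sr; apply.
  by rewrite E map_f// mem_index_enum.
Qed.

(** The squared modulus of the transform of the kernel: 2 + 2 cos t is the squared modulus of 1 +
    exp(it), which enters to the power 2N. *)
Definition lattice_spectral (N : nat) (k : 'rV[R]_d) : R :=
  \prod_j ((2 + 2 * cos (a 0 j + k 0 j)) ^+ N.*2 / ('C(N.*2, N))%:R ^+ 2).

(** By distributivity the transform is a product over coordinates; each factor is, up to the phase
    exp(-iNt) and the normalization, the binomial expansion of (1 + exp(it))^(2N). *)
Lemma sqnorm_kernel_sum N (k : 'rV[R]_d) :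
  sqnorm (\sum_(f : {ffun 'I_d -> 'I_(N.*2.+1)})
    lattice_kernel N (@box_point N f) * lattice_wave (@box_point N f) k) = lattice_spectral N k.
Proof.
pose F (j : 'I_d) (m : 'I_(N.*2.+1)) : R[i] :=
  (('C(N.*2, m))%:R / ('C(N.*2, N))%:R)%:C%C * expi ((m%:R - N%:R) * (a 0 j + k 0 j)).
rewrite (eq_bigr (fun f : {ffun 'I_d -> 'I_(N.*2.+1)} => \prod_j F j (f j))); last first.
  move=> f _; rewrite /lattice_kernel /lattice_wave -mulrA -expiD /F [RHS]big_split/=.
  rewrite -rmorph_prod -expi_sum; congr (_%:C%C * expi _).
    apply: eq_bigr => j _; rewrite /binomial_ratio !mxE; congr (_%:R / _).
    have fj := ltn_ord (f j).
    have [h|h] := leqP N (f j); first by congr 'C(_, _); lia.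
    by rewrite -[RHS]bin_sub; [congr 'C(_, _)|]; lia.
  rewrite /dotp -big_split; apply: eq_bigr => j _; rewrite !mxE rmorphB/=; ring.
rewrite -bigA_distr_bigA/= sqnorm_prod; apply: eq_bigr => j _.
set t := a 0 j + k 0 j.
have -> : \sum_j0 F j j0 = (('C(N.*2, N))%:R^-1)%:C%C * expi (- (N%:R * t)) * (1 + expi t) ^+ N.*2.
  rewrite exprDn mulr_sumr; apply: eq_bigr => m _.
  rewrite expr1n mul1r /F -/t mulrBl addrC expiD rmorphM/=.
  have -> : expi (m%:R * t) = expi t ^+ m.
    elim: (nat_of_ord m) => [|n IH]; first by rewrite mul0r expi0.
    by rewrite -natr1 mulrDl mul1r expiD IH exprSr.
  by rewrite rmorph_nat -[expi t ^+ m *+ _]mulr_natr; ring.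
rewrite !sqnormM sqnorm_real sqnorm_expi mulr1 sqnormX exprVn mulrC; congr (_ ^+ _ / _).
have h := cos2Dsin2 t; rewrite /sqnorm [expi t]/expi /=.
by rewrite (_ : _ + _ = 1 + 2 * cos t + (cos t ^+ 2 + sin t ^+ 2)); [rewrite h|]; ring.
Qed.

(** Reduce t modulo 2 pi to a number u in [-pi, pi]; the cosine decreases on [0, pi], so cos e < cos
    |u| forces |u| < e. *)
Lemma cos_small_mod (e t : R) : 0 < e -> e <= pi -> cos e < cos t ->
  exists m : int, `|t - 2 * pi * m%:~R| < e.
Proof.
move=> e0 epi ct.
pose m := Num.floor ((t + pi) / (2 * pi)).
have pi20 : 0 < 2 * pi :> R by rewrite mulr_gt0 ?pi_gt0.
exists m; set u := t - _.
have cu : cos u = cos t.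
  have := expi_period m u; rewrite /u addrC subrK => h.
  exact: (esym (congr1 (@complex.Re R) h)).
have /andP[m1 m2] : m%:~R <= (t + pi) / (2 * pi) < (m + 1)%:~R by rewrite floor_le floorD1_gt.
rewrite ler_pdivlMr// in m1; rewrite ltr_pdivrMr// rmorphD/= mulrDl mul1r in m2.
have u1 : - pi <= u by rewrite /u; lra.
have u2 : u <= pi by rewrite /u; lra.
rewrite ltNge; apply/negP => eu; move: ct; rewrite -cu ltNge => /negP; apply.
have pu : `|u| <= pi by rewrite ler_norml u1.
move: eu; rewrite le_eqVlt => /predU1P[->|eu]; first by rewrite cos_norm.
rewrite -(cos_norm u) ltW// ltr_cos ?in_itv/= ?(ltW e0) ?normr_ge0//.
Qed.

End lattice_kernel.

Section lattice_variance.
Context {R : realType} {d : nat} {disp} {Omega : measurableType disp}.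
Variables (P : probability Omega R) (Xi : Omega -> cmeasZ R d) (beta : 'rV[int]_d -> R[i]).
Variables (S : {finite_measure set (borel_torus R d) -> \bar R}) (a : 'rV[R]_d).
Hypotheses (Hbeta : covariance_functionalZ P Xi beta) (HS : structure_functionZ beta S).

Let scale : R := (2 * pi) ^+ d.

(** Each value [beta (s - t)] is, up to the scale, the S-integral of a lattice wave; summation
    against the kernel under the integral leaves the squared modulus of its transform. *)
Lemma lattice_variance N :
  scale * complex.Re (ccovariance P (fun w => lfc_integral (Xi w) (lattice_kernel a N))
    (fun w => lfc_integral (Xi w) (lattice_kernel a N))) =
  fine (\int[S]_k (lattice_spectral a N (repr k))%:E)%E.
Proof.
have fs : finitely_supported (lattice_kernel a N).
  apply: sub_finite_set (box_bounded_finite N) => s /= /eqP h.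
  by apply: contrapT => nb; apply: h; exact: lattice_kernel_out.
rewrite Hbeta//.
pose T : finType := {ffun 'I_d -> 'I_(N.*2.+1)}.
pose c (f : T) := lattice_kernel a N (@box_point d N f).
have E1 : \sum_(s \in [set: 'rV[int]_d]) \sum_(t \in [set: 'rV[int]_d])
      lattice_kernel a N s * ((lattice_kernel a N t)^*)%C * beta (s - t) =
    \sum_(f : T) \sum_(g : T) c f * ((c g)^*)%C * beta (@box_point d N f - @box_point d N g).
  rewrite (@sum_box d _ N); last first.
    move=> s bs; rewrite fsbig1// => t _; by rewrite lattice_kernel_out// !mul0r.
  apply: eq_bigr => f _; rewrite (@sum_box d _ N)// => s bs.
  by rewrite (lattice_kernel_out _ bs) rmorph0 mulr0 mul0r.
rewrite E1.
have iw f := lattice_wave_integrable S f.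
pose h (f : T) (k : torus R d) := \sum_(g : T) ((c g)^*)%C * lattice_wave (@box_point d N f - @box_point d N g) (repr k).
have ih (f : T) := cintegral_sum (index_enum T) (fun g => ((c g)^*)%C) (fun g => iw (@box_point d N f - @box_point d N g)).
have [_ E2] := cintegral_sum (index_enum T) c (fun f => (ih f).1).
have -> (z : R[i]) : scale * complex.Re z = complex.Re (scale%:C%C * z).
  by case: z => x y /=; rewrite mul0r subr0.
rewrite (_ : scale%:C%C * _ = \sum_(f : T) c f * cintegral S setT (h f)); last first.
  rewrite mulr_sumr; apply: eq_bigr => f _; rewrite (ih f).2 !mulr_sumr.
  apply: eq_bigr => g _; rewrite (structure_function_wave _ HS) -/scale; ring.
rewrite -E2 /cintegral /=; congr fine; apply: eq_integral => k _; congr EFin.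
rewrite -sqnorm_kernel_sum -/T.
rewrite -[RHS]/(complex.Re (sqnorm _)%:C%C) -mul_conj_sqnorm; congr complex.Re.
rewrite mulr_suml; apply: eq_bigr => f _; rewrite -mulrA; congr (_ * _).
rewrite rmorph_sum mulr_sumr; apply: eq_bigr => g _.
rewrite rmorphM/= mulrCA; congr (_ * _).
rewrite /lattice_wave -[X in _ * X]/((expi (dotp (vec_of_int R (@box_point d N g)) (repr k)))^*)%C.
by rewrite expi_conj -expiD /vec_of_int map_mxB; congr expi; rewrite /dotp -sumrB; apply: eq_bigr => j _; rewrite !mxE mulrBl.
Qed.

Variable U : set (torus R d).
Hypotheses (oU : open U) (SU : S U = 0%E) (Ua : U (torus_pi (- a))).

(** A point off U has some coordinate at distance at least e from that of -a modulo 2 pi. This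
    coordinate contributes r^(2N) with r = (1 + cos e) / 2, the others at most 1, and each
    normalization costs (2N + 1)^2. *)
Lemma lattice_spectral_le : exists2 r : R, 0 <= r < 1 & forall N (k : torus R d), ~ U k ->
  lattice_spectral a N (repr k) <= (N.*2.+1)%:R ^+ (d.*2) * r ^+ N.*2.
Proof.
have : nbhs (- a) (torus_pi @^-1` U).
  by apply: torus_pi_continuous; exact: open_nbhs_nbhs.
move=> /nbhs_ballP[e0 /= e00 eU].
(* The minimum with pi keeps e in the range where the cosine decreases. *)
pose e := Num.min e0 pi.
have e_gt0 : 0 < e by rewrite lt_min e00 pi_gt0.
have epi : e <= pi by rewrite ge_min lexx orbT.
have ce1 : cos e < 1 by rewrite -cos0 ltr_cos ?in_itv/= ?lexx ?pi_ge0 ?(ltW e_gt0).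
have ceN1 : -1 <= cos e by exact: cos_geN1.
exists ((1 + cos e) / 2); first by apply/andP; split; lra.
move=> N k nUk; pose x := repr k.
have [j hj] : exists j, cos (a 0 j + x 0 j) <= cos e.
  apply: contrapT => nj; apply: nUk; rewrite -(torus_piK k) -/x.
  have /choice[m mP] j : exists m : int, `|a 0 j + x 0 j - 2 * pi * m%:~R| < e.
    apply: cos_small_mod => //; rewrite ltNge; apply/negP => h; apply: nj; by exists j.
  pose y : 'rV[R]_d := x - (2 * pi) *: vec_of_int R (\row_j m j).
  have -> : torus_pi x = torus_pi y.
    by apply/torus_pi_eq; exists (\row_j m j); rewrite /y opprB addrC subrK.
  apply: eU; split => // i j; rewrite ord1 /ball/= !mxE.
  have := mP j; rewrite lt_min => /andP[h _]; apply: le_lt_trans h.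
  by rewrite -normrN le_eqVlt; apply/orP; left; apply/eqP; congr `|_|; ring.
have c0 : 0 < 'C(N.*2, N)%:R :> R by rewrite ltr0n bin_gt0 -addnn leq_addr.
have fac i : (2 + 2 * cos (a 0 i + x 0 i)) ^+ N.*2 / ('C(N.*2, N))%:R ^+ 2 <=
    (N.*2.+1)%:R ^+ 2 * ((1 + cos (a 0 i + x 0 i)) / 2) ^+ N.*2.
  rewrite ler_pdivrMr ?exprn_gt0// mulrAC -exprMn.
  have -> : 2 + 2 * cos (a 0 i + x 0 i) = 4 * ((1 + cos (a 0 i + x 0 i)) / 2) by field.
  rewrite [X in X <= _]exprMn; apply: ler_wpM2r.
    by apply: exprn_ge0; have := cos_geN1 (a 0 i + x 0 i); lra.
  by rewrite -[X in 4 ^+ X]muln2 exprM; apply: lerXn2r; rewrite ?nnegrE ?mulr_ge0 ?exprn_ge0//; exact: centralC_ge.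
have fac0 i : 0 <= (2 + 2 * cos (a 0 i + x 0 i)) ^+ N.*2 / ('C(N.*2, N))%:R ^+ 2 :> R.
  by rewrite divr_ge0 ?exprn_ge0.
apply: (@le_trans _ _ (\prod_i ((N.*2.+1)%:R ^+ 2 * ((1 + cos (a 0 i + x 0 i)) / 2) ^+ N.*2))).
  by apply: ler_prod => i _; rewrite fac0 fac.
rewrite big_split/= prodr_const card_ord -exprM mul2n ler_wpM2l ?exprn_ge0//.
rewrite (bigD1 j)//= -[leRHS]mulr1.
have q i : 0 <= ((1 + cos (a 0 i + x 0 i)) / 2) <= 1.
  by have := cos_geN1 (a 0 i + x 0 i); have := cos_le1 (a 0 i + x 0 i); lra.
apply: ler_pM.
- by apply: exprn_ge0; have /andP[] := q j.
- by apply: prodr_ge0 => i _; apply: exprn_ge0; have /andP[] := q i.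
- by apply: lerXn2r; rewrite ?nnegrE; have /andP[? ?] := q j; lra.
- by apply: prodr_ile1 => i _; have /andP[h1 h2] := q i; rewrite exprn_ge0//= exprn_ile1.
Qed.

Lemma lattice_spectral_continuous N : continuous (lattice_spectral a N).
Proof.
apply: smooth_alg_continuous; apply: smooth_alg_prod => j.
apply: smooth_alg_mul; last exact: smooth_alg_cst.
apply: smooth_algX; apply: (smooth_alg_add (smooth_alg_cst 2)).
apply: (smooth_alg_mul (smooth_alg_cst 2)).
have := @smooth_alg_coord R d _ j (smooth1_cos 1 (a 0 j)).
by congr smooth_alg; apply/funext => x; rewrite mul1r addrC.
Qed.

Lemma lattice_variance_cvg0 :
  (fun N => complex.Re (ccovariance P (fun w => lfc_integral (Xi w) (lattice_kernel a N))
    (fun w => lfc_integral (Xi w) (lattice_kernel a N)))) @ \oo --> 0.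
Proof.
have [r r01 hr] := lattice_spectral_le.
have scale0 : 0 < scale by rewrite exprn_gt0// mulr_gt0 ?pi_gt0.
pose B N : R := (N.*2.+1)%:R ^+ (d.*2) * r ^+ N.*2.
have B0 N : 0 <= B N by rewrite mulr_ge0// exprn_ge0//; have /andP[] := r01.
have spec0 N k : 0 <= lattice_spectral a N k.
  by apply: prodr_ge0 => i _; rewrite divr_ge0 ?exprn_ge0.
have mspec N : measurable_fun [set: borel_torus R d] (fun k : torus R d => lattice_spectral a N (repr k)).
  apply: measurable_torus; first exact: lattice_spectral_continuous.
  move=> n x; apply: eq_bigr => j _; rewrite !mxE.
  have := expi_period (n 0 j) (a 0 j + x 0 j); rewrite [2 * pi * _ + _]addrC -addrA.
  by rewrite /expi => -[-> _].
have fS : S setT \is a fin_num by exact: fin_num_measure.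
have le N : (\int[S]_k (lattice_spectral a N (repr k))%:E <= (B N)%:E * S setT)%E.
  rewrite -[leRHS]integral_cst//; apply: ae_ge0_le_integral => //.
  - by move=> k _; rewrite lee_fin.
  - by apply/measurable_EFinP; exact: mspec.
  - by move=> k _; rewrite lee_fin.
  (* U is a null set of S, so a bound that holds off U is enough. *)
  - exists U; split => //; first exact: sub_gen_smallest.
    move=> k /= h; apply: contrapT => nU; apply: h => _.
    by rewrite lee_fin; exact: hr.
have cB : (fun N => scale^-1 * (B N * fine (S setT))) @ \oo --> 0.
  rewrite -(mulr0 scale^-1); apply: cvgM; first exact: cvg_cst.
  rewrite -(mul0r (fine (S setT))); apply: cvgM; last exact: cvg_cst.
  have h := cvg_natpow_expr d.*2 r01.
  have -> : B = (fun n : nat => n.+1%:R ^+ d.*2 * r ^+ n) \o double by [].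
  apply: cvg_comp h; apply/cvgnyPge => A; exists A => // n /= An.
  by rewrite (leq_trans An)// -addnn leq_addr.
apply: (squeeze_cvgr _ (cvg_cst 0) cB); apply: nearW => N.
have := lattice_variance N; set V := complex.Re _ => EV.
have i0 : (0 <= \int[S]_k (lattice_spectral a N (repr k))%:E)%E.
  by apply: integral_ge0 => k _; rewrite lee_fin.
have -> : V = scale^-1 * fine (\int[S]_k (lattice_spectral a N (repr k))%:E)%E.
  by rewrite -EV mulKf// gt_eqF.
rewrite mulr_ge0 ?invr_ge0 ?(ltW scale0) ?fine_ge0//= ler_wpM2l ?invr_ge0 ?(ltW scale0)//.
have -> : B N * fine (S setT) = fine ((B N)%:E * S setT)%E by rewrite fineM.
rewrite fine_le ?fin_numM// ge0_fin_numE// (le_lt_trans (le N))// -ge0_fin_numE ?mule_ge0 ?lee_fin//.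
by rewrite fin_numM.
Qed.

End lattice_variance.

Lemma stealthy_determinedZ {R : realType} {d} {dO} {Omega : measurableType dO}
    (P : probability Omega R) (Xi : {RV P >-> cmeasZ R d}) (D : set (lattice d)) :
  second_order P Xi -> generalized_stealthyZ P Xi -> finite_set D ->
  exists2 F : cmeasZ R d -> cmeasZ R d, measurable_fun [set: cmeasZ R d] F &
    {ae P, forall w, restrictZ D (Xi w) = F (restrictZ (~` D) (Xi w))}.
Proof.
move=> P2 [beta [S [U [Hb HS oU [k Uk] SU]]]] fD.
(* The kernel with phase a concentrates spectrally at -a, so the admissible frequencies are the
   reflected vanishing set, lifted from the torus. *)
apply: (@vanishing_variance_determinedZ _ _ _ _ _ _ D (fun a => U (torus_pi (- a)))) => //.
- move: oU => /(@open_comp _ _ (fun a : 'rV[R]_d => torus_pi (- a))); apply => a _.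
  apply: (@continuous_comp _ _ _ (fun a : 'rV[R]_d => - a) torus_pi); first exact: opp_continuous.
  exact: torus_pi_continuous.
- by exists (- repr k); rewrite opprK torus_piK.
- move=> a Ua; exists box, (lattice_kernel a); split.
  + by move=> n; split; [exact: measurable_lattice|exact: box_bounded_finite].
  + exact: lattice_kernel_bounded.
  + exact: lattice_kernel_le1.
  + exact: cvg_lattice_kernel.
  + exact: (lattice_variance_cvg0 Hb HS oU SU Ua).
Qed.

(** * Fourier analysis of a bump function *)

Section bump_function.
Context {R : realType}.

(** The classical flat function is the case n = 0; the negative powers of x are present because
    differentiating exp(-1/x) produces them. *)
Definition exp_inv (n : nat) (x : R) : R := if 0 < x then x ^- n * expR (- x^-1) else 0.

(** With y = 1/x > 0 this reads y^(n+2) <= (n+2)! exp(y), one term of the exponential series. The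
    quadratic bound makes the difference quotients at 0 tend to 0. *)
Lemma exp_inv_le n x : `|exp_inv n x| <= (n.+2)`!%:R * `|x| ^+ 2.
Proof.
rewrite /exp_inv; case: ifPn => [x0|_]; last by rewrite normr0 mulr_ge0// exprn_ge0.
have y0 : 0 <= x^-1 by rewrite invr_ge0 ltW.
have f0 : 0 < (n.+2)`!%:R :> R by rewrite ltr0n fact_gt0.
have := expR_ge1Dxn n.+1 y0 => h.
have {}h : x^-1 ^+ n.+2 <= (n.+2)`!%:R * expR x^-1.
  by rewrite mulrC -ler_pdivrMr// (le_trans _ h)// lerDr.
rewrite ger0_norm; last by rewrite mulr_ge0 ?expR_ge0// invr_ge0 exprn_ge0// ltW.
rewrite (gtr0_norm x0) expRN ler_pdivrMr ?expR_gt0// -exprVn.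
rewrite mulrAC -ler_pdivrMr ?exprn_gt0// -exprVn.
by rewrite (_ : x^-1 ^+ n * x^-1 ^+ 2 = x^-1 ^+ n.+2)// -exprD addn2.
Qed.

Lemma is_derive_exp_inv n (x : R) :
  is_derive x 1 (exp_inv n) (- n%:R * exp_inv n.+1 x + exp_inv n.+2 x).
Proof.
have [x0|x0|<-] := ltgtP 0 x.
- pose g (y : R) := (y^-1) ^+ n * expR (- y^-1).
  have xn0 : x != 0 by rewrite gt_eqF.
  have dV : is_derive x 1 (fun y : R => y^-1) (- x ^- 2).
    have := @is_deriveV R id x 1 1 xn0 (is_derive_id x 1).
    by rewrite /GRing.scale/= mulr1.
  have dX : is_derive x 1 (fun y : R => (y^-1) ^+ n) (n%:R * x^-1 ^+ n.-1 * - x ^- 2).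
    have := is_deriveX n dV; rewrite (_ : (fun y : R => y^-1) ^+ n = fun y => y^-1 ^+ n)//.
    by apply/funext => y; rewrite exprfctE.
  have dE : is_derive x 1 (fun y : R => expR (- y^-1)) (expR (- x^-1) * - (- x ^- 2)).
    exact: (@is_derive1_comp R expR (fun y => - y^-1) x _ _ (is_derive_expR _) (is_deriveN dV)).
  have dg : is_derive x 1 g (- n%:R * exp_inv n.+1 x + exp_inv n.+2 x).
    have := is_deriveM dX dE; rewrite /GRing.scale/= => dXE.
    apply: (is_derive_eq dXE); rewrite /exp_inv x0 -!exprVn; clear.
    set y := x^-1; set E := expR (- y).
    move: (n) => [|m]; rewrite /= ?exprS; ring.
  apply: near_eq_is_derive dg => //.
  near=> y; rewrite /exp_inv /g exprVn ifT//; near: y.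
  exact: (@lt_nbhsr R).
- have E : exp_inv n.+1 x = 0 /\ exp_inv n.+2 x = 0.
    by rewrite /exp_inv ltNge (ltW x0).
  rewrite E.1 E.2 mulr0 addr0.
  apply: near_eq_is_derive (is_derive_cst (0 : R) x 1) => //.
  near=> y; rewrite /exp_inv ltNge ltW//; near: y.
  exact: (@lt_nbhsl R).
- rewrite {2 3}/exp_inv ltxx mulr0 addr0.
  have c : (fun h : R => h^-1 *: (exp_inv n (h *: 1 + 0) - exp_inv n 0)) @ 0^' --> (0 : R).
    apply/norm_cvg0P.
    apply: (@squeeze_cvgr _ _ _ _ (cst 0) (fun h : R => (n.+2)`!%:R * `|h|)).
    + near=> h; rewrite normr_ge0/= /exp_inv ltxx subr0 -/(exp_inv n _).
      have h0 : h != 0 by near: h; exact: nbhs_dnbhs_neq.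
      rewrite {1}/GRing.scale/= normrM normfV ler_pdivrMl ?normr_gt0//.
      rewrite /GRing.scale/= mulr1 addr0; apply: le_trans (exp_inv_le _ _) _.
      by rewrite expr2 mulrCA.
    + exact: cvg_cst.
    + rewrite -[X in _ --> X](mulr0 (n.+2)`!%:R); apply: cvgM; first exact: cvg_cst.
      have : (fun h : R => `|h|) @ (0 : R) --> `|0 : R| by exact: norm_continuous.
      by rewrite normr0; apply: cvg_trans; apply: cvg_app; exact: cvg_within.
  split; first by apply/cvg_ex; exists 0.
  exact: cvg_lim c.
Unshelve. all: by end_near. Qed.

(** Finite linear combinations of the functions [exp_inv n] form the stable set that [smooth1] asks
    for. *)
Lemma smooth1_exp_inv : smooth1 (exp_inv 0).
Proof.
exists [set f | exists s : seq (R * nat), f = fun x => \sum_(p <- s) p.1 * exp_inv p.2 x].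
  by exists [:: (1, 0%N)]; apply/funext => x; rewrite big_seq1 mul1r.
move=> _ [s ->]; elim: s => [|[c n] s [g [t ->] dg]].
  exists (fun=> 0); first by exists [::]; apply/funext => x; rewrite big_nil.
  move=> t; rewrite (_ : (fun x => _) = cst 0); first exact: is_derive_cst.
  by apply/funext => x; rewrite big_nil.
exists (fun x => c * (- n%:R * exp_inv n.+1 x + exp_inv n.+2 x) + \sum_(p <- t) p.1 * exp_inv p.2 x).
  exists [:: (c * - n%:R, n.+1), (c, n.+2) & t]; apply/funext => x.
  by rewrite !big_cons/= mulrDr mulrA addrA.
move=> x; rewrite (_ : (fun x => _) = (c *: exp_inv n) + (fun x => \sum_(p <- s) p.1 * exp_inv p.2 x)).
  by apply: is_deriveD; apply: is_deriveZ; exact: is_derive_exp_inv.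
by apply/funext => y; rewrite big_cons.
Qed.

(** On the interval (-1, 1) this is exp(2 - 2 / (1 - x^2)). The factor [expR 2] makes the value at 0
    equal to 1, as the convergence of the weights to the wave requires. *)
Definition bump (x : R) : R := expR 2 * (exp_inv 0 (1 + x) * exp_inv 0 (1 - x)).

Lemma smooth1_bump : smooth1 bump.
Proof.
apply: smooth1M; first exact: smooth1_cst.
apply: smooth1M.
  have := smooth1_comp_affine 1 1 smooth1_exp_inv.
  by congr smooth1; apply/funext => x; rewrite mul1r addrC.
have := smooth1_comp_affine (-1) 1 smooth1_exp_inv.
by congr smooth1; apply/funext => x; rewrite mulN1r addrC.
Qed.

Lemma bumpN x : bump (- x) = bump x.
Proof. by rewrite /bump opprK [X in _ * X]mulrC. Qed.

Lemma bump0 : bump 0 = 1.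
Proof.
rewrite /bump addr0 subr0 /exp_inv ltr01 expr0 invr1 mul1r -!expRD.
by rewrite (_ : 2 + (-1 - 1) = 0) ?expR0//; ring.
Qed.

Lemma bump_out x : 1 <= `|x| -> bump x = 0.
Proof.
rewrite ler_normr /bump /exp_inv => /orP[x1|x1].
  by rewrite [X in _ * (_ * X)]ifF ?mulr0//; apply/negbTE; rewrite -leNgt; lra.
by rewrite ifF ?mul0r ?mulr0//; apply/negbTE; rewrite -leNgt; lra.
Qed.

Lemma bump_itv x : 0 <= bump x <= 1.
Proof.
have [x1|x1] := leP 1 `|x|; first by rewrite bump_out// lexx ler01.
move: x1; rewrite ltr_norml => /andP[x1 x2].
have p1 : 0 < 1 + x by lra. have p2 : 0 < 1 - x by lra.
rewrite /bump /exp_inv p1 p2 !expr0 !invr1 !mul1r -!expRD expR_ge0/=.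
rewrite -[leRHS]expR0 ler_expR.
have -> : - (1 + x)^-1 + - (1 - x)^-1 = - (2 / ((1 + x) * (1 - x))).
  by field; rewrite !gt_eqF.
rewrite subr_le0 ler_pdivlMr ?mulr_gt0// ler_piMr//.
by have := sqr_ge0 x; lra.
Qed.

Lemma bump_ge0 x : 0 <= bump x. Proof. by have /andP[] := bump_itv x. Qed.

Lemma continuous_bump : continuous bump.
Proof. exact: smooth1_continuous smooth1_bump. Qed.

End bump_function.

Section line_integrals.
Context {R : realType}.
Notation leb := (@lebesgue_measure R).

Definition affine (a b : R) (x : measurableTypeR R) : measurableTypeR R := a * x + b.

Lemma measurable_affine (a b : R) : measurable_fun setT (affine a b).
Proof. by apply: measurable_funD => //; exact: measurable_funM. Qed.

(** The scaled image measure agrees with the Lebesgue measure on half-open intervals, and these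
    determine it. A negative a reverses an interval and exchanges its open and closed ends. *)
Lemma lebesgue_affine (a b : R) (A : set R) : a != 0 -> measurable A ->
  (`|a|%:E * leb (affine a b @^-1` A) = leb A)%E.
Proof.
move=> a0 mA; have na0 : 0 <= `|a| by [].
pose pf : {measure set (measurableTypeR R) -> \bar R} :=
  measure_function_pushforward__canonical__measure_function_Measure leb (@measurable_affine a b).
pose m : {measure set (measurableTypeR R) -> \bar R} := mscale (NngNum na0) pf.
rewrite -[LHS]/(m A); apply/esym/lebesgue_measure_unique => //= _ [[p q]] _ <-.
rewrite /mscale /= /pushforward !lebesgue_measure_itv/= lte_fin.
have [a_gt0|a_lt0|/esym/eqP] := ltgtP 0 a; last by rewrite (negbTE a0).
  rewrite (_ : _ @^-1` _ = `](p - b) / a, (q - b) / a]%classic); last first.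
    apply/seteqP; split => x /=; rewrite /affine !in_itv/= ltr_pdivrMr// ler_pdivlMr//;
    by rewrite ltrBlDr lerBrDr mulrC.
  rewrite lebesgue_measure_itv/= lte_fin ltr_pM2r ?invr_gt0// ltrD2r.
  case: ifPn => _; last by rewrite mule0.
  rewrite -!EFinB -EFinM (gtr0_norm a_gt0); congr EFin; field; exact: a0.
rewrite (_ : _ @^-1` _ = `[(q - b) / a, (p - b) / a[%classic); last first.
  apply/seteqP; split => x /=; rewrite /affine !in_itv/= ler_ndivrMr// ltr_ndivlMr//;
  by rewrite ltrBlDr lerBrDr mulrC andbC.
rewrite lebesgue_measure_itv/= lte_fin ltr_nM2r ?invr_lt0// ltrD2r.
case: ifPn => _; last by rewrite mule0.
rewrite -!EFinB -EFinM (ltr0_norm a_lt0); congr EFin; field; exact: a0.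
Qed.

Lemma ge0_integral_affine (a b : R) (f : R -> \bar R) : a != 0 ->
  measurable_fun setT f -> (forall x, 0 <= f x)%E ->
  (\int[leb]_x f x = `|a|%:E * \int[leb]_x f (affine a b x))%E.
Proof.
move=> a0 mf f0; have na0 : 0 <= `|a| by [].
pose pf : {measure set (measurableTypeR R) -> \bar R} :=
  measure_function_pushforward__canonical__measure_function_Measure leb (@measurable_affine a b).
transitivity (\int[mscale (NngNum na0) pf]_x f x)%E.
  by apply: eq_measure_integral => A mA _; apply/esym; exact: lebesgue_affine.
rewrite ge0_integral_mscale//; congr (_ * _)%E.
by rewrite (ge0_integral_pushforward (@measurable_affine a b)).
Qed.

Lemma integral_affine (a b : R) (f : R -> R) : a != 0 ->
  leb.-integrable setT (EFin \o f) ->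
  leb.-integrable setT (fun x => (f (affine a b x))%:E) /\
  \int[leb]_x f x = `|a| * \int[leb]_x f (affine a b x).
Proof.
move=> a0 fi; have /integrableP[mf fin] := fi.
have na0 : 0 < `|a| by rewrite normr_gt0.
have m2 : measurable_fun setT (fun x => (f (affine a b x))%:E).
  by apply: (measurableT_comp mf); exact: measurable_affine.
have i2 : leb.-integrable setT (fun x => (f (affine a b x))%:E).
  apply/integrableP; split => //; move: fin.
  rewrite (ge0_integral_affine b a0 (f := fun x => `|(f x)%:E|%E))//; last exact: measurableT_comp.
  by case: (\int[_]_x _)%E => [r| |]//; rewrite ?ltry// gt0_muley ?lte_fin.
split=> //; rewrite /Rintegral.
rewrite -[X in X * _]/(fine `|a|%:E).
rewrite -fineM//; last exact: integrable_fin_num.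
congr fine; rewrite integralE [in RHS]integralE.
rewrite muleBr//; last first.
  by apply: fin_num_adde_defr; exact: integrable_pos_fin_num.
congr (_ - _)%E.
  rewrite (ge0_integral_affine b a0 (measurable_funepos mf))//; congr (_ * _)%E.
  by apply: eq_integral => x _; rewrite !funeposE.
rewrite (ge0_integral_affine b a0 (measurable_funeneg mf))//; congr (_ * _)%E.
by apply: eq_integral => x _; rewrite !funenegE.
Qed.

Lemma integrable_inv1sqr : leb.-integrable setT (fun x : R => ((1 + x ^+ 2)^-1)%:E).
Proof.
have d0 (x : R) : 0 < 1 + x ^+ 2 by rewrite ltr_pwDl// sqr_ge0.
have cf : continuous (fun x : R => (1 + x ^+ 2)^-1).
  exact: (@continuous_oneDsqrV R).
apply/integrableP; split; first by apply/measurable_EFinP; exact: continuous_measurable_fun.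
under eq_integral do rewrite /= ger0_norm ?invr_ge0 ?ltW//.
rewrite ge0_symfun_integralT//.
- rewrite -set_itvcy (_ : (\int[_]_(x in _) _)%E = (pi / 2)%:E) ?ltry//.
  exact: (@integral0y_oneDsqr R).
- by move=> x; rewrite invr_ge0 ltW.
- by move=> x /=; rewrite sqrrN.
Qed.

Lemma integrable_le_inv1sqr (f : R -> R) (C : R) : continuous f ->
  (forall x, `|f x| * (1 + x ^+ 2) <= C) -> leb.-integrable setT (EFin \o f).
Proof.
move=> cf fC; have := integrableZl measurableT C integrable_inv1sqr.
apply: le_integrable => //.
  by apply/measurable_EFinP; exact: continuous_measurable_fun.
move=> x _ /=; rewrite lee_fin; apply: le_trans (ler_norm _).
by rewrite ler_pdivlMr// ltr_pwDl// sqr_ge0.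
Qed.

Lemma integrable_compact (f : R -> R) (L : R) : continuous f ->
  (forall x, L < `|x| -> f x = 0) -> leb.-integrable setT (EFin \o f) /\
  \int[leb]_x f x = \int[leb]_(x in `[- L, L]) f x.
Proof.
move=> cf f0.
have E : f = f \_ `[- L, L].
  apply/funext => x; rewrite /patch; case: ifPn => //; rewrite notin_setE/= in_itv/= -ler_norml.
  by move/negP; rewrite -ltNge; exact: f0.
have ci : leb.-integrable `[- L, L] (EFin \o f).
  by apply: continuous_compact_integrable; [exact: segment_compact|exact: continuous_subspaceT].
split; last by rewrite [in LHS]E -Rintegral_mkcond.
rewrite [in X in integrable _ _ X]E.
rewrite (_ : EFin \o _ = (EFin \o f) \_ `[- L, L]); last first.
  by apply/funext => x; rewrite /patch /=; case: ifP.
by rewrite -integrable_mkcond.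
Qed.

Lemma Rintegral_Fubini (a b : R -> R) (c : R -> R -> R) (C : R) :
  leb.-integrable setT (EFin \o a) -> leb.-integrable setT (EFin \o b) ->
  measurable_fun setT (fun p : measurableTypeR R * measurableTypeR R => c p.1 p.2) ->
  (forall x y, `|c x y| <= C) ->
  \int[leb]_x (a x * \int[leb]_y (b y * c x y)) =
  \int[leb]_y (b y * \int[leb]_x (a x * c x y)).
Proof.
move=> ia ib mc c1.
have ma : measurable_fun setT (a : measurableTypeR R -> R) by apply/measurable_EFinP; exact: measurable_int ia.
have mb : measurable_fun setT (b : measurableTypeR R -> R) by apply/measurable_EFinP; exact: measurable_int ib.
have mcx x : measurable_fun setT (c x : measurableTypeR R -> R).
  exact: (measurableT_comp mc (pair1_measurable x)).
have mcy y : measurable_fun setT ((fun x => c x y) : measurableTypeR R -> R).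
  exact: (measurableT_comp mc (pair2_measurable y)).
have [iab _] := integral_prodM ia ib.
have C0 : 0 <= C by exact: le_trans (c1 0 0).
have mf : measurable_fun setT (fun p : measurableTypeR R * measurableTypeR R => a p.1 * b p.2 * c p.1 p.2).
  by apply: measurable_funM => //; apply: measurable_funM; [exact: (measurableT_comp ma)|exact: (measurableT_comp mb)].
have iabc : (leb \x leb)%E.-integrable setT (fun p => (a p.1 * b p.2 * c p.1 p.2)%:E).
  have := integrableZl measurableT C iab; apply: le_integrable => //.
    exact/measurable_EFinP.
  move=> p _ /=; rewrite lee_fin !normrM (ger0_norm C0) mulrC.
  by rewrite ler_wpM2r// mulr_ge0.
have bnd (g h : R -> R) : leb.-integrable setT (EFin \o g) -> measurable_fun setT (h : measurableTypeR R -> R) ->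
    (forall x, `|h x| <= C) -> leb.-integrable setT (fun x => (g x * h x)%:E).
  move=> ig mh h1; have := integrableZl measurableT C ig; apply: le_integrable => //.
    apply/measurable_EFinP; apply: measurable_funM => //.
    by apply/measurable_EFinP; exact: measurable_int ig.
  by move=> x _ /=; rewrite lee_fin !normrM (ger0_norm C0) mulrC ler_wpM2r.
have E1 (f g : R -> R) (F : R -> R -> R) : (forall x, leb.-integrable setT (fun y => (F x y)%:E)) ->
   (\int[leb]_x \int[leb]_y (f x * F x y)%:E = \int[leb]_x (f x * \int[leb]_y F x y)%:E)%E.
  move=> iF; apply: eq_integral => x _; under eq_integral do rewrite EFinM.
  rewrite integralZl// EFinM /Rintegral fineK//; exact: integrable_fin_num.
rewrite /Rintegral; congr fine.
have iF x := bnd b (c x) ib (mcx x) (c1 x).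
have iG y := bnd a (c ^~ y) ia (mcy y) (c1 ^~ y).
rewrite -(E1 a a (fun x y => b y * c x y) iF) -(E1 b b (fun y x => a x * c x y) iG).
have := Fubini iabc => /=.
under eq_integral => x _ do under eq_integral => y _ do rewrite -mulrA.
move=> ->; apply: eq_integral => y _; apply: eq_integral => x _.
by congr EFin; ring.
Qed.

Lemma Rintegral_dominated_cvg (F : nat -> R -> R) (f g : R -> R) :
  (forall n, measurable_fun setT (F n : measurableTypeR R -> R)) ->
  (forall x, F ^~ x @ \oo --> f x) ->
  leb.-integrable setT (EFin \o g) ->
  (forall n x, `|F n x| <= g x) ->
  (fun n => \int[leb]_x F n x) @ \oo --> \int[leb]_x f x.
Proof.
move=> mF Ff ig Fg.
have mf : measurable_fun setT (f : measurableTypeR R -> R).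
  by apply: (measurable_fun_cvg (h := F)) => // x _; exact: Ff.
have h1 n : measurable_fun setT (fun x : measurableTypeR R => (F n x)%:E) by exact/measurable_EFinP.
have h2 : measurable_fun setT (fun x : measurableTypeR R => (f x)%:E) by exact/measurable_EFinP.
have h3 : {ae leb, forall x, setT x -> (fun n => (F n x)%:E) @ \oo --> (f x)%:E}.
  by apply: aeW => x _; apply: cvg_EFin; [exact: nearW|exact: Ff].
have h4 : {ae leb, forall x n, setT x -> (`|(F n x)%:E| <= (EFin \o g) x)%E}.
  by apply: aeW => x n _ /=; rewrite lee_fin.
have [i1 _ c] := dominated_convergence measurableT h1 h2 h3 ig h4.
by apply: fine_cvg; rewrite fineK//; exact: integrable_fin_num.
Qed.

End line_integrals.

Section schwartz_functions_of_one_variable.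
Context {R : realType}.

(* As for [smooth1]: the set A is stable under differentiation and under
   multiplication by the variable, and consists of bounded functions. *)
Definition schwartz1 (u : R -> R) : Prop := exists2 A : set (R -> R), A u &
  forall f, A f -> [/\ exists C : R, forall t, `|f t| <= C,
    exists2 g, A g & forall t : R, is_derive t 1 f (g t) & A (fun t => t * f t)].

Lemma schwartz1P u : schwartz1 u -> [/\ exists C : R, forall t, `|u t| <= C,
  exists2 g, schwartz1 g & forall t : R, is_derive t 1 u (g t) & schwartz1 (fun t => t * u t)].
Proof.
move=> [A Au hA]; have [b [g Ag dg] m] := hA _ Au; split => //.
  by exists g => //; exists A.
by exists A.
Qed.

Lemma schwartz1_smooth1 u : schwartz1 u -> smooth1 u.
Proof.
move=> [A Au hA]; exists A => // f Af; have [_ [g Ag dg] _] := hA f Af.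
by exists g.
Qed.

Inductive schwartz1_alg : (R -> R) -> Prop :=
| schwartz1_alg_base u : schwartz1 u -> schwartz1_alg u
| schwartz1_alg_lin c u v : schwartz1_alg u -> schwartz1_alg v ->
    schwartz1_alg (fun t => c * u t + v t)
| schwartz1_alg_mul u v : schwartz1_alg u -> schwartz1_alg v ->
    schwartz1_alg (fun t => u t * v t).

Lemma schwartz1_algW u : schwartz1_alg u -> schwartz1 u.
Proof.
move=> au; exists schwartz1_alg => // f; elim.
- move=> v /schwartz1P[b [g sg dg] m]; split => //.
    by exists g => //; exact: schwartz1_alg_base.
  exact: schwartz1_alg_base.
- move=> c v w av [[C1 b1] [g1 sg1 dg1] m1] aw [[C2 b2] [g2 sg2 dg2] m2]; split.
  + exists (`|c| * C1 + C2) => t; apply: le_trans (ler_normD _ _) _.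
    by rewrite lerD// normrM ler_wpM2l.
  + exists (fun t => c * g1 t + g2 t); first exact: schwartz1_alg_lin.
    by move=> t; apply: is_deriveD; exact: is_deriveZ.
  + rewrite (_ : (fun t => _) = fun t => c * (t * v t) + t * w t); first exact: schwartz1_alg_lin.
    by apply/funext => t; ring.
- move=> v w av [[C1 b1] [g1 sg1 dg1] m1] aw [[C2 b2] [g2 sg2 dg2] m2]; split.
  + by exists (C1 * C2) => t; rewrite normrM ler_pM.
  + exists (fun t => 1 * (v t * g2 t) + w t * g1 t).
      by apply: schwartz1_alg_lin; exact: schwartz1_alg_mul.
    by move=> t; rewrite mul1r; apply: is_deriveM.
  + rewrite (_ : (fun t => _) = fun t => (t * v t) * w t); first exact: schwartz1_alg_mul.
    by apply/funext => t; rewrite mulrA.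
Qed.

Lemma schwartz1_lin c u v : schwartz1 u -> schwartz1 v -> schwartz1 (fun t => c * u t + v t).
Proof. by move=> *; apply/schwartz1_algW/schwartz1_alg_lin; exact: schwartz1_alg_base. Qed.

Lemma schwartz1M u v : schwartz1 u -> schwartz1 v -> schwartz1 (fun t => u t * v t).
Proof. by move=> *; apply/schwartz1_algW/schwartz1_alg_mul; exact: schwartz1_alg_base. Qed.

Lemma schwartz10 : schwartz1 (fun=> 0).
Proof.
exists [set fun=> 0] => // _ ->; split; first by exists 0 => t; rewrite normr0.
  by exists (fun=> 0) => // t; exact: is_derive_cst.
by apply/funext => t; rewrite mulr0.
Qed.

Lemma schwartz1Z c u : schwartz1 u -> schwartz1 (fun t => c * u t).
Proof.
move=> su; have := schwartz1_lin c su schwartz10.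
by congr schwartz1; apply/funext => t; rewrite addr0.
Qed.

Lemma schwartz1_comp_affine a b u : a != 0 -> schwartz1 u -> schwartz1 (fun t => u (a * t + b)).
Proof.
move=> a0 su; exists [set f | exists2 v, schwartz1 v & f = fun t => v (a * t + b)]; first by exists u.
move=> _ [v sv ->]; have [[C vC] [g sg dg] m] := schwartz1P sv; split.
- by exists C => t; exact: vC.
- exists (fun t => a * g (a * t + b)).
    by exists (fun s => a * g s) => //; exact: schwartz1Z.
  move=> t; have h : is_derive t 1 (v \o (fun t => a * t + b)) (g (a * t + b) * a).
    by apply: is_derive1_comp; exact: is_derive_affine.
  by rewrite mulrC.
(* With s = a t + b, the product t v(s) equals s v(s) / a - (b / a) v(s). *)
- exists (fun s => a^-1 * (s * v s) + - (b / a) * v s).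
    by apply: schwartz1_lin => //; exact: schwartz1Z.
  by apply/funext => t; field.
Qed.

(** One factor 1 + |t| is traded for the pair u and t u, both in the class. *)
Lemma schwartz1_decay n u : schwartz1 u -> exists C : R, forall t, (1 + `|t|) ^+ n * `|u t| <= C.
Proof.
elim: n u => [|n IH] u su; have [[C uC] _ m] := schwartz1P su.
  by exists C => t; rewrite expr0 mul1r.
have [C1 h1] := IH _ su; have [C2 h2] := IH _ m.
exists (C1 + C2) => t; rewrite exprS mulrDl mul1r mulrDl; apply: lerD => //.
by rewrite -mulrA mulrCA -normrM.
Qed.

End schwartz_functions_of_one_variable.

Section oscillatory_integrals.
Context {R : realType}.
Notation leb := (@lebesgue_measure R).

Definition bump_class (phi : R -> R) : Prop :=
  smooth1 phi /\ forall x, 1 < `|x| -> phi x = 0.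

(** The strict inequality 1 < |x| is an open condition, so phi is locally 0 there and its derivative
    vanishes too. *)
Lemma bump_class_derive phi : bump_class phi ->
  exists2 phi', bump_class phi' & forall t : R, is_derive t 1 phi (phi' t).
Proof.
move=> [/smooth1_derive[phi' s' d'] phi0]; exists phi' => //; split=> // x x1.
have [_ <-] := d' x.
rewrite (@near_eq_derive _ _ _ phi (cst 0)); first exact: derive_cst.
near=> y; apply: phi0; near: y.
by apply: (cvgr_gt `|x|) => //; exact: norm_continuous.
Unshelve. all: by end_near. Qed.

Lemma bump_classX phi : bump_class phi -> bump_class (fun x => x * phi x).
Proof.
move=> [s p0]; split; last by move=> x /p0 ->; rewrite mulr0.
apply: smooth1M => //; have := @smooth1_affine R 1 0.
by congr smooth1; apply/funext => x; rewrite mul1r addr0.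
Qed.

Lemma bump_class_bump : bump_class (@bump R).
Proof. by split; [exact: smooth1_bump|move=> x /ltW; exact: bump_out]. Qed.

(** The phase b merges cosine and sine transforms: differentiation in k and multiplication by k both
    shift it by pi / 2 and change phi within [bump_class], so the family is closed under the two
    operations in [schwartz1]. *)
Definition osc (phi : R -> R) (b k : R) : R := \int[leb]_y (phi y * cos (k * y + b)).

Let integrable_normr (f : R -> R) : leb.-integrable setT (EFin \o f) ->
  leb.-integrable setT (EFin \o (fun x => `|f x|)).
Proof. by move=> /integrable_abse. Qed.

Let osc_cont phi b k : bump_class phi -> continuous (fun y => phi y * cos (k * y + b)).
Proof.
by move=> [s _]; apply: smooth1_continuous; apply: smooth1M => //; exact: smooth1_cos.
Qed.

Lemma osc_integrable phi b k : bump_class phi ->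
  leb.-integrable setT (EFin \o (fun y => phi y * cos (k * y + b))).
Proof.
move=> cp; have h0 x : 1 < `|x| -> phi x * cos (k * x + b) = 0.
  by move=> x1; rewrite cp.2// mul0r.
by have [] := integrable_compact (@osc_cont phi b k cp) h0.
Qed.

Lemma bump_class_integrable phi : bump_class phi -> leb.-integrable setT (EFin \o phi).
Proof.
by move=> [s h0]; have [] := integrable_compact (smooth1_continuous s) h0.
Qed.

Lemma bump_class_bounded phi : bump_class phi -> exists C : R, forall x, `|phi x| <= C.
Proof.
move=> [s p0]; have cphi := smooth1_continuous s.
have : compact (phi @` `[-1, 1]).
  by apply: continuous_compact; [exact: continuous_subspaceT|exact: segment_compact].
move=> /compact_bounded[M [_ hM]]; exists (`|M| + 1) => x.
have [x1|x1] := leP `|x| 1; last by rewrite p0// normr0 addr_ge0.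
apply: (hM (`|M| + 1)); first by rewrite ltr_pwDr// ler_norm.
by exists x => //=; rewrite in_itv/= -ler_norml.
Qed.

Lemma osc_bounded phi b : bump_class phi -> exists C : R, forall k, `|osc phi b k| <= C.
Proof.
move=> cp; exists (\int[leb]_y `|phi y|) => k.
have ip := bump_class_integrable cp.
apply: le_trans (le_normr_Rintegral _ _) _ => //; first exact: osc_integrable.
apply: le_Rintegral => //.
- exact: (integrable_normr (osc_integrable b k cp)).
- exact: (integrable_normr ip).
- by move=> y _; rewrite normrM ler_piMr// cos_max.
Qed.

Lemma osc_derive phi (b k : R) : bump_class phi ->
  is_derive k 1 (osc phi b) (osc (fun y => y * phi y) (b + pi / 2) k).
Proof.
move=> cp; have cX := bump_classX cp.
have df (x y : R) : is_derive x 1 (fun x => phi y * cos (x * y + b)) (y * phi y * cos (x * y + (b + pi / 2))).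
  have h0 : is_derive x 1 (fun x => x * y + b) y.
    have := is_derive_affine y b x.
    by rewrite (_ : (fun t => y * t + b) = fun t => t * y + b)//; apply/funext => t; rewrite mulrC.
  have h : is_derive x 1 (cos \o (fun x => x * y + b)) (- sin (x * y + b) * y) by exact: is_derive1_comp.
  have := is_deriveZ (phi y) h.
  by rewrite /GRing.scale/= addrA cosDpihalf; congr is_derive; ring.
have p1E (x y : R) : partial1of2 (fun x y => phi y * cos (x * y + b)) x y =
    y * phi y * cos (x * y + (b + pi / 2)).
  by rewrite partial1of2E; have [_ ->] := df x y.
have kI : [set` `]k - 1, k + 1[%R] k by rewrite /= in_itv/= ltrBlDr ltrDl ltr01.
have i1 x : [set` `]k - 1, k + 1[%R] x -> leb.-integrable setT (EFin \o (fun y => phi y * cos (x * y + b))).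
  by move=> _; exact: osc_integrable.
have d1 x (y : measurableTypeR R) : [set` `]k - 1, k + 1[%R] x -> setT y ->
    derivable (fun x : R => phi y * cos (x * y + b)) x 1.
  by move=> _ _; have [] := df x y.
have iG : leb.-integrable setT (EFin \o (fun y => `|y * phi y|)).
  exact: (integrable_normr (bump_class_integrable cX)).
have ub (x : R) (y : measurableTypeR R) : [set` `]k - 1, k + 1[%R] x -> setT y ->
    `|partial1of2 (fun x y => phi y * cos (x * y + b)) x y| <= `|y * phi y|.
  by move=> _ _; rewrite p1E normrM ler_piMr// cos_max.
have G0 (y : measurableTypeR R) : 0 <= `|y * phi y| by [].
split.
  exact: (derivable_under_integral measurableT kI i1 d1 G0 iG ub).
rewrite -derive1E (differentiation_under_integral measurableT kI i1 d1 G0 iG ub).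
by apply: eq_Rintegral => y _; rewrite p1E.
Qed.

(** Integration by parts: after the phase shift, the difference of the two integrands is the
    derivative of phi(y) sin(k y + b), which has no boundary terms. *)
Lemma osc_mul phi phi' b k : bump_class phi -> bump_class phi' ->
  (forall t : R, is_derive t 1 phi (phi' t)) ->
  k * osc phi b k = osc phi' (b + pi / 2) k.
Proof.
move=> cp cp' dp.
have i1 := osc_integrable b k cp; have i2 := osc_integrable (b + pi / 2) k cp'.
pose g y := k * (phi y * cos (k * y + b)) - phi' y * cos (k * y + (b + pi / 2)).
have ig : leb.-integrable setT (EFin \o (fun y => k * (phi y * cos (k * y + b)))).
  have := integrableZl measurableT k i1.
  by rewrite (_ : (fun x => _) = EFin \o (fun y => k * (phi y * cos (k * y + b))))//.
have cg : continuous g.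
  apply: smooth1_continuous; apply: smooth1D.
    apply: smooth1M; first exact: smooth1_cst.
    by apply: smooth1M; [exact: cp.1|exact: smooth1_cos].
  have : smooth1 (fun y => -1 * (phi' y * cos (k * y + (b + pi / 2)))).
    apply: smooth1M; first exact: smooth1_cst.
    by apply: smooth1M; [exact: cp'.1|exact: smooth1_cos].
  by congr smooth1; apply/funext => y; rewrite mulN1r.
(* The interval of integration is [-2, 2] because [bump_class] gives vanishing strictly beyond 1, so
   that the endpoints of [-1, 1] would not be covered. *)
have g0 x : 2 < `|x| -> g x = 0.
  by move=> x2; rewrite /g cp.2 ?cp'.2 ?mul0r ?mulr0 ?subr0//; lra.
have dG (x : R) : is_derive x 1 (fun y => phi y * sin (k * y + b)) (g x).
  have h : is_derive x 1 (sin \o (fun x => k * x + b)) (cos (k * x + b) * k).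
    by apply: is_derive1_comp; exact: is_derive_affine.
  have := is_deriveM (dp x) h.
  by rewrite /g addrA cosDpihalf /GRing.scale/=; congr is_derive; ring.
have int0 : \int[leb]_y g y = 0.
  have [_ ->] := @integrable_compact R g 2 cg g0.
  have lt2 : (-2 : R) < 2 by lra.
  rewrite /Rintegral (FTC2_derive lt2 cg dG) /= !(cp.2 _) ?mul0r ?subr0// ?normrN ger0_norm//; lra.
have : \int[leb]_y g y = k * osc phi b k - osc phi' (b + pi / 2) k.
  by rewrite /g RintegralB// RintegralZl.
by rewrite int0 => /esym/eqP; rewrite subr_eq0 => /eqP.
Qed.

Lemma schwartz1_osc phi b : bump_class phi -> schwartz1 (osc phi b).
Proof.
move=> cp; exists [set f | exists p c, bump_class p /\ f = osc p c]; first by exists phi, b.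
move=> _ [p [c [bp ->]]]; split.
- exact: osc_bounded.
- exists (osc (fun y => y * p y) (c + pi / 2)); last by move=> t; exact: osc_derive.
  by exists (fun y => y * p y), (c + pi / 2); split => //; exact: bump_classX.
- have [p' bp' dp'] := bump_class_derive bp.
  exists p', (c + pi / 2); split => //; apply/funext => k; exact: osc_mul.
Qed.

End oscillatory_integrals.

(** * Fourier inversion for the bump *)

Section fourier_inversion.
Context {R : realType}.
Notation leb := (@lebesgue_measure R).

Lemma Rintegral_odd (f : R -> R) : leb.-integrable setT (EFin \o f) ->
  (forall x, f (- x) = - f x) -> \int[leb]_x f x = 0.
Proof.
move=> fi fN; have n1 : -1 != 0 :> R by rewrite oppr_eq0 oner_eq0.
have [_ E] := integral_affine 0 n1 fi.
have {}E : \int[leb]_x f x = -1 * \int[leb]_x f x.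
  rewrite [LHS]E normrN1 mul1r -RintegralZl//; apply: eq_Rintegral => x _.
  by rewrite /affine addr0 mulN1r fN mulN1r.
lra.
Qed.

Lemma Rintegral_gt0 (f : R -> R) : continuous f -> leb.-integrable setT (EFin \o f) ->
  (forall x, 0 <= f x) -> 0 < f 0 -> 0 < \int[leb]_x f x.
Proof.
move=> cf fi f0 f00.
have /nbhs_ballP[e /= e0 he] : \forall x \near (0 : R), f 0 / 2 < f x.
  by apply: (cvgr_gt _ (cf 0)); lra.
pose e2 := e / 2.
have e20 : 0 < e2 by rewrite divr_gt0.
have sub : [set` `[- e2, e2]%R] `<=` [set: R] by [].
apply: (@lt_le_trans _ _ (\int[leb]_(x in `[- e2, e2]) f x)); last first.
  rewrite /Rintegral fine_le//.
  - by apply: integrable_fin_num => //; exact: integrableS fi.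
  - exact: integrable_fin_num.
  - apply: ge0_subset_integral => //; first exact: measurable_int fi.
    by move=> x _; rewrite lee_fin.
apply: (@lt_le_trans _ _ (\int[leb]_(x in `[- e2, e2]) (cst (f 0 / 2) x))).
  have e2N : - e2 < e2 by lra.
  have mI : leb [set` `[- e2, e2]%R] = (e2 - - e2)%:E by rewrite lebesgue_measure_itv/= lte_fin e2N.
  by rewrite Rintegral_cst// [X in fine X]mI /= mulr_gt0//; lra.
apply: le_Rintegral => //.
- apply: continuous_compact_integrable; first exact: segment_compact.
  by apply: continuous_subspaceT => x; exact: cst_continuous.
- exact: integrableS fi.
- move=> x /=; rewrite in_itv/= => /andP[x1 x2]; apply/ltW/he.
  by rewrite /ball/= sub0r normrN ltr_norml; rewrite /e2 in x1 x2; lra.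
Qed.

Definition bump_hat : R -> R := osc (@bump R) 0.

Lemma schwartz1_bump_hat : schwartz1 bump_hat.
Proof. exact: schwartz1_osc bump_class_bump. Qed.

Lemma continuous_bump_hat : continuous bump_hat.
Proof. exact: smooth1_continuous (schwartz1_smooth1 schwartz1_bump_hat). Qed.

Lemma bump_hatN k : bump_hat (- k) = bump_hat k.
Proof.
by apply: eq_Rintegral => y _; rewrite mulNr -cosN opprD opprK !addr0 oppr0 addr0.
Qed.

Lemma schwartz1_integrable (u : R -> R) : schwartz1 u -> leb.-integrable setT (EFin \o u).
Proof.
move=> su; have [C hC] := schwartz1_decay 2 su.
apply: (@integrable_le_inv1sqr R u C).
  exact: smooth1_continuous (schwartz1_smooth1 su).
move=> x; apply: le_trans (hC x); rewrite mulrC ler_wpM2r//.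
have -> : x ^+ 2 = `|x| ^+ 2 by rewrite -normrX ger0_norm// sqr_ge0.
by rewrite sqrrD expr1n mul1r; have := normr_ge0 x; lra.
Qed.

(** The constant of the inversion formula, left unevaluated; with the present convention it is 2
    pi. *)
Definition bump_mass : R := \int[leb]_k bump_hat k.

Let leb_int_bump := bump_class_integrable (@bump_class_bump R).
Let leb_int_hat := schwartz1_integrable schwartz1_bump_hat.

(** When the cosine of k s + k y is expanded, the sine part integrates to 0 because [bump] is
    even. *)
Lemma bump_hat_modulate (k y : R) :
  bump_hat k * cos (k * y) = \int[leb]_s (bump s * cos (k * (s + y))).
Proof.
have ic := osc_integrable 0 k (@bump_class_bump R).
have is_ := osc_integrable (- (pi / 2)) k (@bump_class_bump R).
have sE (s : R) : cos (k * s + - (pi / 2)) = sin (k * s).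
  by rewrite cosB cos_pihalf sin_pihalf mulr0 add0r mulr1.
have is' : leb.-integrable setT (EFin \o (fun s => bump s * sin (k * s))).
  move: is_; rewrite (_ : (fun y : R => bump y * cos (k * y + - (pi / 2))) = fun s => bump s * sin (k * s))//.
  by apply/funext => s; rewrite sE.
have ic' : leb.-integrable setT (EFin \o (fun s => bump s * cos (k * s))).
  move: ic; rewrite (_ : (fun y : R => bump y * cos (k * y + 0)) = fun s => bump s * cos (k * s))//.
  by apply/funext => s; rewrite addr0.
have s0 : \int[leb]_s (bump s * sin (k * s)) = 0.
  by apply: Rintegral_odd => // s; rewrite bumpN mulrN sinN mulrN.
have cE : bump_hat k = \int[leb]_s (bump s * cos (k * s)).
  by apply: eq_Rintegral => s _; rewrite addr0.
transitivity (\int[leb]_s (cos (k * y) * (bump s * cos (k * s)) - sin (k * y) * (bump s * sin (k * s)))); last first.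
  by apply: eq_Rintegral => s _; rewrite mulrDr cosD; ring.
have iZ (c : R) (g : R -> R) : leb.-integrable setT (EFin \o g) -> leb.-integrable setT (EFin \o (fun s => c * g s)).
  by move=> ig; exact: (integrableZl measurableT c ig).
rewrite RintegralB//; [|exact: (iZ _ _ ic')|exact: (iZ _ _ is')].
by rewrite !RintegralZl// s0 mulr0 subr0 -cE mulrC.
Qed.

Let mcosM (y : R) : measurable_fun setT
  (fun p : measurableTypeR R * measurableTypeR R => cos (p.1 * (p.2 + y))).
Proof.
apply: (@measurableT_comp _ _ _ _ _ _ (@cos R)).
  by apply: continuous_measurable_fun; exact: continuous_cos.
by apply: measurable_funM => //; apply: measurable_funD.
Qed.

(** The integral is regularized by bump(k / A). Fubini and [bump_hat_modulate] turn it into the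
    integral of bump(s) against A bump_hat(A (s + y)), an approximate identity at s = -y of total
    mass [bump_mass]; dominated convergence gives the limit on both sides. The regularizer is [bump]
    itself, so that its transform is again [bump_hat]. *)
Lemma fourier_inversion (y : R) : \int[leb]_k (bump_hat k * cos (k * y)) = bump_mass * bump y.
Proof.
pose A (n : nat) : R := n.+1%:R.
have A0 n : 0 < A n by rewrite ltr0n.
have AN n : A n != 0 by rewrite gt_eqF.
have cA (u : R) : (fun n => (A n)^-1 * u) @ \oo --> (0 : R).
  have : (fun n => (A n)^-1 * u) @ \oo --> 0 * u by apply: cvgM; [exact: cvg_harmonic|exact: cvg_cst].
  by rewrite mul0r.
have mcos (a b : R) : measurable_fun setT (fun k : measurableTypeR R => cos (a * k + b)).
  by apply: continuous_measurable_fun; apply: smooth1_continuous; exact: smooth1_cos.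
have mhat : measurable_fun setT (bump_hat : measurableTypeR R -> R).
  by apply: continuous_measurable_fun; exact: continuous_bump_hat.
have mbump a b : measurable_fun setT (fun k : measurableTypeR R => bump (a * k + b)).
  by apply: continuous_measurable_fun; apply: smooth1_continuous; apply: smooth1_comp_affine; exact: smooth1_bump.
have ihat : leb.-integrable setT (EFin \o (fun k => `|bump_hat k|)) by apply: (integrable_abse leb_int_hat).
have lim1 : (fun n => \int[leb]_k (bump ((A n)^-1 * k) * (bump_hat k * cos (k * y)))) @ \oo -->
    \int[leb]_k (bump_hat k * cos (k * y)).
  apply: (@Rintegral_dominated_cvg R _ _ (fun k => `|bump_hat k|)) => //.
  - move=> n; apply: measurable_funM.
      have := mbump (A n)^-1 0.
      by rewrite (_ : (fun k => bump (_ * k + 0)) = fun k => bump ((A n)^-1 * k))//; apply/funext => k; rewrite addr0.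
    apply: measurable_funM => //; have := mcos y 0.
    by rewrite (_ : (fun k => cos (y * k + 0)) = fun k => cos (k * y))//; apply/funext => k; rewrite addr0 mulrC.
  - move=> k; rewrite -[X in _ --> X]mul1r -(@bump0 R); apply: cvgM; last exact: cvg_cst.
    by apply: (cvg_comp _ _ (cA k)); exact: continuous_bump.
  - move=> n k; rewrite normrM (normrM (bump_hat k)); have /andP[b0 b1] := bump_itv ((A n)^-1 * k).
    rewrite (ger0_norm b0); apply: le_trans (ler_piMl _ b1) _; first exact: mulr_ge0.
    by rewrite ler_piMr// cos_max.
have lim2 : (fun n => \int[leb]_u (bump ((A n)^-1 * u - y) * bump_hat u)) @ \oo -->
    \int[leb]_u (bump (- y) * bump_hat u).
  apply: (@Rintegral_dominated_cvg R _ _ (fun k => `|bump_hat k|)) => //.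
  - by move=> n; apply: measurable_funM => //; exact: mbump.
  - move=> u; apply: cvgM; last exact: cvg_cst.
    have : (fun n => (A n)^-1 * u - y) @ \oo --> 0 - y by apply: cvgB; [exact: cA|exact: cvg_cst].
    by rewrite sub0r => c; apply: (cvg_comp _ _ c); exact: continuous_bump.
  - move=> n k; rewrite normrM; have /andP[b0 b1] := bump_itv ((A n)^-1 * k - y).
    by rewrite (ger0_norm b0) ler_piMl.
have key n : \int[leb]_k (bump ((A n)^-1 * k) * (bump_hat k * cos (k * y))) =
    \int[leb]_u (bump ((A n)^-1 * u - y) * bump_hat u).
  under eq_Rintegral do rewrite bump_hat_modulate.
  have [ib _] := @integral_affine R (A n)^-1 0 (@bump R) (invr_neq0 (AN n)) leb_int_bump.
  have ib' : leb.-integrable setT (EFin \o (fun k => bump ((A n)^-1 * k))).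
    move: ib; rewrite (_ : (fun x => _) = EFin \o (fun k => bump ((A n)^-1 * k)))//.
    by apply/funext => k; rewrite /affine/= addr0.
  rewrite (Rintegral_Fubini ib' leb_int_bump (mcosM y) (fun k s => cos_max (k * (s + y)))).
  have inner s : \int[leb]_k (bump ((A n)^-1 * k) * cos (k * (s + y))) = A n * bump_hat (A n * (s + y)).
    have i1 : leb.-integrable setT (EFin \o (fun k => bump ((A n)^-1 * k) * cos (k * (s + y)))).
      have mb' := measurable_int _ ib'.
      apply: le_integrable ib' => //.
        apply/measurable_EFinP; apply: measurable_funM; first exact/measurable_EFinP.
        have := mcos (s + y) 0.
        by rewrite (_ : (fun k => cos (_ * k + 0)) = fun k => cos (k * (s + y)))//; apply/funext => k; rewrite addr0 mulrC.
      by move=> k _ /=; rewrite lee_fin normrM ler_piMr// cos_max.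
    have [_ ->] := integral_affine 0 (AN n) i1.
    rewrite (gtr0_norm (A0 n)); congr (_ * _); apply: eq_Rintegral => r _.
    by rewrite /affine addr0 mulKf// addr0; congr (_ * cos _); ring.
  under eq_Rintegral do rewrite inner.
  have i2 : leb.-integrable setT (EFin \o (fun s => bump s * (A n * bump_hat (A n * (s + y))))).
    have [C hC] := osc_bounded 0 (@bump_class_bump R).
    apply: le_integrable (integrableZl measurableT (A n * C) leb_int_bump) => //.
      apply/measurable_EFinP; apply: measurable_funM.
        by apply/measurable_EFinP; exact: measurable_int leb_int_bump.
      apply: measurable_funM => //; apply: (measurableT_comp mhat).
      by apply: measurable_funM => //; exact: measurable_funD.
    move=> s _ /=; rewrite lee_fin normrM [leRHS]normrM mulrC ler_wpM2r//.
    rewrite normrM [leRHS]normrM ler_wpM2l//.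
    by apply: le_trans (ler_norm C); exact: hC.
  have iV := invr_neq0 (AN n).
  have [_ ->] := integral_affine (- y) iV i2.
  rewrite gtr0_norm ?invr_gt0// -RintegralZl//; last by have [] := integral_affine (- y) iV i2.
  apply: eq_Rintegral => u _; rewrite /affine subrK mulVKf//.
  by rewrite mulrCA mulKf.
have := lim1; under eq_fun do rewrite key.
move=> lim1'.
have -> := cvg_unique (@Rhausdorff R) lim1' lim2.
by rewrite RintegralZl// bumpN mulrC.
Qed.

(** One factor [bump_hat] is expanded through [bump_hat_modulate]; after Fubini, inversion applies
    to the other. The sine integral vanishes by parity. *)
Lemma fourier_bump_hat_sqr (x : R) :
  \int[leb]_k (bump_hat k ^+ 2 * cos (k * x)) = bump_mass * \int[leb]_t (bump t * bump (x + t)) /\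
  \int[leb]_k (bump_hat k ^+ 2 * sin (k * x)) = 0.
Proof.
have i2 : leb.-integrable setT (EFin \o (fun k => bump_hat k ^+ 2)).
  have := schwartz1_integrable (schwartz1M schwartz1_bump_hat schwartz1_bump_hat).
  by apply: eq_integrable => // k _; rewrite /= expr2.
split.
  transitivity (\int[leb]_k (bump_hat k * \int[leb]_t (bump t * cos (k * (t + x))))).
    by apply: eq_Rintegral => k _; rewrite -bump_hat_modulate mulrA expr2.
  rewrite (Rintegral_Fubini leb_int_hat leb_int_bump (mcosM x) (fun k s => cos_max (k * (s + x)))).
  under eq_Rintegral do rewrite fourier_inversion.
  have [C hC] := bump_class_bounded (@bump_class_bump R).
  rewrite -RintegralZl; [|exact: measurableT|].
    by apply: eq_Rintegral => t _; rewrite mulrCA [t + x]addrC.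
  have mb : measurable_fun setT (fun t : measurableTypeR R => bump t * bump (x + t)).
    apply: measurable_funM; first by apply/measurable_EFinP; exact: measurable_int leb_int_bump.
    apply: (@measurableT_comp _ _ _ _ _ _ (@bump R)).
      by apply: continuous_measurable_fun; exact: continuous_bump.
    exact: measurable_funD.
  apply: le_integrable (integrableZl measurableT C leb_int_bump) => //.
    exact/measurable_EFinP.
  move=> t _ /=; rewrite lee_fin normrM [leRHS]normrM mulrC ler_wpM2r//.
  by apply: le_trans (ler_norm C); exact: hC.
apply: Rintegral_odd.
  apply: le_integrable i2 => //.
    apply/measurable_EFinP; apply: measurable_funM.
      by apply: continuous_measurable_fun; apply: smooth1_continuous;
         apply/schwartz1_smooth1; have := schwartz1M schwartz1_bump_hat schwartz1_bump_hat; under eq_fun do rewrite -expr2.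
    apply: (@measurableT_comp _ _ _ _ _ _ (@sin R)).
      by apply: continuous_measurable_fun; exact: continuous_sin.
    exact: measurable_funM.
  by move=> k _ /=; rewrite lee_fin normrM ler_piMr// sin_max.
by move=> k; rewrite bump_hatN mulNr sinN mulrN.
Qed.

Lemma bump_hat0_gt0 : 0 < bump_hat 0.
Proof.
rewrite /bump_hat /osc.
rewrite (_ : (fun y => _) = fun y => bump y).
  apply: Rintegral_gt0 => //; [exact: continuous_bump|exact: bump_ge0|by rewrite bump0].
by apply/funext => y; rewrite mul0r addr0 cos0 mulr1.
Qed.

(** At x = 0 the preceding identity is of Plancherel type: the integral of the square of [bump_hat],
    which is positive, equals [bump_mass] times a nonnegative number. *)
Lemma bump_mass_gt0 : 0 < bump_mass.
Proof.
have [E _] := fourier_bump_hat_sqr 0.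
have i2 (u : R -> R) : leb.-integrable setT (EFin \o (fun k => u k * u k)) ->
    leb.-integrable setT (EFin \o (fun k => u k ^+ 2)).
  by apply: eq_integrable => // k _; rewrite /= expr2.
have p1 : 0 < \int[leb]_k (bump_hat k ^+ 2 * cos (k * 0)).
  rewrite (_ : (fun k => _) = fun k => bump_hat k * bump_hat k); last first.
    by apply/funext => k; rewrite mulr0 cos0 mulr1 expr2.
  apply: Rintegral_gt0.
  - exact: smooth1_continuous (schwartz1_smooth1 (schwartz1M schwartz1_bump_hat schwartz1_bump_hat)).
  - exact: schwartz1_integrable (schwartz1M schwartz1_bump_hat schwartz1_bump_hat).
  - by move=> k; rewrite -expr2 sqr_ge0.
  - by rewrite mulr_gt0 ?bump_hat0_gt0.
have p2 : 0 <= \int[leb]_t (bump t * bump (0 + t)).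
  by apply: Rintegral_ge0 => t _; rewrite mulr_ge0 ?bump_ge0.
move: p1; rewrite E; move: p2; rewrite le_eqVlt => /predU1P[<-|p2]; first by rewrite mulr0 ltxx.
by rewrite pmulr_lgt0.
Qed.

End fourier_inversion.

(** * Vanishing variance in Euclidean space *)

Section products_of_schwartz_functions.
Context {R : realType} {d : nat}.

Definition prodf (u : 'I_d -> R -> R) (x : 'rV[R]_d) : R := \prod_j u j (x 0 j).

Lemma smooth_alg_prodf u : (forall j, smooth1 (u j)) -> smooth_alg (prodf u).
Proof. by move=> su; apply: smooth_alg_prod => j; exact: smooth_alg_coord. Qed.

(** A partial derivative falls on a single factor, so products of one-variable Schwartz functions
    are stable under differentiation. *)
Lemma prodf_derive u i : (forall j, schwartz1 (u j)) -> exists2 u',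
  forall j, schwartz1 (u' j) & 'D_(delta_mx 0 i : 'rV[R]_d) (prodf u) = prodf u'.
Proof.
move=> su; have [_ [g sg dg] _] := schwartz1P (su i).
exists (fun j => if j == i then g else u j) => [j|]; first by case: ifP.
have sm j : smooth1 (u j) by exact: schwartz1_smooth1.
pose G (x : 'rV[R]_d) := \prod_(j | j != i) u j (x 0 j).
have aG : smooth_alg G.
  have : smooth_alg (prodf (fun j => if j != i then u j else fun=> 1)).
    by apply: smooth_alg_prodf => j; case: ifP => // _; exact: smooth1_cst.
  congr smooth_alg; apply/funext => x; rewrite /G big_mkcond/=.
  by apply: eq_bigr => j _; case: ifP.
have au : smooth_alg (fun x : 'rV[R]_d => u i (x 0 i)) by exact: smooth_alg_coord.
apply/funext => x.
have -> : prodf u = (fun x : 'rV[R]_d => u i (x 0 i)) * G.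
  by apply/funext => y; rewrite /prodf (bigD1 i).
rewrite deriveM; last 2 first.
- by apply: diff_derivable; exact: (smooth_alg_derive au).1.
- by apply: diff_derivable; exact: (smooth_alg_derive aG).1.
have -> : 'D_(delta_mx 0 i : 'rV[R]_d) G x = 0.
  rewrite /derive (_ : (fun h => _) = fun=> 0); first exact: lim_cst.
  apply/funext => h; rewrite (_ : (G \o shift x) _ = G x) ?subrr ?scaler0//.
  apply: eq_bigr => j ji; rewrite !mxE (negbTE ji) andbF.
  by rewrite /GRing.scale/= mulr0 add0r.
have -> : 'D_(delta_mx 0 i : 'rV[R]_d) (fun x : 'rV[R]_d => u i (x 0 i)) x = g (x 0 i).
  have := @ridge_derive R d (u i) _ (delta_mx 0 i) x 0 (dg _).
  rewrite dotp_delta addr0 => -[_ /(_ (delta_mx 0 i))].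
  rewrite dotp_delta mxE !eqxx mul1r => <-; congr ('D__ _ x).
  by apply/funext => y; rewrite dotp_delta addr0.
rewrite scaler0 add0r /GRing.scale/= /prodf (bigD1 i)//= eqxx mulrC; congr (_ * _).
by apply: eq_bigr => j ji; rewrite (negbTE ji).
Qed.

Lemma prodf_pderiv s u : (forall j, schwartz1 (u j)) -> exists2 u',
  forall j, schwartz1 (u' j) & pderiv s (prodf u) = prodf u'.
Proof.
elim: s u => [|i s IH] u su; first by exists u.
have [v sv E] := IH u su; have [w sw F] := prodf_derive i sv.
by exists w => //; rewrite /= -F -E.
Qed.

(** Expanding the product yields at least 1 + sum |x_j|, which dominates the sup norm. Decay in each
    coordinate thus becomes decay in the norm. *)
Lemma one_norm_le_prod (x : 'rV[R]_d) : 1 + `|x| <= \prod_j (1 + `|x 0 j|).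
Proof.
have h : 1 + \sum_j `|x 0 j| <= \prod_j (1 + `|x 0 j|).
  elim: (index_enum _) => [|j r IH]; first by rewrite !big_nil addr0.
  rewrite !big_cons; apply: (@le_trans _ _ ((1 + `|x 0 j|) * (1 + \sum_(i <- r) `|x 0 i|))).
    have p0 : 0 <= \sum_(i <- r) `|x 0 i| by apply: sumr_ge0.
    by have := mulr_ge0 (normr_ge0 (x 0 j)) p0; lra.
  by rewrite ler_wpM2l// addr_ge0.
apply: le_trans h; rewrite lerD2l {1}/Num.Def.normr/= mx_normrE.
apply: bigmax_le => [|[i j] _]; first exact: sumr_ge0.
by rewrite ord1 (bigD1 j)//= lerDl sumr_ge0.
Qed.

Lemma prodf_decay N u : (forall j, schwartz1 (u j)) ->
  exists C : R, forall x, (1 + `|x|) ^+ N * `|prodf u x| <= C.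
Proof.
move=> su; have /choice[C hC] j := schwartz1_decay N (su j).
exists (\prod_j C j) => x; rewrite normr_prod.
apply: (@le_trans _ _ (\prod_j ((1 + `|x 0 j|) ^+ N * `|u j (x 0 j)|))); last first.
  by apply: ler_prod => j _; rewrite hC andbT mulr_ge0// exprn_ge0// addr_ge0.
rewrite big_split/= ler_wpM2r//; first exact: prodr_ge0.
rewrite prodrXl; apply: lerXn2r; rewrite ?nnegrE ?addr_ge0 ?prodr_ge0//.
exact: one_norm_le_prod.
Qed.

Lemma pderiv0 (s : seq 'I_d) : pderiv s (fun=> 0 : R) = fun=> 0.
Proof.
elim: s => //= i s ->; apply/funext => x; exact: derive_cst.
Qed.

Lemma schwartz_prodf u : (forall j, schwartz1 (u j)) ->
  schwartz (fun x => (prodf u x)%:C%C).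
Proof.
move=> su; have sa := smooth_alg_prodf (fun j => schwartz1_smooth1 (su j)).
split; first by apply: smooth_algW => //; exact: smooth_alg_cst.
move=> N.
have /choice[C hC] (s : seq 'I_d) : exists C : R, forall x, (1 + `|x|) ^+ N * `|pderiv s (prodf u) x| <= C.
  by have [v sv ->] := prodf_pderiv s su; exact: prodf_decay.
have C0 s : 0 <= C s by apply: le_trans (hC s 0); rewrite mulr_ge0// exprn_ge0// addr_ge0.
(* One constant must serve all words of at most N letters; there are finitely many, so their
   nonnegative constants are added. *)
exists (\sum_(n < N.+1) \sum_(t : n.-tuple 'I_d) C t) => s sN x; split.
  apply: le_trans (hC s x) _.
  rewrite (bigD1 (Ordinal (sN : size s < N.+1)%N))//= (bigD1 (in_tuple s))//= -addrA lerDl addr_ge0// ?sumr_ge0//.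
  by move=> n _; exact: sumr_ge0.
rewrite pderiv0 normr0 mulr0; apply: sumr_ge0 => n _; exact: sumr_ge0.
Qed.

End products_of_schwartz_functions.

Section windows.
Context {R : realType}.
Notation leb := (@lebesgue_measure R).

Lemma cintegral_real_mul (f : R -> R) (z : R[i]) : leb.-integrable setT (EFin \o f) ->
  cintegrable leb (fun t : measurableTypeR R => (f t)%:C%C * z) /\
  cintegral leb setT (fun t : measurableTypeR R => (f t)%:C%C * z) = (\int[leb]_t f t)%:C%C * z.
Proof.
move=> fi.
have cf : cintegrable leb (fun t : measurableTypeR R => (f t)%:C%C).
  by split=> //; exact: integrable0.
have c0 := cintegrable0 (@lebesgue_measure R).
have [h1 h2] := cintegral_lin z cf c0.
have E : (fun t : measurableTypeR R => z * (f t)%:C%C + 0) = fun t => (f t)%:C%C * z.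
  by apply/funext => t; rewrite addr0 mulrC.
rewrite E in h1 h2; split => //; rewrite h2 cintegral0 addr0 mulrC; congr (_ * _).
by rewrite /cintegral/= integral0.
Qed.

(* Normalized so that its Fourier transform is the autocorrelation of
   bump (_ / l). *)
Definition window (l k : R) : R := bump_mass^-1 * (l * bump_hat (l * k)) ^+ 2.

Definition autocorrelation (l x : R) : R := \int[leb]_t (bump (l^-1 * (x + t)) * bump (l^-1 * t)).

Lemma schwartz1_window (l b : R) : l != 0 -> schwartz1 (fun k => window l (k + b)).
Proof.
move=> l0.
have h := schwartz1_comp_affine (l * b) l0 (schwartz1M (@schwartz1_bump_hat R) schwartz1_bump_hat).
have := schwartz1Z (bump_mass^-1 * l ^+ 2) h.
congr schwartz1; apply/funext => k; rewrite /window -mulrDr exprMn; ring.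
Qed.

Lemma window_ge0 l k : 0 <= window l k.
Proof. by rewrite mulr_ge0 ?sqr_ge0// invr_ge0 ltW// bump_mass_gt0. Qed.

(** The substitution of k / l for k reduces the claim to [fourier_bump_hat_sqr], and that of t / l
    restores the scale in the autocorrelation. *)
Lemma fourier_window (l x : R) : 0 < l ->
  \int[leb]_k (window l k * cos (x * k)) = autocorrelation l x /\
  \int[leb]_k (window l k * sin (x * k)) = 0.
Proof.
move=> l0; have ln0 : l != 0 by rewrite gt_eqF.
have c0 : bump_mass != 0 :> R by rewrite gt_eqF// bump_mass_gt0.
have isw : schwartz1 (window l).
  by have := schwartz1_window 0 ln0; congr schwartz1; apply/funext => k; rewrite addr0.
have iw := schwartz1_integrable isw.
have mw : measurable_fun setT (window l : measurableTypeR R -> R).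
  by apply/measurable_EFinP; exact: measurable_int iw.
have itrig (t : R -> R) : continuous t -> (forall y, `|t y| <= 1) ->
    leb.-integrable setT (EFin \o (fun k => window l k * t (x * k))).
  move=> ct t1; apply: le_integrable iw => //.
    apply/measurable_EFinP; apply: measurable_funM => //.
    apply: (measurableT_comp (f := t)); first exact: continuous_measurable_fun.
    exact: measurable_funM.
  by move=> k _ /=; rewrite lee_fin normrM ler_piMr.
split; last first.
  apply: Rintegral_odd; first by apply: itrig; [exact: continuous_sin|exact: sin_max].
  by move=> k; rewrite /window !mulrN bump_hatN sinN !mulrN.
have li := invr_neq0 ln0.
have ic := itrig cos (@continuous_cos R) (@cos_max R).
have [_ ->] := integral_affine 0 li ic.
have [E _] := fourier_bump_hat_sqr (l^-1 * x).
have i3 : leb.-integrable setT (EFin \o (fun k => bump_hat k ^+ 2 * cos (k * (l^-1 * x)))).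
  have ib := schwartz1_integrable (schwartz1M (@schwartz1_bump_hat R) schwartz1_bump_hat).
  have mb := measurable_int _ ib.
  apply: le_integrable ib => //.
    apply/measurable_EFinP; apply: measurable_funM.
      by move/measurable_EFinP : mb; rewrite (_ : (fun t => _) = fun t => bump_hat t ^+ 2)//; apply/funext => t; rewrite expr2.
    apply: (measurableT_comp (f := @cos R)); first by apply: continuous_measurable_fun; exact: continuous_cos.
    exact: measurable_funM.
  by move=> k _ /=; rewrite lee_fin normrM expr2 ler_piMr// cos_max.
transitivity (l * (bump_mass^-1 * \int[leb]_k (bump_hat k ^+ 2 * cos (k * (l^-1 * x))))).
  have [i4 _] := integral_affine 0 li ic.
  rewrite gtr0_norm ?invr_gt0// -[LHS]RintegralZl; [|exact: measurableT|exact: i4].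
  rewrite -[X in _ = _ * X]RintegralZl; [|exact: measurableT|exact: i3].
  rewrite -[RHS]RintegralZl; [|exact: measurableT|]; last first.
    by have := integrableZl measurableT (bump_mass^-1) i3.
  apply: eq_Rintegral => k _; rewrite /window /affine addr0 mulVKf// exprMn.
  rewrite [x * _]mulrCA [k * _]mulrCA [x * k]mulrC; field; exact/andP.
rewrite E (mulKf c0).
have ib : leb.-integrable setT (EFin \o (fun t : R => bump t * bump (l^-1 * x + t))).
  have mb := measurable_int _ (bump_class_integrable (@bump_class_bump R)).
  apply: le_integrable (bump_class_integrable (@bump_class_bump R)) => //.
    apply/measurable_EFinP; apply: measurable_funM; first exact/measurable_EFinP.
    apply: (measurableT_comp (f := @bump R)); first by apply: continuous_measurable_fun; exact: continuous_bump.
    exact: measurable_funD.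
  move=> t _ /=; rewrite lee_fin normrM ler_piMr//.
  by have /andP[b0 b1] := bump_itv (l^-1 * x + t); rewrite ger0_norm.
have [i5 E5] := integral_affine 0 li ib.
have li0 : 0 < l^-1 by rewrite invr_gt0.
rewrite E5 (gtr0_norm li0) (mulVKf ln0).
by apply: eq_Rintegral => t _; rewrite /affine addr0 -mulrDr mulrC.
Qed.

(** Translating the window by b multiplies its transform by exp(i b x); in real terms this is the
    addition formula for cosine and sine. *)
Lemma cintegral_window (l b x : R) : 0 < l ->
  cintegrable leb (fun k : measurableTypeR R => (window l (k + b))%:C%C * expi (- (k * x))) /\
  cintegral leb setT (fun k : measurableTypeR R => (window l (k + b))%:C%C * expi (- (k * x))) =
    (autocorrelation l x)%:C%C * expi (b * x).
Proof.
move=> l0; have ln0 : l != 0 by rewrite gt_eqF.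
have [Ec Es] := fourier_window x l0.
have iw := schwartz1_integrable (schwartz1_window b ln0).
have mb := measurable_int _ iw.
have itrig (t : R -> R) : continuous t -> (forall y, `|t y| <= 1) ->
    leb.-integrable setT (EFin \o (fun k => window l (k + b) * t (x * k))).
  move=> ct t1; apply: le_integrable iw => //.
    apply/measurable_EFinP; apply: measurable_funM; first exact/measurable_EFinP.
    apply: (measurableT_comp (f := t)); first exact: continuous_measurable_fun.
    exact: measurable_funM.
  by move=> k _ /=; rewrite lee_fin normrM ler_piMr.
have ic := itrig cos (@continuous_cos R) (@cos_max R).
have is_ := itrig sin (@continuous_sin R) (@sin_max R).
have isw : schwartz1 (window l).
  by have := schwartz1_window 0 ln0; congr schwartz1; apply/funext => k; rewrite addr0.
have iw0 := schwartz1_integrable isw.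
have mw0 := measurable_int _ iw0.
have itrig0 (t : R -> R) : continuous t -> (forall y, `|t y| <= 1) ->
    leb.-integrable setT (EFin \o (fun k => window l k * t (x * k))).
  move=> ct t1; apply: le_integrable iw0 => //.
    apply/measurable_EFinP; apply: measurable_funM; first exact/measurable_EFinP.
    apply: (measurableT_comp (f := t)); first exact: continuous_measurable_fun.
    exact: measurable_funM.
  by move=> k _ /=; rewrite lee_fin normrM ler_piMr.
have ic0 := itrig0 cos (@continuous_cos R) (@cos_max R).
have is0 := itrig0 sin (@continuous_sin R) (@sin_max R).
have reE (k : measurableTypeR R) : complex.Re ((window l (k + b))%:C%C * expi (- (k * x))) =
    window l (k + b) * cos (x * k) by rewrite /= mul0r subr0 cosN mulrC [x * k]mulrC mulrC.
have imE (k : measurableTypeR R) : complex.Im ((window l (k + b))%:C%C * expi (- (k * x))) =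
    -1 * (window l (k + b) * sin (x * k)) by rewrite /= mul0r addr0 sinN mulrN mulN1r [x * k]mulrC.
have is1 : leb.-integrable setT (fun k : measurableTypeR R => (-1 * (window l (k + b) * sin (x * k)))%:E).
  by have := integrableZl measurableT (-1) is_.
split.
  split; first by move: ic; congr (integrable _ _ _); apply/funext => k; rewrite reE.
  by move: is1; congr (integrable _ _ _); apply/funext => k; rewrite imE.
have n1 : 1 != 0 :> R by exact: oner_neq0.
have [_ Ac] := integral_affine (- b) n1 ic.
have [_ As] := integral_affine (- b) n1 is_.
have sh (t t1 t2 : R -> R) (c1 c2 : R) : leb.-integrable setT (EFin \o (fun k => window l k * t1 (x * k))) ->
    leb.-integrable setT (EFin \o (fun k => window l k * t2 (x * k))) ->
    (forall k, t (x * (k - b)) = c1 * t1 (x * k) + c2 * t2 (x * k)) ->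
    \int[leb]_k (window l (affine 1 (- b) k + b) * t (x * affine 1 (- b) k)) =
    c1 * \int[leb]_k (window l k * t1 (x * k)) + c2 * \int[leb]_k (window l k * t2 (x * k)).
  move=> i1 i2 tE; rewrite -RintegralZl; [|exact: measurableT|exact: i1].
  rewrite -RintegralZl; [|exact: measurableT|exact: i2].
  rewrite -RintegralD; [|exact: measurableT|exact: (integrableZl measurableT c1 i1)|exact: (integrableZl measurableT c2 i2)].
  by apply: eq_Rintegral => k _; rewrite /affine mul1r subrK tE; ring.
have Ec' : \int[leb]_k (window l (k + b) * cos (x * k)) = autocorrelation l x * cos (b * x).
  rewrite Ac normr1 mul1r (sh cos cos sin (cos (b * x)) (sin (b * x)) ic0 is0).
    by rewrite Ec Es mulr0 addr0 mulrC.
  by move=> k; rewrite mulrBr cosB [x * b]mulrC; ring.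
have Es' : \int[leb]_k (window l (k + b) * sin (x * k)) = - (autocorrelation l x * sin (b * x)).
  rewrite As normr1 mul1r (sh sin sin cos (cos (b * x)) (- sin (b * x)) is0 ic0).
    by rewrite Ec Es mulr0 add0r mulNr mulrC.
  by move=> k; rewrite mulrBr sinB [x * b]mulrC; ring.
apply/eqP; rewrite eq_complex /cintegral; apply/andP; split; apply/eqP.
  rewrite [RHS]/= mul0r subr0 -Ec'; apply: eq_Rintegral => k _; exact: reE.
rewrite [RHS]/= mul0r addr0 -[RHS]opprK -Es' -mulN1r -RintegralZl; [|exact: measurableT|exact: is_].
by apply: eq_Rintegral => k _; exact: imE.
Qed.

End windows.

(** * Wave packets and their spectral windows *)

Section test_waves.
Context {R : realType} {d : nat}.
Variables (l : R) (b : 'rV[R]_d).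
Hypothesis l0 : 0 < l.

Definition wave_packet (x : 'rV[R]_d) : R[i] :=
  (\prod_j bump (l^-1 * x 0 j))%:C%C * expi (dotp b x).

Definition spectral_window (k : 'rV[R]_d) : R := \prod_j window l (k 0 j + b 0 j).

Lemma schwartz_spectral_window : schwartz (fun k => (spectral_window k)%:C%C).
Proof.
apply: (@schwartz_prodf R d (fun j k => window l (k + b 0 j))) => j.
by apply: schwartz1_window; rewrite gt_eqF.
Qed.

Lemma smooth_wave_packet : smooth wave_packet.
Proof.
have [h1 h2] : smooth_alg (fun x => complex.Re (wave_packet x)) /\
    smooth_alg (fun x => complex.Im (wave_packet x)); last exact: smooth_algW.
apply: smooth_alg_re_im_mul.
  split; last exact: smooth_alg_cst.
  apply: smooth_alg_prod => j.
  have := smooth_alg_coord j (smooth1_comp_affine l^-1 0 (@smooth1_bump R)).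
  by congr smooth_alg; apply/funext => x; rewrite addr0.
have [h1 h2] := smooth_alg_wave b 0.
by split; [move: h1|move: h2]; congr smooth_alg; apply/funext => x; rewrite addr0.
Qed.

Lemma wave_packet_out (x : 'rV[R]_d) j : l <= `|x 0 j| -> wave_packet x = 0.
Proof.
move=> lx; rewrite /wave_packet (bigD1 j)//= bump_out ?mul0r ?mul0r//.
by rewrite normrM gtr0_norm ?invr_gt0// ler_pdivlMl// mulr1.
Qed.

Lemma test_function_wave_packet : test_function wave_packet.
Proof.
split; first exact: smooth_wave_packet.
exists l; split; first exact: num_real.
move=> r lr x /= /eqP nz; rewrite {1}/Num.Def.normr/= mx_normrE.
apply: bigmax_le => [|[i j] _]; first by rewrite ltW// (lt_trans l0).
rewrite ord1 /= leNgt; apply/negP => rx; apply: nz; apply: (@wave_packet_out _ j).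
by rewrite ltW// (lt_trans lr).
Qed.

Lemma wave_packet_le1 x : `|complex.Re (wave_packet x)| <= 1 /\ `|complex.Im (wave_packet x)| <= 1.
Proof.
have /andP[p0 p1] : 0 <= (\prod_j bump (l^-1 * x 0 j) : R) <= 1.
  rewrite prodr_ge0 => [|j _]; last exact: bump_ge0.
  by apply: prodr_ile1 => j _; exact: bump_itv.
have [e1 e2] := expi_le1 (dotp b x).
rewrite /wave_packet; move: e1 e2; case: (expi _) => y z /= e1 e2.
by rewrite !mul0r subr0 addr0 !normrM (ger0_norm p0); split; rewrite mulr_ile1.
Qed.

Lemma autocorrelation_integrable (y : R) :
  (@lebesgue_measure R).-integrable setT (EFin \o (fun t => bump (l^-1 * (y + t)) * bump (l^-1 * t))).
Proof.
have c1 : continuous (fun t : R => bump (l^-1 * (y + t)) * bump (l^-1 * t)).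
  apply: smooth1_continuous; apply: smooth1M.
    have := smooth1_comp_affine l^-1 (l^-1 * y) (@smooth1_bump R).
    by congr smooth1; apply/funext => t; rewrite mulrDr addrC.
  have := smooth1_comp_affine l^-1 0 (@smooth1_bump R).
  by congr smooth1; apply/funext => t; rewrite addr0.
have h0 t : l < `|t| -> bump (l^-1 * (y + t)) * bump (l^-1 * t) = 0.
  move=> lt; rewrite [X in _ * X]bump_out ?mulr0//.
  by rewrite normrM gtr0_norm ?invr_gt0// ler_pdivlMl// mulr1 ltW.
by have [] := integrable_compact c1 h0.
Qed.

(** The covariance of a packet with itself is [beta] of its correlation, whereas S is accessible
    only through [beta] of Fourier transforms of Schwartz functions; this identity joins the two.
    Both sides factor over coordinates. *)
Lemma correlation_wave_packet :
  correlation wave_packet wave_packet = fourier (fun k => (spectral_window k)%:C%C).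
Proof.
apply/funext => x.
have iw j := autocorrelation_integrable (x 0 j).
have cw j := cintegral_real_mul (expi (b 0 j * x 0 j)) (iw j).
have [_ E1] := cintegral_lebesgue_prod (fun j => (cw j).1).
have cf j := cintegral_window (b 0 j) (x 0 j) l0.
have [_ E2] := cintegral_lebesgue_prod (fun j => (cf j).1).
transitivity (\prod_j ((autocorrelation l (x 0 j))%:C%C * expi (b 0 j * x 0 j))); last first.
  rewrite /fourier (eq_bigr _ (fun j _ => esym (cf j).2)) -E2; congr (cintegral _ _ _).
  apply/funext => k; rewrite /spectral_window big_split/= rmorph_prod; congr (_ * _).
  by rewrite -expi_sum; congr expi; rewrite /dotp -sumrN; apply: eq_bigr => j _; rewrite mulrC.
rewrite /correlation (eq_bigr _ (fun j _ => esym (cw j).2)) -E1; congr (cintegral _ _ _).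
apply/funext => t.
have conjE : ((wave_packet t)^*)%C = (\prod_j bump (l^-1 * t 0 j))%:C%C * expi (- dotp b t).
  apply/eqP; rewrite /wave_packet eq_complex /= cosN sinN.
  by apply/andP; split; apply/eqP; ring.
rewrite -[X in _ * X = _]/(((wave_packet t)^*)%C) conjE /wave_packet [RHS]big_split/= -[in RHS]rmorph_prod -expi_sum mulrACA -expiD.
rewrite linearD/= addrK -rmorphM; congr (_ %:C * _)%C.
by rewrite -big_split; apply: eq_bigr => j _; rewrite mxE.
Qed.

End test_waves.

Section spectral_growth.
Context {R : realType} {d : nat} {disp} {Omega : measurableType disp}.
Variables (P : probability Omega R) (Xi : Omega -> cmeasR R d).
Variables (beta : ('rV[R]_d -> R[i]) -> R[i]) (S : {measure set (euclid R d) -> \bar R}).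
Hypotheses (mXi : measurable_fun setT Xi) (P2 : second_order P Xi).
Hypotheses (Hbeta : covariance_functionalR P Xi beta) (HS : structure_functionR beta S).

Lemma measurable_euclid_continuous (f : 'rV[R]_d -> R) : continuous f ->
  measurable_fun [set: euclid R d] f.
Proof.
move=> cf; apply: (@measurability _ _ (euclid R d) (measurableTypeR R) setT _ (RGenOpens.G (R:=R))).
  exact: RGenOpens.measurableE.
move=> _ [_ [a [b ->]] <-]; rewrite setTI; apply: sub_gen_smallest.
by apply: open_comp; [move=> x _; exact: cf|exact: interval_open].
Qed.

Definition cube (r : R) : set (euclid R d) := [set x : 'rV[R]_d | forall j, `|x 0 j| <= r].

Lemma measurable_cube r : measurable (cube r).
Proof.
rewrite (_ : cube r = \bigcap_(j : 'I_d) (fun x : 'rV[R]_d => x 0 j) @^-1` `[- r, r]).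
  rewrite -[X in measurable X]setCK setC_bigcap; apply: measurableC.
  apply: countable_bigcupT_measurable => // j; apply: measurableC.
  by rewrite -[X in measurable X]setTI; apply: measurable_coord.
apply/seteqP; split => x /= h; first by move=> j _; rewrite /= in_itv/= -ler_norml.
by move=> j; have := h j I; rewrite /= in_itv/= -ler_norml.
Qed.

Lemma bounded_cube r : boundedR (cube r).
Proof.
exists `|r|; split; first exact: num_real.
move=> s rs x hx; rewrite /Num.Def.normr/= mx_normrE.
apply: bigmax_le => [|[i j] _]; first by rewrite ltW// (le_lt_trans _ rs).
by rewrite ord1 /= (le_trans (hx j))// (le_trans (ler_norm r))// ltW.
Qed.

Lemma wave_packet_bounded (l : R) (b : 'rV[R]_d) : 0 < l ->
  cbounded_supported (cube l) (wave_packet l b : euclid R d -> R[i]).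
Proof.
move=> l0; have sm := smooth_wave_packet l b.
have c1 : continuous (fun x => complex.Re (wave_packet l b x)).
  by move=> x; apply: differentiable_continuous; exact: (sm [::] x).1.
have c2 : continuous (fun x => complex.Im (wave_packet l b x)).
  by move=> x; apply: differentiable_continuous; exact: (sm [::] x).2.
have out x : ~ cube l x -> wave_packet l b x = 0.
  move=> nc; have [j hj] : exists j, ~~ (`|(x : 'rV[R]_d) 0 j| <= l).
    by apply/not_existsP => q; apply: nc => j; apply/negPn/negP; exact: q.
  by apply: (@wave_packet_out R d l b l0 x j); rewrite ltW// ltNge.
split; split.
- exact: measurable_euclid_continuous.
- by exists 1 => x; have [] := wave_packet_le1 l b x.
- by move=> x /out ->.
- exact: measurable_euclid_continuous.
- by exists 1 => x; have [] := wave_packet_le1 l b x.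
- by move=> x /out ->.
Qed.

Let variance l b := complex.Re (ccovariance P (fun w => lfc_integral (Xi w) (wave_packet l b))
    (fun w => lfc_integral (Xi w) (wave_packet l b))).

Lemma wave_packet_variance (l : R) (b : 'rV[R]_d) : 0 < l ->
  S.-integrable setT (fun k : euclid R d => (spectral_window l b k)%:E) /\
  variance l b = fine (\int[S]_k (spectral_window l b k)%:E)%E.
Proof.
move=> l0; have tw := test_function_wave_packet b l0.
have [[i1 _] E] := HS (schwartz_spectral_window b l0).
split => //; rewrite /variance Hbeta.2// correlation_wave_packet// -E.
by [].
Qed.

Lemma spectral_window_ge0 (l : R) (b k : 'rV[R]_d) : 0 <= spectral_window l b k.
Proof. by apply: prodr_ge0 => j _; exact: window_ge0. Qed.

(** Packets with l = 2^-n all live in [cube 1], so their variances share one bound V. The window is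
    at least c l^2 per coordinate on the cube of radius e / l, and the variance identity bounds the
    S-measure of that cube by V / (c l^2)^d. *)
Lemma structure_function_cube : exists2 e : R, 0 < e & exists M : R, 0 <= M /\
  forall n : nat, (S (cube (2 ^+ n * e)) <= (M * (2 ^+ n) ^+ d.*2)%:E)%E.
Proof.
have h0 := @bump_hat0_gt0 R; set h := bump_hat 0 in h0.
have /nbhs_ballP[e0 /= e00 he0] : \forall t \near (0 : R), h / 2 < bump_hat t.
  by apply: (cvgr_gt _ (@continuous_bump_hat R 0)); rewrite -/h; lra.
have mass0 := @bump_mass_gt0 R.
pose e := e0 / 2; have e_gt0 : 0 < e by rewrite divr_gt0.
have he t : `|t| <= e -> h / 2 <= bump_hat t.
  by move=> te; apply/ltW/he0; rewrite /ball/= sub0r normrN (le_lt_trans te)// /e; lra.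
pose c := bump_mass^-1 * (h / 2) ^+ 2.
have c0 : 0 < c by rewrite mulr_gt0 ?invr_gt0// exprn_gt0// divr_gt0.
(* The bound of [linear_statistic_variance] with C = 1, for integrands supported in [cube 1]. *)
pose V := 32 * 1 ^+ 2 * fine (\int[P]_w (Defs.total_variation (Xi w) (cube 1) ^+ 2))%E.
exists e => //; exists (V * c^-1 ^+ d).
have bound n : (S (cube (2 ^+ n * e)) <= (V * c^-1 ^+ d * (2 ^+ n) ^+ d.*2)%:E)%E /\ 0 <= V.
  pose l : R := (2 ^+ n)^-1.
  have p2 : 0 < 2 ^+ n :> R by rewrite exprn_gt0.
  have l0 : 0 < l by rewrite invr_gt0.
  have l1 : l <= 1 by rewrite invf_le1// exprn_ege1// ler1n.
  have [ii Ev] := wave_packet_variance 0 l0.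
  have bw : cbounded_supported (cube 1) (wave_packet l 0 : euclid R d -> R[i]).
    have [b1 b2] := wave_packet_bounded 0 l0.
    have sub : cube l `<=` cube 1 by move=> x hx j; exact: le_trans (hx j) l1.
    by split; [exact: bounded_supportedS sub b1|exact: bounded_supportedS sub b2].
  have [_ [_ v0 vV]] := linear_statistic_variance bornologyR mXi P2 (measurable_cube 1) (bounded_cube 1)
     bw ltr01 (wave_packet_le1 l 0).
  have low k : cube (2 ^+ n * e) k -> (c * l ^+ 2) ^+ d <= spectral_window l 0 k.
    move=> hk; rewrite /spectral_window -[X in _ ^+ X]card_ord -prodr_const.
    apply: ler_prod => j _; rewrite mulr_ge0 ?(ltW c0) ?sqr_ge0//= mxE addr0 /window.
    rewrite /c -mulrA ler_wpM2l ?invr_ge0 ?(ltW mass0)// -exprMn [h / 2 * l]mulrC.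
    have hh : h / 2 <= bump_hat (l * k 0 j).
      by apply: he; rewrite normrM (gtr0_norm l0) ler_pdivrMl//; exact: hk.
    apply: lerXn2r; rewrite ?nnegrE ?mulr_ge0 ?(ltW l0) ?ler_wpM2l ?(ltW l0)//; lra.
  have mc := measurable_cube (2 ^+ n * e).
  have le1 : (((c * l ^+ 2) ^+ d)%:E * S (cube (2 ^+ n * e)) <= (variance l 0)%:E)%E.
    rewrite Ev fineK; last exact: integrable_fin_num.
    rewrite -integral_cst//; apply: (@le_trans _ _ (\int[S]_(k in cube (2 ^+ n * e)) (spectral_window l 0 k)%:E)%E).
      have ms : measurable_fun (cube (2 ^+ n * e)) (fun k => (spectral_window l 0 k)%:E).
        by apply: measurable_funTS; exact: measurable_int ii.
      have q0 : (0 <= ((c * l ^+ 2) ^+ d)%:E)%E.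
        by rewrite lee_fin exprn_ge0// mulr_ge0 ?sqr_ge0// ltW.
      by apply: ge0_le_integral.
    apply: ge0_subset_integral => //; first exact: measurable_int ii.
    by move=> k _; rewrite lee_fin; exact: spectral_window_ge0.
  split; last exact: le_trans v0 vV.
  have q0 : 0 < (c * l ^+ 2) ^+ d by rewrite exprn_gt0// mulr_gt0// exprn_gt0.
  have -> : V * c^-1 ^+ d * (2 ^+ n) ^+ d.*2 = V / (c * l ^+ 2) ^+ d.
    rewrite -mulrA; congr (_ * _); rewrite -muln2 mulnC exprM -exprMn -exprVn; congr (_ ^+ _).
    by rewrite /l; field; rewrite !gt_eqF.
  by rewrite [V / _]mulrC EFinM lee_pdivlMl//; apply: le_trans le1 _; rewrite lee_fin.
have [_ V0] := bound 0%N.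
split; last by move=> n; have [] := bound n.
by rewrite mulr_ge0// exprn_ge0// invr_ge0 ltW.
Qed.

(** W is the sum of the indicators of dyadic cubes with weights 2^(-n(2d+1)). One power more than
    the growth 2^(2dn) of their S-measures makes the integral at most the geometric sum 2 M; W thus
    stands in for |k|^-(2d+1) at large k. *)
Lemma structure_function_majorant : exists (W : euclid R d -> \bar R) (e : R),
  [/\ 0 < e, measurable_fun setT W, (forall k, 0 <= W k)%E, (\int[S]_k W k < +oo)%E &
   forall n k, cube (2 ^+ n * e) k -> (((2 ^+ n)^-1 ^+ d.*2.+1)%:E <= W k)%E].
Proof.
have [e e0 [M [M0 hM]]] := structure_function_cube.
pose w (n : nat) (k : euclid R d) : \bar R := (((2 ^+ n)^-1 ^+ d.*2.+1) * \1_(cube (2 ^+ n * e)) k)%:E.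
have a0 n : 0 <= (2 ^+ n)^-1 ^+ d.*2.+1 :> R by rewrite exprn_ge0// invr_ge0 exprn_ge0.
have w0 n k : (0 <= w n k)%E by rewrite lee_fin mulr_ge0// indicE ler0n.
have mw n : measurable_fun setT (w n).
  apply/measurable_EFinP; apply: measurable_funM => //.
  by apply: measurable_indic; exact: measurable_cube.
exists (fun k => \sum_(n <oo) w n k)%E, e; split => //.
- by apply: ge0_emeasurable_sum => // n k _ _; exact: w0.
- by move=> k; exact: nneseries_ge0.
- rewrite integral_nneseries//.
  apply: (@le_lt_trans _ _ ((2 * M)%:E)%E); last exact: ltry.
  apply: le_trans (@epsilon_trick0 R (2 * M) xpredT _); last by rewrite mulr_ge0.
  apply: lee_nneseries => [n _ _|n _]; first exact: integral_ge0.
  rewrite /w; under eq_integral do rewrite EFinM.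
  rewrite ge0_integralZl//; last by apply/measurable_EFinP; apply: measurable_indic; exact: measurable_cube.
  rewrite integral_indic ?setIT//; last exact: measurable_cube.
  apply: (@le_trans _ _ ((((2 ^+ n)^-1 ^+ d.*2.+1)%:E * (M * (2 ^+ n) ^+ d.*2)%:E))%E).
    by rewrite lee_wpmul2l// lee_fin.
  rewrite -EFinM lee_fin le_eqVlt; apply/orP; left; apply/eqP.
  have p2 : 2 ^+ n != 0 :> R by rewrite expf_neq0.
  rewrite natrX [in RHS]exprS exprS exprVn; field.
  by rewrite p2 expf_neq0.
- move=> n k hk.
  apply: (@le_trans _ _ (\sum_(0 <= i < n.+1) w i k)%E); last exact: nneseries_lim_ge.
  rewrite big_nat_recr//= -[leLHS]add0e; apply: leeD; first exact: sume_ge0.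
  by rewrite /w indicE mem_set// mulr1.
Qed.

Variables (U : set 'rV[R]_d) (a : 'rV[R]_d).
Hypotheses (oU : open U) (SU : S U = 0%E) (Ua : U (- a)).

(** Decay of order d + 1 of [bump_hat], squared, gives (l |v|)^-(2d+2) for v = k + a, and the
    prefactor l^(2d) leaves l^-2 |v|^-(2d+2). Off U the vector v stays away from 0, so |v| controls
    the dyadic size of k and the remaining power is dominated by W. *)
Lemma spectral_window_le (W : euclid R d -> \bar R) (e : R) : 0 < e ->
  (forall n k, cube (2 ^+ n * e) k -> (((2 ^+ n)^-1 ^+ d.*2.+1)%:E <= W k)%E) ->
  exists2 C : R, 0 <= C & forall (l : R) (k : 'rV[R]_d), 0 < l -> ~ U k ->
    ((spectral_window l a k)%:E <= (C * l^-1 ^+ 2)%:E * W k)%E.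
Proof.
move=> e0 hW.
have /nbhs_ballP[r /= r0 rU] : nbhs (- a) U by exact: open_nbhs_nbhs.
have mass0 := @bump_mass_gt0 R.
have [C hC] := schwartz1_decay d.+1 (@schwartz1_bump_hat R).
(* B ensures 2^n <= B |v| for the least n with |k| <= 2^n e: minimality gives 2^n <= 1 + 2 |k| / e,
   and one uses |k| <= |v| + |a| together with 1 <= |v| / r. *)
pose B := (1 + 2 * `|a| / e) / r + 2 / e.
have B0 : 0 < B by rewrite addr_gt0// ?divr_gt0// ltr_pwDl// divr_ge0 ?mulr_ge0// ltW.
pose D := (bump_mass^-1 * C ^+ 2) ^+ d.
have D0 : 0 <= D by rewrite exprn_ge0// mulr_ge0 ?sqr_ge0// invr_ge0 ltW.
exists (D * B ^+ d.*2.+2); first by rewrite mulr_ge0// exprn_ge0// ltW.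
move=> l k l0 nUk; pose v := k + a.
have vr : r <= `|v|.
  rewrite leNgt; apply/negP => h; apply: nUk; apply: rU; rewrite -ball_normE /ball_/=.
  by rewrite -normrN opprB opprK.
have v0 : 0 < `|v| by exact: lt_le_trans vr.
have lv0 : 0 < l * `|v| by rewrite mulr_gt0.
have [n nk n2] : exists2 n, cube (2 ^+ n * e) k & 2 ^+ n <= B * `|v|.
  have ex : exists n, `|k| <= 2 ^+ n * e.
    exists (Num.truncn (`|k| / e)).+1; rewrite -ler_pdivrMr// ltW//.
    apply: lt_le_trans (truncnS_gt _) _.
    by rewrite -natrX ler_nat ltnW// ltn_expl.
  have [n hn nmin] := ex_minnP ex; exists n.
    by move=> j; apply: le_trans hn; exact: norm_coord_le.
  have kv : `|k| <= `|v| + `|a|.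
    by have := ler_normB v a; rewrite /v addrK.
  have h2 : 2 ^+ n <= 1 + 2 * `|k| / e.
    case: n nmin {hn} => [|m] nmin; first by rewrite expr0 lerDl divr_ge0 ?mulr_ge0// ltW.
    have : 2 ^+ m * e < `|k| by rewrite ltNge; apply/negP => /nmin; rewrite ltnn.
    rewrite -ltr_pdivlMr// => h; rewrite exprS; apply: (@le_trans _ _ (2 * (`|k| / e))).
      by rewrite ler_wpM2l// ltW.
    by rewrite mulrA lerDr.
  apply: le_trans h2 _; apply: (@le_trans _ _ (1 + 2 * (`|v| + `|a|) / e)).
    by rewrite lerD2l ler_wpM2r ?invr_ge0 ?(ltW e0)// ler_wpM2l.
  have h1 : 1 <= `|v| / r by rewrite ler_pdivlMr// mul1r.
  have q0 : 0 <= 1 + 2 * `|a| / e by rewrite addr_ge0// divr_ge0 ?mulr_ge0// ltW.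
  have := ler_wpM2l q0 h1; rewrite mulr1 => h3.
  have -> : B * `|v| = (1 + 2 * `|a| / e) * (`|v| / r) + 2 * `|v| / e by rewrite /B; ring.
  have -> : 1 + 2 * (`|v| + `|a|) / e = 1 + 2 * `|a| / e + 2 * `|v| / e by ring.
  by rewrite lerD2r.
have win j : window l (k 0 j + a 0 j) <= bump_mass^-1 * C ^+ 2 * l ^+ 2 * ((1 + `|l * v 0 j|) ^+ d.+1) ^- 2.
  have q0 : 0 < (1 + `|l * v 0 j|) ^+ d.+1 by rewrite exprn_gt0// ltr_pwDl.
  have -> : bump_mass^-1 * C ^+ 2 * l ^+ 2 * ((1 + `|l * v 0 j|) ^+ d.+1) ^- 2 =
      bump_mass^-1 * (l ^+ 2 * (C / (1 + `|l * v 0 j|) ^+ d.+1) ^+ 2).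
    by rewrite exprMn exprVn; ring.
  have -> : k 0 j + a 0 j = v 0 j by rewrite /v mxE.
  rewrite /window ler_wpM2l ?invr_ge0 ?(ltW mass0)// exprMn.
  rewrite ler_wpM2l ?sqr_ge0// -[leLHS]real_normK ?num_real//.
  have h : `|bump_hat (l * v 0 j)| <= C / (1 + `|l * v 0 j|) ^+ d.+1.
    by rewrite ler_pdivlMr// mulrC; exact: hC.
  by apply: lerXn2r => //; rewrite nnegrE (le_trans _ h).
have le1 : spectral_window l a k <= D * l^-1 ^+ 2 * (`|v|^-1) ^+ d.*2.+2.
  apply: (@le_trans _ _ (\prod_j (bump_mass^-1 * C ^+ 2 * l ^+ 2 * ((1 + `|l * v 0 j|) ^+ d.+1) ^- 2))).
    by apply: ler_prod => j _; rewrite window_ge0 win.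
  rewrite big_split/= prodr_const card_ord exprMn -/D.
  rewrite prodfV !prodrXl.
  have h := one_norm_le_prod (l *: v).
  have hn : `|l *: v| = l * `|v| by rewrite normrZ gtr0_norm.
  rewrite hn in h.
  have h3 : l * `|v| <= \prod_j (1 + `|l * v 0 j|).
    apply: le_trans (le_trans _ h) _; first by rewrite lerDr.
    by apply: ler_prod => j _; rewrite addr_ge0//= mxE.
  have p0 : 0 < \prod_j (1 + `|l * v 0 j|) by exact: lt_le_trans h3.
  rewrite -[leLHS]mulrA -[leRHS]mulrA ler_wpM2l//.
  apply: (@le_trans _ _ ((l ^+ 2) ^+ d * ((l * `|v|) ^+ d.+1 ^- 2))).
    apply: ler_wpM2l; first by rewrite exprn_ge0// sqr_ge0.
    rewrite lef_pV2 ?posrE ?exprn_gt0//.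
    by rewrite -!exprM; apply: lerXn2r; rewrite // nnegrE ltW.
  rewrite le_eqVlt; apply/orP; left; apply/eqP.
  rewrite -!exprVn -!exprM muln2 mul2n doubleS invfM exprMn mulrA; congr (_ * _).
  have ln : l != 0 by rewrite gt_eqF.
  rewrite -[d.*2.+2]addn2 exprD mulrA -exprMn mulfV// expr1n mul1r//.
apply: (@le_trans _ _ (D * l^-1 ^+ 2 * (`|v|^-1) ^+ d.*2.+2)%:E); first by rewrite lee_fin.
apply: (@le_trans _ _ ((D * B ^+ d.*2.+2 * l^-1 ^+ 2)%:E * ((2 ^+ n)^-1 ^+ d.*2.+1)%:E)%E); last first.
  apply: lee_wpmul2l; last exact: hW.
  rewrite lee_fin; apply: mulr_ge0; last exact: sqr_ge0.
  by apply: mulr_ge0 => //; rewrite exprn_ge0// ltW.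
rewrite -EFinM lee_fin [leLHS]mulrAC [leRHS]mulrAC ler_wpM2r ?sqr_ge0//.
rewrite -[leRHS]mulrA ler_wpM2l//.
have p2 : 0 < 2 ^+ n :> R by rewrite exprn_gt0.
apply: (@le_trans _ _ (B ^+ d.*2.+2 * ((2 ^+ n)^-1) ^+ d.*2.+2)).
  rewrite -exprMn; apply: lerXn2r; rewrite ?nnegrE ?invr_ge0 ?(ltW v0)//.
    by rewrite mulr_ge0 ?invr_ge0 ?(ltW p2) ?(ltW B0).
  by rewrite -[leRHS]invrK lef_pV2 ?posrE// ?invr_gt0 ?mulr_gt0 ?invr_gt0// invfM invrK ler_pdivrMl// mulrC.
rewrite ler_wpM2l ?exprn_ge0 ?(ltW B0)// [leLHS]exprS ler_piMl ?exprn_ge0 ?invr_ge0 ?(ltW p2)//.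
by rewrite invf_le1// exprn_ege1// ler1n.
Qed.

(** Integrating the pointwise bound off the S-null set U leaves a variance of order (n + 1)^-2. *)
Lemma wave_packet_variance_cvg0 : (fun n : nat => variance n.+1%:R a) @ \oo --> 0.
Proof.
have [W [e [e0 mW W0 iW hW]]] := structure_function_majorant.
have [C C0 hC] := spectral_window_le e0 hW.
have le (n : nat) : (\int[S]_k (spectral_window n.+1%:R a k)%:E <= (C * n.+1%:R^-1 ^+ 2)%:E * \int[S]_k W k)%E.
  have l0 : 0 < n.+1%:R :> R by rewrite ltr0n.
  have [i1 _] := wave_packet_variance a l0.
  have c0 : 0 <= C * n.+1%:R^-1 ^+ 2 by rewrite mulr_ge0// sqr_ge0.
  rewrite -ge0_integralZl//.
  apply: ae_ge0_le_integral => //.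
  - by move=> k _; rewrite lee_fin; exact: spectral_window_ge0.
  - exact: measurable_int i1.
  - by move=> k _; rewrite mule_ge0.
  - by apply: emeasurable_funM.
  - exists U; split => //; first exact: sub_gen_smallest.
    by move=> k /= h; apply: contrapT => nU; apply: h => _; exact: hC.
have iW0 : (0 <= \int[S]_k W k)%E by exact: integral_ge0.
have iWf : (\int[S]_k W k)%E \is a fin_num by rewrite ge0_fin_numE.
have cB : (fun n : nat => C * n.+1%:R^-1 ^+ 2 * fine (\int[S]_k W k)%E) @ \oo --> 0.
  have h1 : (fun n : nat => n.+1%:R^-1 * n.+1%:R^-1 : R) @ \oo --> (0 * 0 : R).
    by apply: cvgM; exact: cvg_harmonic.
  have h2 : (fun n : nat => C * (n.+1%:R^-1 * n.+1%:R^-1) * fine (\int[S]_k W k)%E) @ \oo -->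
      C * (0 * 0) * fine (\int[S]_k W k)%E.
    by apply: cvgM; [apply: cvgM => //; exact: cvg_cst|exact: cvg_cst].
  by move: h2; rewrite !mulr0 mul0r.
apply: (squeeze_cvgr _ (cvg_cst 0) cB); apply: nearW => n.
have l0 : 0 < n.+1%:R :> R by rewrite ltr0n.
have [i1 ->] := wave_packet_variance a l0.
have i0 : (0 <= \int[S]_k (spectral_window n.+1%:R a k)%:E)%E.
  by apply: integral_ge0 => k _; rewrite lee_fin; exact: spectral_window_ge0.
rewrite fine_ge0//=.
have -> : C * n.+1%:R^-1 ^+ 2 * fine (\int[S]_k W k)%E = fine ((C * n.+1%:R^-1 ^+ 2)%:E * \int[S]_k W k)%E.
  by rewrite fineM.
by rewrite fine_le// ?fin_numM//; exact: integrable_fin_num.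
Qed.

End spectral_growth.

Lemma stealthy_determinedR {R : realType} {d} {dO} {Omega : measurableType dO}
    (P : probability Omega R) (Xi : {RV P >-> cmeasR R d}) (D : set (euclid R d))
    (mD : measurable D) :
  second_order P Xi -> generalized_stealthyR P Xi -> boundedR D ->
  exists2 F : cmeasR R d -> cmeasR R d, measurable_fun [set: cmeasR R d] F &
    {ae P, forall w, restrictR mD (Xi w) = F (restrictR (measurableC mD) (Xi w))}.
Proof.
move=> P2 [beta [S [U [Hb HS oU [k Uk] SU]]]] bD.
have mXi : measurable_fun setT Xi by exact: measurable_funP.
(* The packet with phase a has its spectral window centred at -a, hence the reflection of U. *)
apply: (@vanishing_variance_determinedR _ _ _ _ _ _ D mD (fun a => U (- a))) => //.
- by apply: open_comp oU => a _; exact: opp_continuous.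
- by exists (- k); rewrite opprK.
- move=> a Ua; exists (fun n => cube n.+1%:R), (fun n => wave_packet n.+1%:R a); split.
  + by move=> n; split; [exact: measurable_cube|exact: bounded_cube].
  + by move=> n; apply: wave_packet_bounded; rewrite ltr0n.
  + by move=> n x; exact: wave_packet_le1.
  + move=> x; rewrite -[X in ccvg _ X]mul1r; apply: ccvgM; last exact: ccvg_cst.
    split => /=; last exact: cvg_cst.
    elim: (index_enum _) => [|j r IH].
      by under eq_fun do rewrite big_nil; exact: cvg_cst.
    under eq_fun do rewrite big_cons.
    have c1 : (fun n : nat => n.+1%:R^-1 * (x : 'rV[R]_d) 0 j) @ \oo --> 0 * (x : 'rV[R]_d) 0 j.
      by apply: cvgM; [exact: cvg_harmonic|exact: cvg_cst].
    rewrite mul0r in c1.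
    have c2 : (fun n : nat => bump (n.+1%:R^-1 * (x : 'rV[R]_d) 0 j)) @ \oo --> (bump 0 : R).
      by apply: (cvg_comp _ _ c1); exact: continuous_bump.
    rewrite bump0 in c2.
    have : (fun n : nat => bump (n.+1%:R^-1 * (x : 'rV[R]_d) 0 j) *
       \prod_(i <- r) bump (n.+1%:R^-1 * (x : 'rV[R]_d) 0 i)) @ \oo --> (1 * 1 : R) by apply: cvgM.
    by rewrite mulr1.
  + exact: (wave_packet_variance_cvg0 mXi P2 Hb HS oU SU Ua).
Qed.

Theorem theorem1p4 (R : realType) (d : nat) (d_gt0 : (0 < d)%N)
    (disp : measure_display) (Omega : measurableType disp)
    (P : probability Omega R) :
  (forall Xi : {RV P >-> cmeasR R d},
     second_order P Xi -> translation_invariantR P Xi ->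
     generalized_stealthyR P Xi ->
     forall (D : set (euclid R d)) (mD : measurable D),
       boundedR D ->
       exists2 F : cmeasR R d -> cmeasR R d,
         measurable_fun [set: cmeasR R d] F &
         {ae P, forall w,
            restrictR mD (Xi w) = F (restrictR (measurableC mD) (Xi w))}) /\
  (forall Xi : {RV P >-> cmeasZ R d},
     second_order P Xi -> translation_invariantZ P Xi ->
     generalized_stealthyZ P Xi ->
     forall D : set (lattice d), finite_set D ->
       exists2 F : cmeasZ R d -> cmeasZ R d,
         measurable_fun [set: cmeasZ R d] F &
         {ae P, forall w,
            restrictZ D (Xi w) = F (restrictZ (~` D) (Xi w))}).
Proof.
split=> Xi P2 _ stealthy D; first by move=> mD bD; exact: stealthy_determinedR.
by move=> fD; exact: stealthy_determinedZ.
Qed.
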